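(* Let $(u,\nabla)$ be a stable solution to the self-dual Yang--Mills--Higgs equations in $\mathbf{R}^4$, $$\nabla^*\nabla u=\tfrac12(1-|u|^2)u,\qquad d^*F_\nabla=\langle\nabla u,iu\rangle,$$ and suppose that there is a constant $C>0$ such that $$\int_{B_R}e(u,\nabla)\le C R^2\qquad\text{for all }R\ge 1 .$$ Then there exists a constant orthogonal complex structure $J$ on $\mathbf{R}^4$ for which $(u,\nabla)$ solves on $\mathbf{R}^4$ the first order system $$(\nabla u)^{0,1}_J=0,\qquad F^{0,2}_{\nabla;J}=0,\qquad \Lambda_J F_\nabla=h(u).$$
   Context: $\mathbf{R}^n$ carries the Euclidean metric $g$ and $B_R$ is the ball of radius $R$ centred at the origin. Every Hermitian line bundle on $\mathbf{R}^n$ is trivial, so a pair $(u,\nabla)$ consists of a smooth function $u:\mathbf{R}^n\to\mathbf{C}$ and a connection $\nabla=\nabla^A=d-iA$ with $A$ a smooth real-valued one-form. The real curvature two-form is $F_\nabla=F_A=i\nabla^2=dA$. On $\mathbf{C}$, $\langle a,b\rangle=\mathrm{Re}(a\overline b)$. Two-forms carry the norm with $|F|^2=\sum_{j<k}F_{jk}^2$ in an orthonormal frame, with the corresponding inner product. Set $$h(u)=\tfrac12(1-|u|^2),\qquad e(u,\nabla)=|\nabla u|^2+|F_\nabla|^2+\tfrac14(1-|u|^2)^2 .$$ The Yang--Mills--Higgs equations are the Euler--Lagrange equations of $E(u,\nabla)=\frac12\int e(u,\nabla)$; here $\langle\nabla u,iu\rangle$ is the real one-form $X\mapsto\langle\nabla_Xu,iu\rangle$.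 Stability: a solution is stable if, for every compactly supported smooth pair $(\phi,\Phi)$ ($\phi$ a complex-valued function, $\Phi$ a real-valued one-form), the second variation of the energy is nonnegative: $$\int |\nabla^A\phi-i\Phi u|^2-2\langle\nabla^Au,i\Phi\phi\rangle+|d\Phi|^2+\langle u,\phi\rangle^2-h(u)|\phi|^2\ \ge 0 .$$ Complex structures: a constant orthogonal complex structure $J$ on $\mathbf{R}^4$ is a constant linear isometry with $J^2=-\mathrm{Id}$ (either induced orientation is allowed). Its Kähler form is $\omega_J(X,Y)=g(JX,Y)$, and $\Lambda_J\beta=\langle\beta,\omega_J\rangle$ for real two-forms $\beta$ (so $|\omega_J|^2=2$). The $(0,1)$ part is $(\nabla u)^{0,1}_J(X)=\frac12(\nabla_Xu+i\nabla_{JX}u)$, and $F^{0,2}_{\nabla;J}$ is the $(0,2)$ component of $F_\nabla$ with respect to $J$; since $F_\nabla$ is real, $F^{0,2}_{\nabla;J}=0$ is equivalent to $F_\nabla(JX,JY)=F_\nabla(X,Y)$ for all $X,Y$. *)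

(* Defs.v *)
From HB Require Import structures.
From mathcomp Require Import all_boot all_order all_algebra.
From mathcomp Require Import all_classical all_reals all_analysis.
From mathcomp Require Import complex.

Set Implicit Arguments.
Unset Strict Implicit.
Unset Printing Implicit Defensive.

Import Order.TTheory GRing.Theory Num.Theory.
Import numFieldNormedType.Exports.

Local Open Scope classical_set_scope.
Local Open Scope ring_scope.
Local Open Scope complex_scope.

(* Points, vectors and one-forms of R^4 are all rows.  The norm instance on
   ['rV[R]_4] is the sup norm: only its topology and the derivatives ['D_v],
   which do not depend on the choice of norm, are used, and every metric
   quantity goes through [euclid]. *)
Section YangMillsHiggs.
Variable R : realType.

Local Notation V := 'rV[R]_4.
Local Notation C := R[i].
Local Notation Rb := (measurableTypeR R).
Local Notation mu := (@lebesgue_measure R).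

Implicit Types (x X Y : V) (u phi : V -> C) (A Phi : V -> V) (J : 'M[R]_4).

Definition coordvec (j : 'I_4) : V := delta_mx 0 j.

Definition euclid X Y : R := \sum_j X 0 j * Y 0 j.

Definition euclid_ball (r : R) : set V := [set x | Num.sqrt (euclid x x) < r].

Definition partials (s : seq 'I_4) (f : V -> R) : V -> R :=
  foldr (fun j (g : V -> R) => 'D_(coordvec j) g) f s.

Definition smooth (f : V -> R) : Prop :=
  forall s : seq 'I_4, continuous (partials s f) /\
    forall (j : 'I_4) x, derivable (partials s f) x (coordvec j).

Definition smooth_fun u : Prop :=
  smooth (fun x => complex.Re (u x)) /\ smooth (fun x => complex.Im (u x)).

Definition smooth_form A : Prop := forall j : 'I_4, smooth (fun x => A x 0 j).

Definition compactly_supported (T : zmodType) (f : V -> T) : Prop :=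
  compact (closure [set x | f x != 0]).

Definition row4 (p : (Rb * Rb * Rb * Rb)%type) : V :=
  \row_j nth 0 [:: p.1.1.1; p.1.1.2; p.1.2; p.2] j.

Definition lebesgue4 :
    {measure set (Rb * Rb * Rb * Rb)%type -> \bar R} :=
  (mu \x mu \x mu \x mu)%E.

(* ['rV[R]_4] has no measurable structure in the library, hence the transport
   along [row4]. *)
Definition integral4 (D : set V) (f : V -> R) : \bar R :=
  (\int[lebesgue4]_(p in row4 @^-1` D) (f (row4 p))%:E)%E.

Definition cinner (a b : C) : R := complex.Re (a * b^*).

Definition inner2 (F G : 'M[R]_4) : R :=
  \sum_(j < 4) \sum_(k < 4 | (j < k)%N) F j k * G j k.

Definition eval2 (F : 'M[R]_4) X Y : R := \sum_j \sum_k F j k * X 0 j * Y 0 k.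

Definition dirderiv X u : V -> C := fun x =>
  ('D_X (fun y => complex.Re (u y)) x) +i* ('D_X (fun y => complex.Im (u y)) x).

(* [nabla A u x X] is (nabla^A_X u)(x) for nabla^A = d - iA. *)
Definition nabla A u x X : C :=
  dirderiv X u x - 'i * (euclid (A x) X)%:C * u x.

(* (dA)_{jk}, which is the real curvature i (nabla^A)^2. *)
Definition dform A x : 'M[R]_4 := \matrix_(j, k)
  ('D_(coordvec j) (fun y => A y 0 k) x - 'D_(coordvec k) (fun y => A y 0 j) x).

(* The formal L^2-adjoint of [nabla A] on C-valued one-forms:
   nabla^* alpha = - sum_j nabla_j (alpha_j), since i A_j is skew-adjoint. *)
Definition nabla_adj A (alpha : V -> V -> C) x : C :=
  - \sum_j nabla A (fun y => alpha y (coordvec j)) x (coordvec j).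

(* The formal L^2-adjoint of [dform] for the inner product [inner2], as a row of
   components: (d^*F)_k = - sum_j d_j F_jk. *)
Definition dform_adj (F : V -> 'M[R]_4) x : V :=
  \row_k - \sum_j 'D_(coordvec j) (fun y => F y j k) x.

Definition higgs u x : R := 2^-1 * (1 - cinner (u x) (u x)).

Definition energy_density u A x : R :=
  (\sum_j cinner (nabla A u x (coordvec j)) (nabla A u x (coordvec j)))
  + inner2 (dform A x) (dform A x)
  + 4^-1 * (1 - cinner (u x) (u x)) ^+ 2.

Definition ymh_solution u A : Prop := forall x,
  nabla_adj A (nabla A u) x = (2^-1 * (1 - cinner (u x) (u x)))%:C * u x /\
  dform_adj (dform A) x = \row_j cinner (nabla A u x (coordvec j)) ('i * u x).

Definition second_variation_density u A phi Phi x : R :=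
  (\sum_j (let v := nabla A phi x (coordvec j) - 'i * (Phi x 0 j)%:C * u x in
           cinner v v))
  - 2 * (\sum_j cinner (nabla A u x (coordvec j)) ('i * (Phi x 0 j)%:C * phi x))
  + inner2 (dform Phi x) (dform Phi x)
  + cinner (u x) (phi x) ^+ 2
  - higgs u x * cinner (phi x) (phi x).

Definition ymh_stable u A : Prop := forall phi Phi,
  smooth_fun phi -> smooth_form Phi ->
  compactly_supported phi -> compactly_supported Phi ->
  (0 <= integral4 setT (second_variation_density u A phi Phi))%E.

(* Vectors being rows, [J] acts by [X *m J]. *)
Definition orthogonal_complex_structure J : Prop :=
  (forall X Y, euclid (X *m J) (Y *m J) = euclid X Y) /\
  (forall X, X *m J *m J = - X).

Definition kahler_form J : 'M[R]_4 :=
  \matrix_(j, k) euclid (coordvec j *m J) (coordvec k).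

Definition Lambda J (F : 'M[R]_4) : R := inner2 F (kahler_form J).

Definition part01 J (alpha : V -> C) : V -> C := fun X =>
  2^-1 * (alpha X + 'i * alpha (X *m J)).

(* The (0,2) component: the complex bilinear extension of [F] restricted to
   T^{0,1}, i.e. both arguments are projected as in [part01]. *)
Definition part02 J (F : 'M[R]_4) X Y : C :=
  part01 J (fun X' => part01 J (fun Y' => (eval2 F X' Y')%:C) Y) X.

Definition vortex_equations u A J : Prop := forall x,
  [/\ forall X, part01 J (nabla A u x) X = 0,
      forall X Y, part02 J (dform A x) X Y = 0
    & Lambda J (dform A x) = higgs u x].

End YangMillsHiggs.

(* Main.v *)
Require Import Defs.
From HB Require Import structures.
From mathcomp Require Import all_boot all_order all_algebra.
From mathcomp Require Import all_classical all_reals all_analysis.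
From mathcomp Require Import complex.
From mathcomp Require Import measurable_realfun.
From mathcomp Require Import ring lra.
Set Implicit Arguments.
Unset Strict Implicit.
Unset Printing Implicit Defensive.
Import Order.TTheory GRing.Theory Num.Theory.
Import numFieldNormedType.Exports.
Local Open Scope classical_set_scope.
Local Open Scope ring_scope.

(** Write F = F^+ + F^-, let f and f' be the two halves as vectors in R^3 with f . v = <F, J_v>,
    where J_v runs over the complex structures of one orientation (J'_v for the other), and let
    psi, psi' be the halves of the vorticity form psi(X, Y) = 2 <i nabla_X u, nabla_Y u>.
    The equations give lap h = |u|^2 h - |nabla u|^2 and lap f = |u|^2 f - psi, and pointwise
    |nabla u|^2 - psi . v = 1/2 |nabla u + i nabla_J u|^2 >= 0 for unit v ([sqsum_rot]).  So if
    f . v = h everywhere for a constant unit v, then nabla u is complex linear for J_v; if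
    moreover |f| <= h then f = h v, which is the rest of the vortex equations.  The proof finds
    such a v.

    First, |f| <= h and |f'| <= h ([curvature_le]): f . v - h satisfies a maximum principle, and
    quadratic growth of the energy in dimension 4 provides logarithmic cutoffs ([log_cutoff])
    for which Caccioppoli's inequality leaves no positive part.

    Second, stability is tested with phi_i = i eta nabla_i u and Phi_i = - eta N_i, i = 1, .., 4,
    where N = 1/2 (h Id - m) and m is the product J J' of the complex structures in the
    directions of f and f', times the positive part of |f| + |f'| - h ([stability_trace],
    [testN]).  Bochner's formula removes the second derivatives of u, and the remaining
    integrand is estimated by a sum of squares: |f||f'||nabla u|^2 - |f'| f . psi - |f| f' . psi'
    minus the trace of J_f J'_f' against Re <nabla_i u, nabla_j u> is a multiple of
    |(|f| + i J_f)(|f'| + i J'_f') nabla u|^2 ([mixed_bound]).  The terms in dN combine with the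
    Laplacians of h, |f| and |f'|; [stability_slack] bounds what is lost in these estimates, and
    letting the cutoffs exhaust R^4 all losses vanish.  Norms and positive part are smoothed
    at scale d, and d tends to 0 after the cutoff is fixed ([no_uniform_slack]).

    The losses give, where |f'| < h: |f||nabla u|^2 = f . psi ([gradient_aligned]); the direction
    of f is parallel if also |f| + |f'| > h ([direction_parallel]); and dh = 0 where
    |f| + |f'| <= h on an open set ([higgs_locally_constant]).  If |f| < h and |f'| < h at a
    point where u does not vanish, each case is contradictory ([one_half_saturated]): in the
    first, the Bianchi identity and d^* F = <nabla u, i u> give d|f| = dh, against the equations
    for lap |f| and lap h; in the second nabla u = 0 follows.  Hence |f| = h (or |f'| = h) on an
    open set, and comparing the Laplacians of |f|^2 and h^2 there shows that f / h is a constant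
    v ([saturated_direction]).  Finally w = h - f . v >= 0 satisfies lap w <= w and vanishes on
    that open set, so it vanishes identically ([unique_continuation]). *)

(** * Directional derivatives *)

Section DirectionalCalculus.
Variables (R : realType) (V : normedModType R).
Implicit Types (f g : V -> R) (x v : V).

Lemma is_derive_line f x v (t d : R) :
  is_derive (t *: v + x) v f d -> is_derive t 1 (fun s => f (s *: v + x)) d.
Proof.
move=> [df <-].
have E : (fun h : R => h^-1 *: (((fun s => f (s *: v + x)) \o shift t) (h *: 1) -
            f (t *: v + x))) =
         (fun h => h^-1 *: ((f \o shift (t *: v + x)) (h *: v) - f (t *: v + x))).
  by apply/funext => h /=; rewrite scalerDl [h *: 1]mulr1 addrA.
by split; rewrite /derivable /derive E.
Qed.

Lemma is_derive_of_line f x v (d : R) :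
  is_derive (0 : R) 1 (fun s => f (s *: v + x)) d -> is_derive x v f d.
Proof.
have E : (fun h : R => h^-1 *: (((fun s => f (s *: v + x)) \o shift 0) (h *: 1) -
            f (0 *: v + x))) =
         (fun h => h^-1 *: ((f \o shift x) (h *: v) - f x)).
  by apply/funext => h /=; rewrite addr0 scale0r add0r [h *: 1]mulr1.
by move=> [df <-]; split; move: df; rewrite /derivable /derive E.
Qed.

Lemma is_derive_comp1 f (g : R -> R) x v df dg :
  is_derive x v f df -> is_derive (f x) 1 g dg ->
  is_derive x v (g \o f) (dg * df).
Proof.
move=> Hf Hg; apply: is_derive_of_line.
apply: (@is_derive1_comp _ g (fun s => f (s *: v + x))).
  by rewrite scale0r add0r.
by apply: is_derive_line; rewrite scale0r add0r.
Qed.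

Lemma is_derive_translate f (w x v : V) d :
  is_derive (w + x) v f d -> is_derive x v (fun y => f (w + y)) d.
Proof.
move=> [df <-].
have E : (fun h : R => h^-1 *: (((fun y => f (w + y)) \o shift x) (h *: v) - f (w + x))) =
         (fun h => h^-1 *: ((f \o shift (w + x)) (h *: v) - f (w + x))).
  by apply/funext => h /=; rewrite addrCA.
by split; rewrite /derivable /derive E.
Qed.

End DirectionalCalculus.

(** * Functions flat at the origin *)

Section FlatFunctions.
Variable R : realType.
Implicit Types (c t : R) (q : {poly R}).

Definition flat c q t : R := if 0 < t then q.[t^-1] * expR (- (c * t^-1)) else 0.

Lemma powM_expRN_le c (n : nat) (s : R) : 0 < c -> 0 < s ->
  s ^+ n * expR (- (c * s)) <= n`!%:R / c ^+ n.
Proof.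
move=> c0 s0.
have cs0 : 0 <= c * s by rewrite mulr_ge0 // ltW.
have le1 : (c * s) ^+ n / n`!%:R <= expR (c * s).
  case: n => [|n]; first by rewrite expr0 divr1 (le_trans _ (expR_ge1Dx _)) // lerDl.
  by rewrite (le_trans _ (expR_ge1Dxn n cs0)) // lerDr.
rewrite ler_pdivlMr ?exprn_gt0 // mulrAC -exprMn [s * c]mulrC expRN.
by move: le1; rewrite !ler_pdivrMr ?expR_gt0 ?ltr0n ?fact_gt0 // [expR _ * _]mulrC.
Qed.

Lemma horner_expRN_bounded c q (n : nat) : 0 < c ->
  exists K : R, forall s : R, 0 < s -> `|q.[s] * (s ^+ n * expR (- (c * s)))| <= K.
Proof.
move=> c0; elim/poly_ind: q n => [|q a IH] n.
  by exists 0 => s _; rewrite horner0 mul0r normr0.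
have [K HK] := IH n.+1.
exists (K + `|a| * (n`!%:R / c ^+ n)) => s s0.
rewrite hornerMXaddC mulrDl (le_trans (ler_normD _ _)) // lerD //.
  by rewrite -mulrA [s * _]mulrA -exprS HK.
rewrite normrM ler_wpM2l // ger0_norm ?powM_expRN_le //.
by rewrite mulr_ge0 ?expR_ge0 // exprn_ge0 // ltW.
Qed.

Lemma flat_le_lin c q : 0 < c -> exists K : R, forall t, `|flat c q t| <= K * `|t|.
Proof.
move=> c0; have [K HK] := horner_expRN_bounded q 1 c0.
have K0 : 0 <= K by rewrite (le_trans _ (HK 1 ltr01)).
exists K => t; rewrite /flat; case: ifPn => t0; last by rewrite normr0 mulr_ge0.
have := HK t^-1; rewrite invr_gt0 => /(_ t0).
rewrite expr1 mulrCA normrM normfV (gtr0_norm t0).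
by rewrite ler_pdivrMl // [t * _]mulrC.
Qed.

(** The class of functions t |-> q(1/t) exp(-c/t), extended by zero to t <= 0, is
    stable under differentiation, which is why these functions are smooth. *)
Lemma is_derive_flat c q t : 0 < c ->
  is_derive t 1 (flat c q) (flat c ('X^2 * (c *: q - q^`())) t).
Proof.
move=> c0; have [t0|t0|t0] := ltgtP t 0.
- have : is_derive t 1 (cst 0 : R -> R) 0 by exact: is_derive_cst.
  rewrite [flat _ _ t]/flat ltNge (ltW t0) /=; apply: near_eq_is_derive.
  near=> z; rewrite /flat ifF //; apply/negbTE; rewrite -leNgt ltW //.
  near: z; exact: lt_nbhsl.
- have dV : is_derive t 1 (@GRing.inv R) (- t ^- 2).
    have := @is_deriveV R id t 1 1 (lt0r_neq0 t0) (is_derive_id _ _).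
    by rewrite /GRing.scale /= mulr1.
  have d1 := is_derive1_comp (is_derive_poly q t^-1) dV.
  have d2 : is_derive t 1 (fun z : R => expR (- (c * z^-1)))
                 (expR (- (c * t^-1)) * (- (c * - t ^- 2))).
    apply: (@is_derive1_comp R expR (fun z => - (c * z^-1))).
  have d12 := is_deriveM d1 d2.
  have -> : flat c ('X^2 * (c *: q - q^`())) t =
     q.[t^-1] *: (expR (- (c * t^-1)) * (- (c * - t ^- 2))) +
     expR (- (c * t^-1)) *: (q^`().[t^-1] * - t ^- 2).
    rewrite /flat t0 !(hornerE, hornerXn) /GRing.scale /= -exprVn; ring.
  apply: near_eq_is_derive d12.
  by near=> z; rewrite /flat ifT //; near: z; exact: lt_nbhsr.
- rewrite t0 [flat c _ 0]/flat ltxx.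
  have [K HK] := flat_le_lin ('X * q) c0.
  have L : (fun h : R => h^-1 *: ((flat c q \o shift 0) (h *: 1) - flat c q 0)) @ 0^' --> (0 : R).
    have K1 : 0 < `|K| + 1 by rewrite ltr_wpDl.
    apply/cvgrPdist_le => /= e e0.
    near=> h; rewrite sub0r normrN [flat c q 0]/flat ltxx subr0 /= addr0 [h *: 1]mulr1.
    have -> : h^-1 *: flat c q h = flat c ('X * q) h.
      by rewrite /flat; case: ifP => _; rewrite ?scaler0 // hornerM hornerX /GRing.scale /= mulrA.
    rewrite (le_trans (HK h)) // (@le_trans _ _ ((`|K| + 1) * `|h|)) //.
      by rewrite ler_wpM2r // (le_trans (ler_norm _)) // lerDl.
    rewrite -ler_pdivlMl //; near: h; apply: dnbhs0_le.
    by rewrite mulr_gt0 ?invr_gt0.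
  split; first by apply/cvg_ex; exists 0.
  exact/cvg_lim.
Unshelve. all: by end_near. Qed.

Lemma flat_ge0 c t : 0 <= flat c 1 t.
Proof. by rewrite /flat; case: ifP => // _; rewrite hornerC mul1r expR_ge0. Qed.

Lemma flat_gt0 c t : 0 < t -> 0 < flat c 1 t.
Proof. by move=> t0; rewrite /flat t0 hornerC mul1r expR_gt0. Qed.

Lemma flat_le0 c q t : t <= 0 -> flat c q t = 0.
Proof. by move=> t0; rewrite /flat ltNge t0. Qed.

End FlatFunctions.

(** * Closure properties of smoothness *)

Section SmoothClosure.
Variable R : realType.
Local Notation V := 'rV[R]_4.
Implicit Types (f g : V -> R) (x : V) (j : 'I_4) (s : seq 'I_4).

Lemma partials_derive s j f :
  partials s (fun x => 'D_(coordvec R j) f x) = partials (rcons s j) f.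
Proof. by rewrite /partials foldr_rcons. Qed.

Lemma smooth_derive j f : smooth f -> smooth (fun x => 'D_(coordvec R j) f x).
Proof. by move=> sf s; rewrite partials_derive; exact: sf. Qed.

Lemma smooth_continuous f : smooth f -> continuous f.
Proof. by move=> /(_ [::])[]. Qed.

Lemma smooth_is_derive f j x : smooth f ->
  is_derive x (coordvec R j) f ('D_(coordvec R j) f x).
Proof. by move=> /(_ [::])[_ df]; apply: derivableP; exact: df. Qed.

(** Coinduction for [smooth]: it suffices that every member of some class has
    all its first partial derivatives in that class. *)
Lemma smooth_coind (P : (V -> R) -> Prop) :
  (forall f, P f -> continuous f) ->
  (forall f, P f -> forall j, exists2 g, P g &
     forall x, is_derive x (coordvec R j) f (g x)) ->
  forall f, P f -> smooth f.
Proof.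
move=> Pc Pd f Pf s.
have: P (partials s f).
  elim: s => //= j s Ps; have [g Pg dg] := Pd _ Ps j.
  suff -> : 'D_(coordvec R j) (partials s f) = g by [].
  by apply/funext => x; have [] := dg x.
move=> Ps; split; first exact: Pc.
by move=> j x; have [g _ /(_ x)[]] := Pd _ Ps j.
Qed.

(** All functions met in the proof; the class is closed under differentiation because it contains
    products and, with [flat c q], all derivatives of flat functions. *)
Inductive smooth_gen : (V -> R) -> Prop :=
| gen_base f of smooth f : smooth_gen f
| gen_cst (a : R) : smooth_gen (fun=> a)
| gen_coord j : smooth_gen (fun x => x 0 j)
| gen_add f g of smooth_gen f & smooth_gen g : smooth_gen (fun x => f x + g x)
| gen_mul f g of smooth_gen f & smooth_gen g : smooth_gen (fun x => f x * g x)
| gen_inv f of smooth_gen f & (forall x, 0 < f x) : smooth_gen (fun x => (f x)^-1)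
| gen_sqrt f of smooth_gen f & (forall x, 0 < f x) :
    smooth_gen (fun x => Num.sqrt (f x))
| gen_flat c q f of 0 < c & smooth_gen f : smooth_gen (fun x => flat c q (f x)).

Lemma is_derive_coord x (v : V) j : is_derive x v (fun y : V => y 0 j) (v 0 j).
Proof.
apply: is_derive_of_line.
have -> : (fun t : R => (t *: v + x) 0 j) = (fun t : R => t * v 0 j + x 0 j).
  by apply/funext => t; rewrite !mxE.
have := is_deriveD (is_deriveM (is_derive_id (0 : R) (1 : R)) (is_derive_cst (v 0 j) (0 : R) (1 : R)))
   (is_derive_cst (x 0 j) (0 : R) (1 : R)).
by rewrite scaler0 add0r addr0 /GRing.scale /= mulr1.
Qed.

Lemma smooth_gen_continuous f : smooth_gen f -> continuous f.
Proof.
elim=> {f} [f sf|a|j|f g _ cf _ cg|f g _ cf _ cg|f _ cf f0|f _ cf f0|c q f c0 _ cf] x.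
- exact: smooth_continuous.
- exact: cst_continuous.
- exact: coord_continuous.
- exact: (@continuousD _ _ _ f g x (cf x) (cg x)).
- exact: (@continuousM _ _ f g x (cf x) (cg x)).
- by apply: (@continuousV _ _ f x) (cf x); rewrite gt_eqF.
- apply: (@continuous_comp _ _ _ f Num.sqrt); first exact: cf.
  exact: sqrt_continuous.
- apply: (@continuous_comp _ _ _ f (flat c q)); first exact: cf.
  apply/differentiable_continuous/derivable1_diffP.
  by have [] := is_derive_flat q (f x) c0.
Qed.

Lemma smooth_gen_derive f : smooth_gen f -> forall j, exists2 g, smooth_gen g &
  forall x, is_derive x (coordvec R j) f (g x).
Proof.
elim=> {f} [f sf|a|i|f g sf cf sg cg|f g sf cf sg cg|f sf cf f0|f sf cf f0|c q f c0 sf cf] j.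
- exists (fun x => 'D_(coordvec R j) f x); first exact/gen_base/smooth_derive.
  by move=> x; exact: smooth_is_derive.
- exists (fun=> 0); first exact: gen_cst.
  by move=> x; exact: is_derive_cst.
- exists (fun=> coordvec R j 0 i); first exact: gen_cst.
  by move=> x; exact: is_derive_coord.
- have [f' sf' df] := cf j; have [g' sg' dg] := cg j.
  exists (fun x => f' x + g' x); first exact: gen_add.
  by move=> x; exact: is_deriveD (df x) (dg x).
- have [f' sf' df] := cf j; have [g' sg' dg] := cg j.
  exists (fun x => f x * g' x + g x * f' x).
    by apply: gen_add; apply: gen_mul.
  by move=> x; exact: is_deriveM (df x) (dg x).
- have [f' sf' df] := cf j.
  have ff0 x : 0 < f x * f x by rewrite mulr_gt0.
  exists (fun x => (- 1) * (f x * f x)^-1 * f' x).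
    by do 2?[apply: gen_mul => //]; [exact: gen_cst|apply: gen_inv => //; exact: gen_mul].
  move=> x; apply: is_derive_comp1 => //.
  have := @is_deriveV R id (f x) 1 1 (lt0r_neq0 (f0 x)) (is_derive_id _ _).
  by rewrite /GRing.scale /= mulr1 mulN1r -expr2.
- have [f' sf' df] := cf j.
  have ff0 x : 0 < Num.sqrt (f x) by rewrite sqrtr_gt0.
  exists (fun x => (2 * Num.sqrt (f x))^-1 * f' x).
    apply: gen_mul => //; apply: gen_inv; first by apply: gen_mul; [exact: gen_cst|exact: gen_sqrt].
    by move=> x; rewrite mulr_gt0.
  by move=> x; apply: is_derive_comp1 => //; exact: is_derive1_sqrt.
- have [f' sf' df] := cf j.
  exists (fun x => flat c ('X^2 * (c *: q - q^`())) (f x) * f' x).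
    by apply: gen_mul => //; exact: gen_flat.
  by move=> x; apply: is_derive_comp1 => //; exact: is_derive_flat.
Qed.

Lemma smooth_gen_smooth f : smooth_gen f -> smooth f.
Proof. exact: (smooth_coind smooth_gen_continuous smooth_gen_derive). Qed.

End SmoothClosure.

(** * The ring of smooth functions on R^4 *)

Section SmoothRing.
Variable R : realType.
Local Notation V := 'rV[R]_4.

Definition smooth_pred : {pred (V -> R)} := fun f => `[< smooth f >].

Lemma smooth_pred_subring : subring_closed smooth_pred.
Proof.
split=> [|f g /asboolP/gen_base sf /asboolP/gen_base sg|f g /asboolP/gen_base sf /asboolP/gen_base sg];
  apply/asboolP.
- exact: (smooth_gen_smooth (gen_cst 1)).
- have -> : f - g = fun x => f x + (- 1) * g x by apply/funext => x; rewrite mulN1r.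
  by apply/smooth_gen_smooth/gen_add => //; apply: gen_mul => //; exact: gen_cst.
- exact: (smooth_gen_smooth (gen_mul sf sg)).
Qed.

HB.instance Definition _ := GRing.isSubringClosed.Build (V -> R) smooth_pred smooth_pred_subring.

(** Smooth functions are made into a commutative ring so that identities between derivatives are
    ring identities between atoms [D j f]. *)
Record sfun := SFun { sfun_val :> V -> R; sfun_prop : sfun_val \in smooth_pred }.
HB.instance Definition _ := [isSub for sfun_val].
HB.instance Definition _ := [Choice of sfun by <:].
HB.instance Definition _ := GRing.SubChoice_isSubComPzRing.Build (V -> R) smooth_pred sfun smooth_pred_subring.

Implicit Types (f g : sfun) (x y v : V) (i j : 'I_4).

Lemma sfun_smooth f : smooth f.
Proof. by apply/asboolP; exact: sfun_prop. Qed.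

Definition mk_sfun (f : V -> R) (sf : smooth f) : sfun := SFun (asboolT sf).
Definition gen_sfun (f : V -> R) (sf : smooth_gen f) : sfun := mk_sfun (smooth_gen_smooth sf).

Lemma sfun_gen f : smooth_gen f.
Proof. exact/gen_base/sfun_smooth. Qed.

Lemma sfun_ext f g : (forall x, f x = g x) -> f = g.
Proof. by move=> fg; apply/val_inj/funext. Qed.

Lemma sfun_continuous f : continuous f.
Proof. exact/smooth_continuous/sfun_smooth. Qed.

Definition cstf (a : R) : sfun := gen_sfun (gen_cst a).
Definition coordf j : sfun := gen_sfun (gen_coord R j).
Definition invf f (f0 : forall x, 0 < f x) : sfun := gen_sfun (gen_inv (sfun_gen f) f0).
Definition sqrtf f (f0 : forall x, 0 < f x) : sfun := gen_sfun (gen_sqrt (sfun_gen f) f0).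
Definition flatf c q (c0 : 0 < c) f : sfun := gen_sfun (gen_flat q c0 (sfun_gen f)).

(* Locked, so that [ring] never tries to unfold derivatives to compare atoms. *)
Fact D_key : unit. Proof. exact: tt. Qed.
Definition D : 'I_4 -> sfun -> sfun :=
  locked_with D_key (fun j f => mk_sfun (smooth_derive j (sfun_smooth f))).

Lemma D_val j f x : D j f x = 'D_(coordvec R j) f x.
Proof. by rewrite /D unlock. Qed.

Lemma is_derive_D j f x : is_derive x (coordvec R j) f (D j f x).
Proof. by rewrite D_val; exact/smooth_is_derive/sfun_smooth. Qed.

Lemma sfunDE f g x : (f + g) x = f x + g x. Proof. by []. Qed.
Lemma sfunME f g x : (f * g) x = f x * g x. Proof. by []. Qed.
Lemma sfunNE f x : (- f) x = - f x. Proof. by []. Qed.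
Lemma sfun0E x : (0 : sfun) x = 0. Proof. by []. Qed.
Lemma sfun1E x : (1 : sfun) x = 1. Proof. by []. Qed.
Lemma sfunXE f n x : (f ^+ n) x = f x ^+ n.
Proof. by elim: n => // n IH; rewrite !exprS sfunME IH. Qed.
Lemma sfunMnE f n x : (f *+ n) x = f x *+ n.
Proof. by elim: n => // n IH; rewrite !mulrS sfunDE IH. Qed.
Lemma cstfE a x : cstf a x = a. Proof. by []. Qed.
Lemma coordfE j x : coordf j x = x 0 j. Proof. by []. Qed.
Lemma invfE f (f0 : forall x, 0 < f x) x : invf f0 x = (f x)^-1. Proof. by []. Qed.
Lemma sqrtfE f (f0 : forall x, 0 < f x) x : sqrtf f0 x = Num.sqrt (f x). Proof. by []. Qed.
Lemma flatfE c q (c0 : 0 < c) f x : flatf q c0 f x = flat c q (f x). Proof. by []. Qed.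
Lemma sfun_sumE (I : Type) (r : seq I) (P : pred I) (F : I -> sfun) x :
  (\sum_(k <- r | P k) F k) x = \sum_(k <- r | P k) F k x.
Proof. by elim/big_rec2: _ => // k a b _ <-; rewrite sfunDE. Qed.

Lemma DE j f x (d : R) : is_derive x (coordvec R j) f d -> D j f x = d.
Proof. by rewrite D_val; case. Qed.

Lemma DD j f g : D j (f + g) = D j f + D j g.
Proof. apply/sfun_ext => x; exact: (@DE j (f + g) x _ (is_deriveD (is_derive_D j f x) (is_derive_D j g x))). Qed.

Lemma DM j f g : D j (f * g) = D j f * g + f * D j g.
Proof.
apply/sfun_ext => x; refine (DE _).
have -> : (D j f * g + f * D j g) x = f x *: D j g x + g x *: D j f x.
  by rewrite sfunDE !sfunME addrC [D j f x * g x]mulrC.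
exact: is_deriveM (is_derive_D j f x) (is_derive_D j g x).
Qed.

Lemma D_cst j a : D j (cstf a) = 0.
Proof. by apply/sfun_ext => x; refine (DE _); exact: is_derive_cst. Qed.

Lemma cstf1 : cstf 1 = 1. Proof. exact: sfun_ext. Qed.
Lemma cstfN1 : cstf (- 1) = - 1. Proof. exact: sfun_ext. Qed.

Lemma D1 j : D j 1 = 0. Proof. by rewrite -cstf1 D_cst. Qed.

Lemma DN j f : D j (- f) = - D j f.
Proof. by rewrite -mulN1r -cstfN1 DM D_cst mul0r add0r cstfN1 mulN1r. Qed.

Lemma D0 j : D j 0 = 0.
Proof. by apply: (addrI (D j 0)); rewrite -DD !addr0. Qed.

Lemma Dsum j (I : Type) (r : seq I) (P : pred I) (F : I -> sfun) :
  D j (\sum_(k <- r | P k) F k) = \sum_(k <- r | P k) D j (F k).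
Proof. by elim/big_rec2: _ => [|k a b _ <-]; [exact: D0|rewrite DD]. Qed.

Lemma DMn j f n : D j (f *+ n) = D j f *+ n.
Proof. by elim: n => [|n IH]; rewrite ?D0 // !mulrS DD IH. Qed.

Lemma D_coord i j : D i (coordf j) = (i == j)%:R.
Proof.
apply/sfun_ext => x; rewrite (@DE _ (coordf j) _ _ (is_derive_coord x (coordvec R i) j)).
by rewrite mxE /= eq_sym sfunMnE.
Qed.

Lemma D_flat j c q (c0 : 0 < c) f :
  D j (flatf q c0 f) = flatf ('X^2 * (c *: q - q^`())) c0 f * D j f.
Proof.
apply/sfun_ext => x; refine (DE _); apply: is_derive_comp1; [exact: is_derive_D|exact: is_derive_flat].
Qed.

Lemma invfM f (f0 : forall x, 0 < f x) : invf f0 * f = 1.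
Proof. by apply/sfun_ext => x; rewrite sfunME invfE mulVf // gt_eqF. Qed.

Lemma sqrtf_sqr f (f0 : forall x, 0 < f x) : sqrtf f0 * sqrtf f0 = f.
Proof. by apply/sfun_ext => x; rewrite sfunME sqrtfE -expr2 sqr_sqrtr // ltW. Qed.

Lemma mvt_line (f df : V -> R) v x (t : R) : (forall y, is_derive y v f (df y)) ->
  exists2 c : R, `|c| <= `|t| & f (t *: v + x) - f x = df (c *: v + x) * t.
Proof.
move=> dfE.
have dl (z : R) : is_derive z 1 (fun s : R => f (s *: v + x)) (df (z *: v + x)).
  exact: is_derive_line.
have cl (a b : R) : {within `[a, b], continuous (fun s : R => f (s *: v + x))}.
  by apply: derivable_within_continuous => z _; case: (dl z).
have [t0|t0] := leP 0 t.
  have [//|c] := MVT_segment t0 (fun z _ => dl z).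
  rewrite in_itv /= scale0r add0r subr0 => /andP[c0 ct] E; exists c => //.
  by rewrite !ger0_norm // (le_trans c0).
have [//|c] := MVT_segment (ltW t0) (fun z _ => dl z).
rewrite in_itv /= scale0r add0r sub0r => /andP[c0 ct] E; exists c.
  by rewrite !ler0_norm ?lerN2 // ltW.
by rewrite -opprB E mulrN opprK.
Qed.

Lemma sfun_near f x (e : R) : 0 < e ->
  exists2 d : R, 0 < d & forall y, (forall k, `|y 0 k - x 0 k| < d) -> `|f y - f x| < e.
Proof.
move=> e0; have /cvgrPdist_lt /(_ e e0) := sfun_continuous (f := f) (x := x).
move/nbhs_ballP => [d /= d0 H]; exists d => // y yx.
rewrite distrC; apply: H; split=> // i k; rewrite ord1.
by rewrite /ball /= distrC.
Qed.

(** Second-order difference quotients are symmetric in the two directions, and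
    by the mean value theorem they are values of either mixed derivative. *)
Lemma D_comm i j f : D i (D j f) = D j (D i f).
Proof.
apply/sfun_ext => x; apply/eqP; rewrite -subr_eq0 -normr_le0.
apply/ler_addgt0Pr => e e0; rewrite add0r.
have e2 : 0 < e / 2 by rewrite divr_gt0.
have [d1 d10 H1] := sfun_near (D i (D j f)) x e2.
have [d2 d20 H2] := sfun_near (D j (D i f)) x e2.
pose d := Num.min d1 d2 / 3.
have dm : 0 < Num.min d1 d2 by rewrite lt_min d10.
have d0 : 0 < d by rewrite divr_gt0.
have near_x (a b : R) (k l : 'I_4) m : `|a| <= `|d| -> `|b| <= `|d| ->
    `|(a *: coordvec R k + (b *: coordvec R l + x)) 0 m - x 0 m| < Num.min d1 d2.
  rewrite !mxE /= addrA addrK (gtr0_norm d0) => ad bd.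
  have bb (c : bool) (z : R) : `|z| <= d -> `|z * c%:R| <= d.
    by case: c => zd; rewrite ?mulr1 // mulr0 normr0 ltW.
  rewrite (le_lt_trans (ler_normD _ _)) // (@le_lt_trans _ _ (d + d)) //.
    by rewrite lerD // bb.
  by rewrite /d; lra.
have quotient (k l : 'I_4) : exists a b : R, [/\ `|a| <= `|d|, `|b| <= `|d| &
    f (d *: coordvec R l + (d *: coordvec R k + x)) - f (d *: coordvec R k + x) -
    (f (d *: coordvec R l + x) - f x) =
    D l (D k f) (a *: coordvec R l + (b *: coordvec R k + x)) * d * d].
  have dq y : is_derive y (coordvec R k) (fun y => f (d *: coordvec R l + y) - f y)
      (D k f (d *: coordvec R l + y) - D k f y).
    apply: is_deriveB; last exact: is_derive_D.
    exact/is_derive_translate/is_derive_D.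
  have [b bd Eb] := mvt_line x d dq.
  have [a ad Ea] := mvt_line (b *: coordvec R k + x) d (is_derive_D l (D k f)).
  by exists a, b; split => //; rewrite -Ea -Eb.
have [a [b [ad bd E1]]] := quotient j i; have [a' [b' [ad' bd' E2]]] := quotient i j.
have E : D i (D j f) (a *: coordvec R i + (b *: coordvec R j + x)) =
         D j (D i f) (a' *: coordvec R j + (b' *: coordvec R i + x)).
  apply: (mulIf (lt0r_neq0 d0)); apply: (mulIf (lt0r_neq0 d0)).
  rewrite -E1 -E2 [d *: coordvec R i + (_ + _)]addrCA.
  move: (f (d *: _ + (d *: _ + x))) (f (d *: coordvec R i + x)) (f (d *: coordvec R j + x)) (f x).
  by move=> p q r s; rewrite !opprB !addrA addrAC; ring.
have {}H1 := H1 (a *: coordvec R i + (b *: coordvec R j + x)).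
have {}H2 := H2 (a' *: coordvec R j + (b' *: coordvec R i + x)).
have : `|D i (D j f) (a *: coordvec R i + (b *: coordvec R j + x)) - D i (D j f) x| < e / 2.
  by apply: H1 => k; rewrite (lt_le_trans (near_x _ _ _ _ _ ad bd)) // ge_min lexx.
have : `|D j (D i f) (a' *: coordvec R j + (b' *: coordvec R i + x)) - D j (D i f) x| < e / 2.
  by apply: H2 => k; rewrite (lt_le_trans (near_x _ _ _ _ _ ad' bd')) // ge_min lexx orbT.
rewrite E !ltr_norml ler_norml; lra.
Qed.

Lemma is_derive_dir f x v : is_derive x v f (\sum_k v 0 k * D k f x).
Proof.
suff H (r : seq 'I_4) : is_derive x (\sum_(k <- r) v 0 k *: coordvec R k) f
    (\sum_(k <- r) v 0 k * D k f x).
  have := H (index_enum 'I_4); rewrite [X in is_derive x X](_ : _ = v) //.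
  by rewrite [RHS]row_sum_delta.
elim: r => [|k r IH]; first by rewrite !big_nil; exact: is_derive0.
rewrite !big_cons; set w := \sum_(_ <- _) _ in IH *; set L := \sum_(_ <- _) _ in IH *.
set a := v 0 k.
have [dw Lw] := IH.
suff C : (fun h : R => h^-1 *: ((f \o shift x) (h *: (a *: coordvec R k + w)) - f x)) @ 0^'
    --> a * D k f x + L.
  by split; [apply/cvg_ex; exists (a * D k f x + L)|exact/cvg_lim].
have C1 : (fun h : R => h^-1 *: ((f \o shift x) (h *: w) - f x)) @ 0^' --> L.
  by rewrite -Lw; exact: dw.
pose q (h : R) := h^-1 *: (f ((h * a) *: coordvec R k + (h *: w + x)) - f (h *: w + x)).
have -> : (fun h : R => h^-1 *: ((f \o shift x) (h *: (a *: coordvec R k + w)) - f x)) =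
    q \+ (fun h : R => h^-1 *: ((f \o shift x) (h *: w) - f x)).
  apply/funext => h /=; rewrite /q -scalerDr; congr (_ *: _).
  have -> : h *: (a *: coordvec R k + w) + x = (h * a) *: coordvec R k + (h *: w + x).
    by rewrite scalerDr scalerA addrA.
  by rewrite [RHS]addrA subrK.
apply: cvgD C1.
apply/cvgrPdist_le => e e0.
pose A := `|a| + 1.
have A0 : 0 < A by rewrite ltr_wpDl.
have [d d0 H] := sfun_near (D k f) x (divr_gt0 e0 A0).
pose B := `|a| + \sum_m `|w 0 m| + 1.
have B0 : 0 < B by rewrite ltr_wpDl // addr_ge0 // sumr_ge0.
near=> h.
have h0 : h != 0 by near: h; exact: nbhs_dnbhs_neq.
have hd : `|h| * B < d.
  by rewrite -ltr_pdivlMr //; near: h; apply: dnbhs0_lt; rewrite divr_gt0.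
have [c cb E] := mvt_line (h *: w + x) (h * a) (is_derive_D k f).
rewrite /q E mulrA [h^-1 *: _](_ : _ = a * D k f (c *: coordvec R k + (h *: w + x))); last first.
  by rewrite /GRing.scale /=; field.
rewrite -mulrBr normrM (@le_trans _ _ (A * (e / A))) //; last by rewrite mulrC divfK ?gt_eqF.
rewrite ler_pM //; first by rewrite lerDl.
rewrite distrC; apply/ltW/H => m.
rewrite !mxE /= addrA addrK (le_lt_trans (ler_normD _ _)) // (le_lt_trans _ hd) //.
rewrite /B mulrDr mulrDr mulr1 -normrM.
rewrite (@le_trans _ _ (`|h * a| + `|h| * \sum_m `|w 0 m|)) // ?lerDl // lerD //.
  by have [_|_] := eqVneq m k; rewrite ?mulr0 ?normr0 ?mulr1.
by rewrite normrM ler_wpM2l // (bigD1 m) //= lerDl sumr_ge0.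
Unshelve. all: by end_near. Qed.

Lemma derive_dir f x v : 'D_v f x = \sum_k v 0 k * D k f x.
Proof. by case: (is_derive_dir f x v). Qed.

End SmoothRing.

(** * Measurability of continuous functions on R^4 *)

Section ProductMeasurability.
Local Open Scope ring_scope.

(** Caratheodory: freezing the second variable at the nodes of finer and finer
    grids gives countably valued approximations of the function. *)
Lemma measurable_fun_caratheodory (R : realType) (d : measure_display) (T : measurableType d)
    (f : T * measurableTypeR R -> R) :
  (forall t, continuous (fun s : R => f (t, s))) ->
  (forall s : R, measurable_fun setT (fun t => f (t, s))) ->
  measurable_fun setT f.
Proof.
move=> cf mf.
pose q (n : nat) (s : R) : R := (Num.floor (s * n.+1%:R))%:~R / n.+1%:R.
apply: (@measurable_realfun.measurable_fun_cvg _ _ _ _ (fun n ts => f (ts.1, q n ts.2))).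
  move=> n _ B mB; rewrite setTI.
  have -> : (fun ts : T * measurableTypeR R => f (ts.1, q n ts.2)) @^-1` B =
    \bigcup_(i : int) ((fun t => f (t, i%:~R / n.+1%:R)) @^-1` B `*`
       (`[i%:~R / n.+1%:R, (i + 1)%:~R / n.+1%:R[ : set (measurableTypeR R))).
    apply/seteqP; split=> [[t s] /= Bts|[t s] [i _] /= [Bt]].
      exists (Num.floor (s * n.+1%:R)) => //; split => //=.
      by rewrite in_itv /= ler_pdivrMr // ltr_pdivlMr // floor_itv.
    rewrite in_itv /= ler_pdivrMr // ltr_pdivlMr // => si.
    by rewrite /q (floor_def si).
  apply: countable_bigcupT_measurable => // i.
  apply: measurableX; first by rewrite -[X in measurable X]setTI; exact: mf.
  exact: measurable_itv.
move=> [t s] _ /=.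
apply: (@continuous_cvg _ _ _ _ _ (fun n => q n s) (fun s => f (t, s))); first exact: cf.
apply/cvgrPdist_le => e e0; near=> n.
have n0 : (0 : R) < n.+1%:R by [].
have /andP[l1 l2] := floor_itv (s * n.+1%:R).
have q1 : q n s <= s by rewrite /q ler_pdivrMr.
have q2 : s <= q n s + n.+1%:R^-1.
  by rewrite /q -[X in _ + X]mul1r -mulrDl ler_pdivlMr // ltW // -[1]/(1%:~R) -intrD.
rewrite ger0_norm ?subr_ge0 // lerBlDl (le_trans q2) // lerD2l ltW //.
near: n; exact: near_infty_natSinv_lt (PosNum e0).
Unshelve. all: by end_near. Qed.

Variable R : realType.
Local Notation Rb := (measurableTypeR R).
Local Notation V := 'rV[R]_4.
Local Notation mu := (@lebesgue_measure R).

Lemma row4_continuous_last (a b c : R) : continuous (fun s : R => row4 (a, b, c, s)).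
Proof.
move=> s A /nbhs_ballP[e e0 eA]; apply/nbhs_ballP; exists e => //= t st.
apply: eA; split => // i j; rewrite !mxE.
by case: j => [[|[|[|[|j]]]] ?] //=; exact: ballxx.
Qed.

Lemma row4_continuous_third (a b d : R) : continuous (fun s : R => row4 (a, b, s, d)).
Proof.
move=> s A /nbhs_ballP[e e0 eA]; apply/nbhs_ballP; exists e => //= t st.
apply: eA; split => // i j; rewrite !mxE.
by case: j => [[|[|[|[|j]]]] ?] //=; exact: ballxx.
Qed.

Lemma row4_continuous_second (a c d : R) : continuous (fun s : R => row4 (a, s, c, d)).
Proof.
move=> s A /nbhs_ballP[e e0 eA]; apply/nbhs_ballP; exists e => //= t st.
apply: eA; split => // i j; rewrite !mxE.
by case: j => [[|[|[|[|j]]]] ?] //=; exact: ballxx.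
Qed.

Lemma row4_continuous_first (b c d : R) : continuous (fun s : R => row4 (s, b, c, d)).
Proof.
move=> s A /nbhs_ballP[e e0 eA]; apply/nbhs_ballP; exists e => //= t st.
apply: eA; split => // i j; rewrite !mxE.
by case: j => [[|[|[|[|j]]]] ?] //=; exact: ballxx.
Qed.

Lemma measurable_row4 (f : V -> R) : continuous f -> 
  measurable_fun setT (fun p : Rb * Rb * Rb * Rb => f (row4 p)).
Proof.
move=> cf.
apply: measurable_fun_caratheodory => [[[a b] c] s|d].
  by apply: continuous_comp; [exact: row4_continuous_last|exact: cf].
apply: (@measurable_fun_caratheodory R _ (Rb * Rb)%type (fun p => f (row4 (p, d)))) => [[a b] s|c].
  by apply: continuous_comp; [exact: row4_continuous_third|exact: cf].
apply: (@measurable_fun_caratheodory R _ Rb (fun p => f (row4 (p, c, d)))) => [a s|b].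
  by apply: continuous_comp; [exact: row4_continuous_second|exact: cf].
apply: measurable_realfun.continuous_measurable_fun => s.
by apply: continuous_comp; [exact: row4_continuous_first|exact: cf].
Qed.

End ProductMeasurability.

(** * Integration by parts *)

Section CompactlySupportedIntegrals.
Local Open Scope ring_scope.

(** A measurable bounded function vanishing off a measurable set; the set is kept as
    a product so that the notion passes to sections. *)
Definition carried (d : measure_display) (T : measurableType d) (R : realType)
    (B : set T) (F : T -> R) :=
  [/\ measurable_fun setT F, measurable B, exists C : R, forall t, `|F t| <= C &
      forall t, ~ B t -> F t = 0].

Lemma carried_integrable (d : measure_display) (T : measurableType d) (R : realType)
    (m : {measure set T -> \bar R}) (B : set T) (F : T -> R) :
  carried B F -> (m B < +oo)%E -> m.-integrable setT (EFin \o F).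
Proof.
move=> [mF mB [C FC] F0] mBoo.
have -> : EFin \o F = (EFin \o F) \_ B.
  apply/funext => t; rewrite patchE; case: ifPn => //= /negP; rewrite inE => tB.
  by rewrite F0.
apply: (iffLR (integrable_mkcond _ mB)); apply: measurable_bounded_integrable => //.
  exact: measurable_funS mF.
by exists C; split; [exact: num_real|move=> M CM t _; apply: ltW; exact: le_lt_trans (FC t) CM].
Qed.

Section Sections.
Context (d1 d2 : measure_display) (T1 : measurableType d1) (T2 : measurableType d2).
Context (R : realType).
Variables (m1 : {sigma_finite_measure set T1 -> \bar R}).
Variables (m2 : {sigma_finite_measure set T2 -> \bar R}).

Lemma sigma_finite_prod : sigma_finite setT (m1 \x m2)%E.
Proof.
have /sigma_finiteP[F [TF ndF Foo]] := sigma_finiteT m1.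
have /sigma_finiteP[G [TG ndG Goo]] := sigma_finiteT m2.
exists (fun n => F n `*` G n).
  apply/seteqP; split => // -[x y] _.
  have [n _ Fx] : (\bigcup_i F i) x by rewrite -TF.
  have [k _ Gy] : (\bigcup_i G i) y by rewrite -TG.
  exists (maxn n k) => //; split => /=.
    by move: x Fx; exact/subsetPset/ndF/leq_maxl.
  by move: y Gy; exact/subsetPset/ndG/leq_maxr.
move=> k; have [? ?] := Foo k; have [? ?] := Goo k.
split; first exact: measurableX.
by rewrite product_measure1E // lte_mul_pinfty // ge0_fin_numE.
Qed.

(* The product measure together with its sigma-finiteness, so that it iterates. *)
Definition sigma_prod : {sigma_finite_measure set (T1 * T2)%type -> \bar R} :=
  HB.pack_for {sigma_finite_measure set (T1 * T2)%type -> \bar R}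
    (m1 \x m2)%E (Measure_isSigmaFinite.Build _ _ _ (m1 \x m2)%E sigma_finite_prod).

Variables (B1 : set T1) (B2 : set T2) (F : T1 * T2 -> R).
Hypotheses (mB1 : measurable B1) (mB2 : measurable B2).
Hypothesis cF : carried (B1 `*` B2) F.

Lemma carried_section2 s : carried B1 (fun t => F (t, s)).
Proof.
have [mF _ [C FC] F0] := cF; split => //.
- exact: (measurable_fun_pair1 _ mF).
- by exists C.
- by move=> t B1t; apply: F0 => -[].
Qed.

Hypotheses (fB1 : (m1 B1 < +oo)%E) (fB2 : (m2 B2 < +oo)%E).

Lemma finite_box : (sigma_prod (B1 `*` B2) < +oo)%E.
Proof. by change ((m1 \x m2)%E (B1 `*` B2) < +oo)%E; rewrite product_measure1E // lte_mul_pinfty // ge0_fin_numE. Qed.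

Lemma carried_integral0_snd :
  (forall t, (\int[m2]_s (F (t, s))%:E = 0)%E) -> (\int[sigma_prod]_p (F p)%:E = 0)%E.
Proof.
move=> H; have := integral12_prod_meas1 (carried_integrable cF finite_box).
move=> <-; apply: integral0_eq => t _; rewrite /fubini_F; exact: H.
Qed.

Lemma carried_integral0_fst :
  (forall s, (\int[m1]_t (F (t, s))%:E = 0)%E) -> (\int[sigma_prod]_p (F p)%:E = 0)%E.
Proof.
move=> H; have := integral21_prod_meas1 (carried_integrable cF finite_box).
move=> <-; apply: integral0_eq => t _; rewrite /fubini_G; exact: H.
Qed.
End Sections.

Variable R : realType.
Local Notation Rb := (measurableTypeR R).
Local Notation V := 'rV[R]_4.
Local Notation mu := (@lebesgue_measure R).
Implicit Types (f g : sfun R) (M : R).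

Lemma integral_derivative_eq0 (G g : R -> R) M :
  (forall s : R, is_derive s 1 G (g s)) -> continuous g ->
  (forall s, M < `|s| -> G s = 0) -> (forall s, M < `|s| -> g s = 0) ->
  (\int[mu]_s (g s)%:E = 0)%E.
Proof.
move=> dG cg G0 g0; pose b : R := `|M| + 1.
have Mb : M < b by rewrite (le_lt_trans (ler_norm _)) // ltrDl.
have b0 : 0 < b by rewrite ltr_wpDl.
have -> : (\int[mu]_s (g s)%:E = \int[mu]_(s in [set` `[(- b)%R, b]%R]) (g s)%:E)%E.
  rewrite [RHS]integral_mkcond; apply: eq_integral => s _; rewrite patchE.
  case: ifPn => // /negP; rewrite inE /= in_itv /= -ler_norml => /negP; rewrite -ltNge => bs.
  by rewrite g0 // (lt_trans Mb).
rewrite (@continuous_FTC2 _ g G).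
- by rewrite !G0 ?subee // ?normrN gtr0_norm.
- by rewrite gtrN.
- exact: continuous_subspaceT.
- have cG s : {for s, continuous G}.
    by apply/differentiable_continuous/derivable1_diffP; case: (dG s).
  split; [by move=> s _; case: (dG s)|exact: cvg_at_right_filter (cG _)|exact: cvg_at_left_filter (cG _)].
- by move=> s _; rewrite derive1E; case: (dG s).
Qed.

Let mu2 := sigma_prod mu mu.
Let mu3 := sigma_prod mu2 mu.

Definition supp_in M (f : V -> R) := forall x : V, (exists k, M < `|x 0 k|) -> f x = 0.

Definition cube M : set Rb := `[- M, M].
Definition box4 M : set (Rb * Rb * Rb * Rb)%type := cube M `*` cube M `*` cube M `*` cube M.

Lemma measurable_cube M : measurable (cube M).
Proof. exact: measurable_itv. Qed.

Lemma finite_cube M : (mu (cube M) < +oo)%E.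
Proof. by rewrite lebesgue_measure_itv /=; case: ifP => _; rewrite -?EFinD ltry. Qed.

Lemma cubeP M s : cube M s <-> `|s| <= M.
Proof. by rewrite /cube /= in_itv /= -ler_norml. Qed.

Lemma coord_row4 (a b c d : R) (k : 'I_4) :
  row4 (a, b, c, d) 0 k = nth 0 [:: a; b; c; d] k.
Proof. by rewrite mxE. Qed.

Lemma not_box4 M p : ~ box4 M p -> exists k, M < `|row4 p 0 k|.
Proof.
case: p => [[[a b] c] d] nb.
apply: contrapT => /forallNP H; apply: nb.
have {}H k : `|row4 (a, b, c, d) 0 k| <= M by rewrite leNgt; apply/negP/H.
split; first split; first split; apply/cubeP.
- by have := H (@Ordinal 4 0 isT); rewrite mxE.
- by have := H (@Ordinal 4 1 isT); rewrite mxE.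
- by have := H (@Ordinal 4 2 isT); rewrite mxE.
- by have := H (@Ordinal 4 3 isT); rewrite mxE.
Qed.

Lemma supp_bounded M (f : V -> R) : continuous f -> supp_in M f ->
  exists C : R, forall x, `|f x| <= C.
Proof.
move=> cf f0.
have cK : compact [set x : V | forall k, x 0 k \in `[- M, M]].
  by apply: (@rV_compact _ _ (fun=> `[- M, M]%classic)) => k; exact: segment_compact.
have /compact_bounded[C [_ HC]] : compact (f @` [set x : V | forall k, x 0 k \in `[- M, M]]).
  by apply: continuous_compact => //; exact: continuous_subspaceT.
exists (`|C| + 1) => x.
have [[k kM]|/forallNP H] := pselect (exists k, M < `|x 0 k|).
  by rewrite f0 ?normr0 ?addr_ge0 //; exists k.
apply: (HC (`|C| + 1)); first by rewrite (le_lt_trans (ler_norm _)) // ltrDl.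
exists x => // k; rewrite in_itv /= -ler_norml leNgt; exact/negP/H.
Qed.

Lemma carried_row4 M (f : V -> R) : continuous f -> supp_in M f ->
  carried (box4 M) (fun p : Rb * Rb * Rb * Rb => f (row4 p)).
Proof.
move=> cf f0; split.
- exact: measurable_row4.
- have mc := measurable_cube M.
  exact: (measurableX (measurableX (measurableX mc mc) mc) mc).
- by have [C HC] := supp_bounded cf f0; exists C => p.
- by move=> p /not_box4; exact: f0.
Qed.

Lemma finite_box4 M : (lebesgue4 R (box4 M) < +oo)%E.
Proof.
have mc := measurable_cube M; have fc := finite_cube M.
have mc2 := measurableX mc mc; have fc2 : (mu2 (cube M `*` cube M) < +oo)%E := finite_box mc mc fc fc.
have mc3 := measurableX mc2 mc; have fc3 : (mu3 (cube M `*` cube M `*` cube M) < +oo)%E := finite_box mc2 mc fc2 fc.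
exact: (finite_box mc3 mc fc3 fc).
Qed.

Lemma integrable_row4 M (f : V -> R) : continuous f -> supp_in M f ->
  (lebesgue4 R).-integrable setT (EFin \o (fun p => f (row4 p))).
Proof. by move=> cf f0; exact: carried_integrable (carried_row4 cf f0) (finite_box4 M). Qed.

Lemma supp_in_D M j f : supp_in M f -> supp_in M (D j f).
Proof.
move=> f0 x [k kM]; apply: DE.
apply: (@near_eq_is_derive _ _ _ (fun=> 0 : R)).
have : nbhs x [set y : V | M < `|y 0 k|].
  have c : {for x, continuous (fun y : V => `|y 0 k|)}.
    by apply: continuous_comp; [exact: coord_continuous|exact: norm_continuous].
  exact: (c _ (lt_nbhsr kM)).
by apply: filterS => y ky; rewrite f0 //; exists k.
Qed.

Lemma integral_D_eq0 M j f : supp_in M f ->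
  (\int[lebesgue4 R]_p (D j f (row4 p))%:E = 0)%E.
Proof.
move=> f0; have Df0 := supp_in_D j f0.
have cD : continuous (D j f) := sfun_continuous (f := D j f).
have C4 := carried_row4 cD Df0.
have mc := measurable_cube M; have fc := finite_cube M.
have mc2 := measurableX mc mc; have fc2 : (mu2 (cube M `*` cube M) < +oo)%E := finite_box mc mc fc fc.
have mc3 := measurableX mc2 mc; have fc3 : (mu3 (cube M `*` cube M `*` cube M) < +oo)%E := finite_box mc2 mc fc2 fc.
have line (x : V) : x 0 j = 0 -> (\int[mu]_s (D j f (s *: coordvec R j + x))%:E = 0)%E.
  move=> x0.
  have sM s : M < `|s| -> exists k, M < `|(s *: coordvec R j + x) 0 k|.
    by move=> Ms; exists j; rewrite !mxE x0 !eqxx mulr1 addr0.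
  apply: (@integral_derivative_eq0 (fun s => f (s *: coordvec R j + x)) _ M).
  - by move=> s; apply: is_derive_line; exact: is_derive_D.
  - move=> s; apply: (@continuous_comp _ _ _ (fun s : R => s *: coordvec R j + x)); last exact: cD.
    by apply: cvgD; [apply: cvgZr_tmp; exact: cvg_id|exact: cvg_cst].
  - by move=> s /sM; exact: f0.
  - by move=> s /sM; exact: Df0.
have row0 p : row4 p 0 j = 0 -> forall q, (forall s, row4 (q s) = s *: coordvec R j + row4 p) ->
    (\int[mu]_s (D j f (row4 (q s)))%:E = 0)%E.
  move=> /line <- q qE; apply: eq_integral => s _; by rewrite qE.
have C3 d : carried (cube M `*` cube M `*` cube M) (fun q => D j f (row4 (q, d))).
  exact: carried_section2 mc3 C4 d.
have C2 c d : carried (cube M `*` cube M) (fun q => D j f (row4 (q, c, d))).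
  exact: carried_section2 mc2 (C3 d) c.
have rowE (a b c d s : R) p : (forall k : 'I_4, nth 0 [:: a; b; c; d] k = s * (k == j)%:R + row4 p 0 k) ->
    row4 (a, b, c, d) = s *: coordvec R j + row4 p.
  by move=> H; apply/rowP => k; rewrite coord_row4 H !mxE.
have : (j == 0 :> nat) || (j == 1 :> nat) || (j == 2 :> nat) || (j == 3 :> nat).
  by case: (j) => [[|[|[|[|m]]]]].
case/orP => [/orP[/orP[]|]|] /eqP jE.
- apply: (@carried_integral0_fst _ _ _ _ R mu3 mu _ _ _ mc3 mc C4 fc3 fc) => d.
  apply: (@carried_integral0_fst _ _ _ _ R mu2 mu _ _ _ mc2 mc (C3 d) fc2 fc) => c.
  apply: (@carried_integral0_fst _ _ _ _ R mu mu _ _ _ mc mc (C2 c d) fc fc) => b.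
  apply: (row0 (0, b, c, d)); first by rewrite coord_row4 jE.
  move=> s; apply: rowE => k; rewrite coord_row4 -val_eqE /= jE.
  by case: k => [[|[|[|[|m]]]]] //= _; rewrite ?mulr1 ?mulr0 ?addr0 ?add0r.
- apply: (@carried_integral0_fst _ _ _ _ R mu3 mu _ _ _ mc3 mc C4 fc3 fc) => d.
  apply: (@carried_integral0_fst _ _ _ _ R mu2 mu _ _ _ mc2 mc (C3 d) fc2 fc) => c.
  apply: (@carried_integral0_snd _ _ _ _ R mu mu _ _ _ mc mc (C2 c d) fc fc) => a.
  apply: (row0 (a, 0, c, d)); first by rewrite coord_row4 jE.
  move=> s; apply: rowE => k; rewrite coord_row4 -val_eqE /= jE.
  by case: k => [[|[|[|[|m]]]]] //= _; rewrite ?mulr1 ?mulr0 ?addr0 ?add0r.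
- apply: (@carried_integral0_fst _ _ _ _ R mu3 mu _ _ _ mc3 mc C4 fc3 fc) => d.
  apply: (@carried_integral0_snd _ _ _ _ R mu2 mu _ _ _ mc2 mc (C3 d) fc2 fc) => -[a b].
  apply: (row0 (a, b, 0, d)); first by rewrite coord_row4 jE.
  move=> s; apply: rowE => k; rewrite coord_row4 -val_eqE /= jE.
  by case: k => [[|[|[|[|m]]]]] //= _; rewrite ?mulr1 ?mulr0 ?addr0 ?add0r.
- apply: (@carried_integral0_snd _ _ _ _ R mu3 mu _ _ _ mc3 mc C4 fc3 fc) => -[[a b] c].
  apply: (row0 (a, b, c, 0)); first by rewrite coord_row4 jE.
  move=> s; apply: rowE => k; rewrite coord_row4 -val_eqE /= jE.
  by case: k => [[|[|[|[|m]]]]] //= _; rewrite ?mulr1 ?mulr0 ?addr0 ?add0r.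
Qed.

End CompactlySupportedIntegrals.

(** * The integral of compactly supported smooth functions *)

Lemma product_measure_eq (d1 d2 : measure_display) (T1 : measurableType d1)
    (T2 : measurableType d2) (R : realType) (m1 : {measure set T1 -> \bar R})
    (m2 : {sigma_finite_measure set T2 -> \bar R}) (A : set T1) (B : set T2) (a b : R) :
  measurable A -> measurable B -> m1 A = a%:E -> m2 B = b%:E ->
  (m1 \x m2)%E (A `*` B) = (a * b)%:E.
Proof. by move=> mA mB Aa Bb; rewrite product_measure1E // Aa Bb EFinM. Qed.

Section IntegralFunctional.
Variable R : realType.
Local Notation Rb := (measurableTypeR R).
Local Notation V := 'rV[R]_4.
Implicit Types (f g : sfun R) (M : R) (x : V).

(* Compact support, in the form that passes to derivatives and products. *)
Definition cs f := exists M, supp_in M f.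

Definition int4 f : R := (\int[lebesgue4 R]_p f (row4 p))%R.

Lemma csMr f g : cs f -> cs (f * g).
Proof. by case=> M f0; exists M => x /f0 fx; rewrite sfunME fx mul0r. Qed.

Lemma csMl f g : cs f -> cs (g * f).
Proof. by rewrite mulrC; exact: csMr. Qed.

Lemma cs0 : cs 0. Proof. by exists 0. Qed.

Lemma csD f g : cs f -> cs g -> cs (f + g).
Proof.
move=> [M f0] [N g0]; exists (Num.max M N) => x [k]; rewrite gt_max => /andP[kM kN].
by rewrite sfunDE f0 ?g0 ?addr0 //; exists k.
Qed.

Lemma csN f : cs f -> cs (- f).
Proof. by rewrite -mulN1r; exact: csMl. Qed.

Lemma cs_der j f : cs f -> cs (D j f).
Proof. by case=> M f0; exists M; exact: supp_in_D. Qed.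

Lemma cs_sum (I : Type) (r : seq I) (P : pred I) (F : I -> sfun R) :
  (forall i, cs (F i)) -> cs (\sum_(i <- r | P i) F i).
Proof. by move=> H; elim/big_rec: _ => [|i a _]; [exact: cs0|exact: csD]. Qed.

Lemma cs_integrable f : cs f ->
  (lebesgue4 R).-integrable setT (EFin \o (fun p => f (row4 p))).
Proof. by case=> M f0; exact: integrable_row4 (sfun_continuous (f := f)) f0. Qed.

Lemma int4_integral4 (f : sfun R) : cs f -> integral4 setT f = (int4 f)%:E.
Proof.
move=> cf; rewrite /integral4 preimage_setT /int4 /Rintegral fineK //.
exact: integrable_fin_num (cs_integrable cf).
Qed.

Lemma int4D f g : cs f -> cs g -> int4 (f + g) = int4 f + int4 g.
Proof. by move=> cf cg; rewrite /int4 -RintegralD //; exact: cs_integrable. Qed.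

Lemma int4_0 : int4 0 = 0.
Proof. by apply: (addrI (int4 0)); rewrite -int4D ?addr0 //; exact: cs0. Qed.

Lemma int4N f : cs f -> int4 (- f) = - int4 f.
Proof.
move=> cf; apply/eqP; rewrite -addr_eq0 addrC -int4D //; last exact: csN.
by rewrite subrr int4_0.
Qed.

Lemma int4_le f g : cs f -> cs g -> (forall x, f x <= g x) -> int4 f <= int4 g.
Proof. by move=> cf cg fg; apply: le_Rintegral => //; exact: cs_integrable. Qed.

Lemma int4_cstM (a : R) f : cs f -> int4 (cstf a * f) = a * int4 f.
Proof. by move=> cf; rewrite /int4 -RintegralZl //; exact: cs_integrable. Qed.

Lemma int4_D j f : cs f -> int4 (D j f) = 0.
Proof.
by move=> [M f0]; rewrite /int4 /Rintegral (integral_D_eq0 j f0).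
Qed.

Lemma int4_divergence (F : 'I_4 -> sfun R) : (forall j, cs (F j)) -> int4 (\sum_j D j (F j)) = 0.
Proof.
move=> cF.
have : cs (\sum_j D j (F j)) /\ int4 (\sum_j D j (F j)) = 0 by
  elim/big_rec: _ => [|j a _ [ca a0]]; [split; [exact: cs0|exact: int4_0]|
    split; [exact: csD (cs_der j (cF j)) ca|rewrite int4D ?int4_D ?a0 ?addr0 //; exact: cs_der]].
by case.
Qed.

Definition ball_box x (d : R) : set (Rb * Rb * Rb * Rb)%type :=
  [set p | forall k, `|row4 p 0 k - x 0 k| <= d].

Lemma ball_boxE x d : ball_box x d =
  `[x 0 (@Ordinal 4 0 isT) - d, x 0 (@Ordinal 4 0 isT) + d] `*`
  `[x 0 (@Ordinal 4 1 isT) - d, x 0 (@Ordinal 4 1 isT) + d] `*`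
  `[x 0 (@Ordinal 4 2 isT) - d, x 0 (@Ordinal 4 2 isT) + d] `*`
  `[x 0 (@Ordinal 4 3 isT) - d, x 0 (@Ordinal 4 3 isT) + d].
Proof.
apply/seteqP; split=> [[[[a b] c] e] H|[[[a b] c] e] [[[H0 H1] H2] H3]].
  do 3?split => /=; rewrite in_itv /= -ler_distl distrC.
  - by have := H (@Ordinal 4 0 isT); rewrite mxE distrC.
  - by have := H (@Ordinal 4 1 isT); rewrite mxE distrC.
  - by have := H (@Ordinal 4 2 isT); rewrite mxE distrC.
  - by have := H (@Ordinal 4 3 isT); rewrite mxE distrC.
move: H0 H1 H2 H3 => /=; rewrite !in_itv /= -!ler_distl => H0 H1 H2 H3 k.
rewrite coord_row4; case: k => [[|[|[|[|m]]]] kl] //=.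
- by rewrite (_ : Ordinal kl = @Ordinal 4 0 isT) //; exact: val_inj.
- by rewrite (_ : Ordinal kl = @Ordinal 4 1 isT) //; exact: val_inj.
- by rewrite (_ : Ordinal kl = @Ordinal 4 2 isT) //; exact: val_inj.
- by rewrite (_ : Ordinal kl = @Ordinal 4 3 isT) //; exact: val_inj.
Qed.

Lemma measurable_ball_box x d : measurable (ball_box x d).
Proof.
have mi (a b : R) : measurable (`[a, b]%classic : set Rb) by exact: measurable_itv.
rewrite ball_boxE; exact: (measurableX (measurableX (measurableX (mi _ _) (mi _ _)) (mi _ _)) (mi _ _)).
Qed.

Lemma measure_ball_box x d : 0 < d -> lebesgue4 R (ball_box x d) = ((2 * d) ^+ 4)%:E.
Proof.
move=> d0; have mi (a b : R) : measurable (`[a, b]%classic : set Rb) by exact: measurable_itv.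
have li (a : R) : (@lebesgue_measure R `[(a - d)%R, (a + d)%R]%classic = (2 * d)%:E)%E.
  by rewrite lebesgue_measure_itv /= lte_fin ltrBlDl addrCA -[X in X < _]addr0 ltrD2l addr_gt0 //
    -EFinB; congr EFin; ring.
rewrite ball_boxE.
have -> : (2 * d) ^+ 4 = 2 * d * (2 * d) * (2 * d) * (2 * d) by ring.
have E2 := product_measure_eq (mi _ _) (mi _ _) (li (x 0 (@Ordinal 4 0 isT))) (li (x 0 (@Ordinal 4 1 isT))).
have E3 := product_measure_eq (measurableX (mi _ _) (mi _ _)) (mi _ _) E2 (li (x 0 (@Ordinal 4 2 isT))).
exact: product_measure_eq (measurableX (measurableX (mi _ _) (mi _ _)) (mi _ _)) (mi _ _) E3
  (li (x 0 (@Ordinal 4 3 isT))).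
Qed.

(* A continuous function positive at a point is bounded below on a box of positive measure. *)
Lemma int4_eq0 f : cs f -> (forall x, 0 <= f x) -> int4 f <= 0 -> forall x, f x = 0.
Proof.
move=> cf f0 If x; apply/eqP; rewrite eq_le f0 andbT leNgt; apply/negP => fx.
have [d d0 Hd] := sfun_near f x (divr_gt0 fx (ltr0n R 2)).
pose B := ball_box x (d / 2).
have d2 : 0 < d / 2 by rewrite divr_gt0.
have mB : measurable B := measurable_ball_box x (d / 2).
have fB p : B p -> f x / 2 <= f (row4 p).
  move=> Bp; have : `|f (row4 p) - f x| < f x / 2.
    by apply: Hd => k; rewrite (le_lt_trans (Bp k)) // ltr_pdivrMr // ltr_pMr // ltr1n.
  by rewrite ltr_norml; lra.
have [mf _] := integrableP _ _ _ (cs_integrable cf).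
have : (\int[lebesgue4 R]_(p in B) (f x / 2)%:E <= \int[lebesgue4 R]_p (f (row4 p))%:E)%E.
  apply: (@le_trans _ _ (\int[lebesgue4 R]_(p in B) (f (row4 p))%:E)%E).
    apply: ge0_le_integral => //.
    - by move=> p _; rewrite lee_fin divr_ge0 ?f0.
    - exact: measurable_funS mf.
  by apply: ge0_subset_integral => // p _; rewrite lee_fin f0.
rewrite integral_cst // measure_ball_box //.
have -> : (\int[lebesgue4 R]_p (f (row4 p))%:E = (int4 f)%:E)%E.
  by rewrite -int4_integral4 // /integral4 preimage_setT.
rewrite -EFinM lee_fin leNgt => /negP; apply; apply: le_lt_trans If _.
by rewrite mulr_gt0 ?divr_gt0 // exprn_gt0 // mulr_gt0.
Qed.

Lemma euclid_continuous : continuous (fun x => Num.sqrt (euclid x x)).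
Proof.
pose q := \sum_k (coordf R k * coordf R k).
have -> : (fun x => Num.sqrt (euclid x x)) = Num.sqrt \o q.
  by apply/funext => x /=; rewrite sfun_sumE.
by move=> x; apply: continuous_comp; [exact: sfun_continuous|exact: sqrt_continuous].
Qed.

Lemma measurable_euclid_ball (r : R) : measurable (@row4 R @^-1` euclid_ball r).
Proof.
have := measurable_row4 euclid_continuous measurableT (measurable_itv `]-oo, r[%R).
by rewrite setTI; congr measurable; apply/seteqP; split=> p /=; rewrite in_itv.
Qed.

(* Transfers the growth hypothesis, on extended-real integrals over balls, to [int4]. *)
Lemma int4_le_ball (e f : sfun R) (r K c : R) : cs f -> 0 <= c -> (forall x, 0 <= e x) ->
  (forall x, euclid_ball r x -> f x <= c * e x) ->
  (forall x, 0 <= f x) -> (forall x, ~ euclid_ball r x -> f x = 0) ->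
  (integral4 (euclid_ball r) e <= K%:E)%E -> int4 f <= c * K.
Proof.
move=> cf c0 e0 fe f0 fout eK.
have mB := measurable_euclid_ball r.
have /measurable_EFinP me := measurable_row4 (sfun_continuous (f := e)).
have [mf _] := integrableP _ _ _ (cs_integrable cf).
rewrite -lee_fin EFinM -int4_integral4 // /integral4 preimage_setT.
apply: (@le_trans _ _ (\int[lebesgue4 R]_(p in @row4 R @^-1` euclid_ball r) (c%:E * (e (row4 p))%:E))%E); last first.
  rewrite ge0_integralZl_EFin //.
  - by rewrite lee_wpmul2l ?lee_fin.
  - by move=> p _; rewrite lee_fin.
  - exact: measurable_funS me.
have -> : (\int[lebesgue4 R]_p (f (row4 p))%:E =
    \int[lebesgue4 R]_(p in @row4 R @^-1` euclid_ball r) (f (row4 p))%:E)%E.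
  rewrite [RHS]integral_mkcond; apply: eq_integral => p _; rewrite patchE.
  by case: ifPn => // /negP; rewrite inE => pB; rewrite fout.
apply: ge0_le_integral => //.
- by move=> p _; rewrite lee_fin.
- exact: measurable_funS mf.
- by apply: measurable_funeM; exact: measurable_funS me.
- by move=> p Bp; rewrite -EFinM lee_fin fe.
Qed.

End IntegralFunctional.

(** * Bochner formulas and the second variation *)

Section YMHIdentities.
Variable R : realType.
Local Notation sfun := (sfun R).
Variables (a b : sfun) (A : 'I_4 -> sfun).

(* [P j + i Q j] is the covariant derivative of u = a + i b along the j-th axis,
   [PP i j + i QQ i j] that of [P i + i Q i]. *)
Definition covP j : sfun := D j a + A j * b.
Definition covQ j : sfun := D j b - A j * a.
Definition curv j k : sfun := D j (A k) - D k (A j).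
Definition higgsf : sfun := cstf 2^-1 * (1 - a * a - b * b).
Definition normu : sfun := a * a + b * b.
Local Notation P := covP.
Local Notation Q := covQ.
Local Notation F := curv.
Local Notation h := higgsf.
Definition covPP i j : sfun := D j (P i) + A j * Q i.
Definition covQQ i j : sfun := D j (Q i) - A j * P i.
Local Notation PP := covPP.
Local Notation QQ := covQQ.
Definition lap (f : sfun) : sfun := \sum_j D j (D j f).
Definition grad2 : sfun := \sum_j (P j * P j + Q j * Q j).
Definition vort j k : sfun := (P j * Q k - Q j * P k) *+ 2.

Hypothesis eq_re : \sum_j PP j j = - (h * a).
Hypothesis eq_im : \sum_j QQ j j = - (h * b).
Hypothesis eq_curv : forall k, \sum_j D j (F j k) = - (Q k * a - P k * b).

Lemma cst_half2 : cstf (2^-1 : R) *+ 2 = 1.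
Proof. by apply/sfun_ext => x; rewrite sfunMnE sfun1E; change ((2^-1 : R) *+ 2 = 1); lra. Qed.

Lemma half_double (f : sfun) : cstf (2^-1 : R) * (f *+ 2) = f.
Proof. by rewrite mulrnAr -mulrnAl cst_half2 mul1r. Qed.

Lemma D_higgs k : D k h = - (P k * a + Q k * b).
Proof.
rewrite /higgsf DM D_cst mul0r add0r !(DD, DN, DM, D1) -[RHS]half_double; congr (_ * _).
rewrite /covP /covQ; ring.
Qed.

Lemma lap_higgs : lap h = normu * h - grad2.
Proof.
have E j : D j (D j h) = - (PP j j * a + QQ j j * b) - (P j * P j + Q j * Q j).
  rewrite D_higgs DN DD !DM /covPP /covQQ.
  have -> : D j a = P j - A j * b by rewrite /covP; ring.
  have -> : D j b = Q j + A j * a by rewrite /covQ; ring.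
  ring.
rewrite /lap (eq_bigr _ (fun j _ => E j)) sumrB sumrN big_split /= -!mulr_suml eq_re eq_im.
by rewrite -/grad2 /normu; ring.
Qed.

Lemma cov_comm_re i j :
  D j (PP i j) + A j * QQ i j = D i (PP j j) + A i * QQ j j + F j i * Q j *+ 2 + D j (F j i) * b.
Proof.
rewrite /covPP /covQQ /covP /covQ /curv !(DD, DN, DM) !(D_comm j i).
ring.
Qed.

Lemma cov_comm_im i j :
  D j (QQ i j) - A j * PP i j = D i (QQ j j) - A i * PP j j - F j i * P j *+ 2 - D j (F j i) * a.
Proof.
rewrite /covPP /covQQ /covP /covQ /curv !(DD, DN, DM) !(D_comm j i).
ring.
Qed.

Lemma curvN i j : F i j = - F j i.
Proof. by rewrite /curv opprB. Qed.

(** The Bianchi identity turns the divergence of the curvature into its Laplacian. *)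
Lemma lap_curv j k : lap (F j k) = normu * F j k - vort j k.
Proof.
have E l : D l (D l (F j k)) = D j (D l (F l k)) - D k (D l (F l j)).
  rewrite /curv !(DD, DN, DM) !(D_comm l j) !(D_comm l k) !(D_comm k j); ring.
rewrite /lap (eq_bigr _ (fun l _ => E l)) sumrB -!Dsum !eq_curv !(DN, DD, DM).
rewrite /vort /normu /covP /covQ /curv !(D_comm k j); ring.
Qed.

Lemma derM_cov j (p q pp qq c : sfun) : D j p = pp - c * q -> D j q = qq + c * p ->
  D j (p * pp + q * qq) =
  pp * pp + qq * qq + (p * (D j pp + c * qq) + q * (D j qq - c * pp)).
Proof. by move=> e1 e2; rewrite DD !DM e1 e2; ring. Qed.

Lemma bochner i : \sum_j D j (P i * PP i j + Q i * QQ i j) =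
  \sum_j (PP i j * PP i j + QQ i j * QQ i j)
   - (h - normu) * (P i * P i + Q i * Q i) - \sum_j F j i * vort j i.
Proof.
pose W j := P i * (D j (PP i j) + A j * QQ i j) + Q i * (D j (QQ i j) - A j * PP i j).
have E j : D j (P i * PP i j + Q i * QQ i j) = PP i j * PP i j + QQ i j * QQ i j + W j.
  apply: derM_cov; rewrite /covPP /covQQ; ring.
rewrite (eq_bigr _ (fun j _ => E j)) big_split /= -!addrA; congr (_ + _).
have W1 j : W j = P i * D i (PP j j) + P i * A i * QQ j j + Q i * D i (QQ j j) - Q i * A i * PP j j
   - F j i * vort j i - (Q i * a - P i * b) * D j (F j i).
  rewrite /W cov_comm_re cov_comm_im /vort; ring.
rewrite (eq_bigr _ (fun j _ => W1 j)) !(big_split, sumrN) /= -!mulr_sumr -!Dsum.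
rewrite eq_re eq_im eq_curv (DN i (h * a)) (DN i (h * b)) (DM i h a) (DM i h b) !D_higgs.
have -> : D i a = P i - A i * b by rewrite /covP; ring.
have -> : D i b = Q i + A i * a by rewrite /covQ; ring.
rewrite /normu; ring.
Qed.

(** Up to a divergence, the curl of a one-form controls its full gradient minus
    its divergence. *)
Lemma curl_divergence (f : 'I_4 -> sfun) :
  \sum_j \sum_k (D j (f k) - D k (f j)) ^+ 2 =
  (\sum_j \sum_k D j (f k) ^+ 2 - (\sum_j D j (f j)) ^+ 2
   + \sum_j D j (f j * \sum_k D k (f k) - \sum_k f k * D k (f j))) *+ 2.
Proof.
pose X j k := D j (f k) ^+ 2 - D j (f k) * D k (f j).
have -> : \sum_j \sum_k (D j (f k) - D k (f j)) ^+ 2 = (\sum_j \sum_k X j k) *+ 2.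
  transitivity (\sum_j \sum_k (X j k + X k j)).
    by apply: eq_bigr => j _; apply: eq_bigr => k _; rewrite /X; ring.
  under eq_bigr do rewrite big_split /=.
  by rewrite big_split /= [X in _ + X]exchange_big mulr2n.
rewrite /X {X}.
congr (_ *+ 2); under eq_bigr do rewrite sumrB.
rewrite sumrB -!addrA; congr (_ + _).
have -> : \sum_j D j (f j * \sum_k D k (f k) - \sum_k f k * D k (f j)) =
  \sum_j (D j (f j) * \sum_k D k (f k)) - \sum_j \sum_k D j (f k) * D k (f j).
  transitivity (\sum_j (D j (f j) * \sum_k D k (f k) - \sum_k D j (f k) * D k (f j)
     + \sum_k (f j * D j (D k (f k)) - f k * D k (D j (f j))))).
    apply: eq_bigr => j _; rewrite !(DD, DN, DM) !Dsum !mulr_sumr.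
    under [X in _ - X]eq_bigr do rewrite DM.
    rewrite [X in _ - X]big_split /= sumrB.
    under [X in _ - (_ + X)]eq_bigr do rewrite D_comm.
    ring.
  rewrite big_split /= sumrB -[RHS]addr0; congr (_ + _).
  under eq_bigr do rewrite sumrB.
  by rewrite sumrB [X in _ - X]exchange_big subrr.
rewrite -mulr_suml; ring.
Qed.

Lemma hess_higgs i j : D j (D i h) = - (PP i j * a + QQ i j * b + (P i * P j + Q i * Q j)).
Proof.
have -> : D i h = - (P i * a + Q i * b) := D_higgs i.
rewrite (DN j (P i * a + Q i * b)) (DD j (P i * a)) (DM j (P i)) (DM j (Q i)).
have -> : D j a = P j - A j * b by rewrite /covP; ring.
have -> : D j b = Q j + A j * a by rewrite /covQ; ring.
rewrite /covPP /covQQ; ring.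
Qed.

(* The density of the second variation, for phi = p + i q and Phi = G. *)
Definition second_var (p q : sfun) (G : 'I_4 -> sfun) : sfun :=
  \sum_j ((D j p + A j * q + G j * b) ^+ 2 + (D j q - A j * p - G j * a) ^+ 2)
  - (\sum_j (Q j * G j * p - P j * G j * q)) *+ 2
  + cstf 2^-1 * (\sum_j \sum_k (D j (G k) - D k (G j)) ^+ 2)
  + (a * p + b * q) ^+ 2 - h * (p * p + q * q).

(** The second variation along phi = i e nabla_i u, Phi = - M, up to a divergence.  The variation
    phi = nabla_i u, Phi = F(e_i, .) is an infinitesimal translation; multiplying its first
    component by i and replacing F by a free form M is what detects complex structures.  By
    [bochner] second derivatives of u survive in the divergence only. *)
Lemma second_var_test (e : sfun) (M : 'I_4 -> sfun) i :
  second_var (- (e * Q i)) (e * P i) (fun j => - M j) =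
  e ^+ 2 * (\sum_j F j i * vort j i) - (e * \sum_j M j * (P i * P j + Q i * Q j)) *+ 4
  + normu * (\sum_j M j ^+ 2) + \sum_j \sum_k D j (M k) ^+ 2
  + (\sum_j D j e ^+ 2) * (P i * P i + Q i * Q i)
  - (\sum_j D j (M j) - e * D i h) ^+ 2
  + \sum_j D j (e ^+ 2 * (P i * PP i j + Q i * QQ i j) - (e * D i h * M j) *+ 2
      + (M j * \sum_k D k (M k) - \sum_k M k * D k (M j))).
Proof.
rewrite /second_var.
have -> : \sum_j \sum_k (D j (- M k) - D k (- M j)) ^+ 2 =
          \sum_j \sum_k (D j (M k) - D k (M j)) ^+ 2.
  by apply: eq_bigr => j _; apply: eq_bigr => k _; rewrite !DN; ring.
rewrite curl_divergence half_double.
pose G j := P i * PP i j + Q i * QQ i j.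
have T j : (D j (- (e * Q i)) + A j * (e * P i) + - M j * b) ^+ 2
    + (D j (e * P i) - A j * - (e * Q i) - - M j * a) ^+ 2
    - (Q j * - M j * - (e * Q i) - P j * - M j * (e * P i)) *+ 2
  = D j e ^+ 2 * (P i * P i + Q i * Q i) + e ^+ 2 * (PP i j * PP i j + QQ i j * QQ i j)
    + normu * M j ^+ 2 - e *+ 4 * (M j * (P i * P j + Q i * Q j))
    + D j (e ^+ 2 * G j - (e * D i h * M j) *+ 2) - e ^+ 2 * D j (G j)
    + (e * D i h) *+ 2 * D j (M j).
  have -> : D j (e ^+ 2 * G j - (e * D i h * M j) *+ 2) =
    (e * D j e * G j) *+ 2 + e ^+ 2 * D j (G j)
    - (D j e * D i h * M j + e * D j (D i h) * M j + e * D i h * D j (M j)) *+ 2.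
    rewrite expr2; move: (G j) (D i h) (M j) => g d m.
    by rewrite !(DD, DN, DMn, DM); ring.
  rewrite (DN j (e * Q i)) (DM j e) (DM j e) hess_higgs.
  have -> : D i h = - (P i * a + Q i * b) := D_higgs i.
  have -> : D j (P i) = PP i j - A j * Q i by rewrite /covPP; ring.
  have -> : D j (Q i) = QQ i j + A j * P i by rewrite /covQQ; ring.
  rewrite /normu /G; ring.
rewrite -[X in _ - X + _]sumrMnl -sumrB (eq_bigr _ (fun j _ => T j)).
rewrite !(big_split, sumrN) /= -!mulr_sumr -mulr_suml.
have -> : \sum_j D j (e ^+ 2 * G j - (e * D i h * M j) *+ 2
      + (M j * \sum_k D k (M k) - \sum_k M k * D k (M j))) =
   \sum_j D j (e ^+ 2 * G j - (e * D i h * M j) *+ 2) +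
   \sum_j D j (M j * \sum_k D k (M k) - \sum_k M k * D k (M j)).
  by rewrite -big_split /=; apply: eq_bigr => j _; rewrite [LHS]DD.
rewrite bochner big_split /=.
have -> : D i h = - (P i * a + Q i * b) := D_higgs i.
rewrite /normu; ring.
Qed.

End YMHIdentities.

(** * Real components of the equations *)

Section Translation.
Local Open Scope complex_scope.
Variable R : realType.
Local Notation sfun := (sfun R).
Local Notation V := 'rV[R]_4.
Variables (A : V -> V) (A' : 'I_4 -> sfun).
Hypothesis AE : forall x j, A x 0 j = A' j x.

Lemma euclid_coordvec (X : V) j : euclid X (coordvec R j) = X 0 j.
Proof.
rewrite /euclid (bigD1 j) //= big1 ?addr0; first by rewrite mxE !eqxx mulr1.
by move=> k kj; rewrite mxE eqxx (negbTE kj) mulr0.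
Qed.

Lemma nablaE (p q : sfun) x j :
  nabla A (fun y => p y +i* q y) x (coordvec R j) = covP p q A' j x +i* covQ p q A' j x.
Proof.
rewrite /covP /covQ !sfunDE sfunNE !sfunME /nabla /dirderiv /= euclid_coordvec AE -!D_val.
by apply/eqP; rewrite eq_complex /=; apply/andP; split; apply/eqP; ring.
Qed.

Lemma dformE x j k : dform A x j k = curv A' j k x.
Proof.
have Ak l : (fun y => A y 0 l) = A' l by apply/funext => y; rewrite AE.
by rewrite mxE /curv sfunDE sfunNE !D_val !Ak.
Qed.

Variables (a b : sfun) (u : V -> R[i]).
Hypothesis uE : forall x, u x = a x +i* b x.

Let u_fun : u = fun x => a x +i* b x.
Proof. by apply/funext => x; rewrite uE. Qed.

Lemma cinnerE (z w : R[i]) : cinner z w = complex.Re z * complex.Re w + complex.Im z * complex.Im w.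
Proof. by case: z w => [z1 z2] [w1 w2]; rewrite /cinner /= mulrN opprK. Qed.

Lemma cinner_pair (p q r s : R) : cinner (p +i* q) (r +i* s) = p * r + q * s.
Proof. exact: cinnerE. Qed.

Lemma mul_i (p q : R) : 'i * (p +i* q) = (- q) +i* p.
Proof. by apply/eqP; rewrite eq_complex /=; apply/andP; split; apply/eqP; ring. Qed.

Lemma mul_i_real (c p q : R) : 'i * c%:C * (p +i* q) = (- (c * q)) +i* (c * p).
Proof. by apply/eqP; rewrite eq_complex /=; apply/andP; split; apply/eqP; ring. Qed.

Lemma higgsE x : higgs u x = higgsf a b x.
Proof. rewrite /higgsf !(sfunME, sfunDE, sfunNE, sfun1E) cstfE /higgs cinnerE uE /=.
by rewrite opprD addrA. Qed.

Lemma complexD_sum (I : Type) (r : seq I) (f g : I -> R) :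
  \sum_(k <- r) (f k +i* g k) = (\sum_(k <- r) f k) +i* (\sum_(k <- r) g k).
Proof. by elim: r => [|k r IH]; rewrite ?big_nil // !big_cons IH. Qed.

Lemma ymh_equations : ymh_solution u A ->
  [/\ \sum_j covPP a b A' j j = - (higgsf a b * a),
      \sum_j covQQ a b A' j j = - (higgsf a b * b) &
      forall k, \sum_j D j (curv A' j k) = - (covQ a b A' k * a - covP a b A' k * b)].
Proof.
move=> sol.
have nE j : (fun y => nabla A u y (coordvec R j)) = (fun y => covP a b A' j y +i* covQ a b A' j y).
  by apply/funext => y; rewrite u_fun nablaE.
have adj x : nabla_adj A (nabla A u) x =
    - ((\sum_j covPP a b A' j j) x +i* (\sum_j covQQ a b A' j j) x).
  rewrite /nabla_adj !sfun_sumE -complexD_sum; congr (- _); apply: eq_bigr => j _.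
  by rewrite nE nablaE.
have main x : - ((\sum_j covPP a b A' j j) x +i* (\sum_j covQQ a b A' j j) x) =
    (higgsf a b x * a x) +i* (higgsf a b x * b x).
  rewrite -adj; have [-> _] := sol x; rewrite -higgsE -/(higgs u x) uE.
  by apply/eqP; rewrite eq_complex /= !mul0r subr0 addr0 !eqxx.
split=> [||k]; apply/sfun_ext => x.
- have E : - (\sum_j covPP a b A' j j) x = higgsf a b x * a x := congr1 (@complex.Re R) (main x).
  by rewrite sfunNE sfunME -E opprK.
- have E : - (\sum_j covQQ a b A' j j) x = higgsf a b x * b x := congr1 (@complex.Im R) (main x).
  by rewrite sfunNE sfunME -E opprK.
- have [_ /rowP/(_ k)] := sol x; rewrite !mxE u_fun nablaE mul_i cinner_pair => E.
  rewrite sfun_sumE -[LHS]opprK.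
  have dE j : (fun y => dform A y j k) = curv A' j k by apply/funext => y; rewrite dformE.
  have -> : \sum_j D j (curv A' j k) x = \sum_j 'D_(coordvec R j) (fun y => dform A y j k) x.
    by apply: eq_bigr => j _; rewrite D_val dE.
  rewrite E; change (- (covP a b A' k x * - b x + covQ a b A' k x * a x) =
    - (covQ a b A' k x * a x - covP a b A' k x * b x)); ring.
Qed.

(* Explicit indices, to unfold sums over the four axes. *)
Definition o0 : 'I_4 := @Ordinal 4 0 isT.
Definition o1 : 'I_4 := @Ordinal 4 1 isT.
Definition o2 : 'I_4 := @Ordinal 4 2 isT.
Definition o3 : 'I_4 := @Ordinal 4 3 isT.

Lemma sum4 (G : nmodType) (f : 'I_4 -> G) : \sum_j f j = f o0 + f o1 + f o2 + f o3.
Proof.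
rewrite !big_ord_recr big_ord0 /= add0r.
by congr (f _ + f _ + f _ + f _); exact: val_inj.
Qed.

Lemma inner2E (F G : 'M[R]_4) : inner2 F G =
  F o0 o1 * G o0 o1 + F o0 o2 * G o0 o2 + F o0 o3 * G o0 o3 + F o1 o2 * G o1 o2 +
  F o1 o3 * G o1 o3 + F o2 o3 * G o2 o3.
Proof.
rewrite /inner2; under eq_bigr do rewrite big_mkcond sum4 /=.
by rewrite sum4 /= !(addr0, add0r) !addrA.
Qed.

Lemma inner2_self (F : 'M[R]_4) : (forall j k, F j k = - F k j) ->
  inner2 F F = 2^-1 * \sum_j \sum_k F j k ^+ 2.
Proof.
move=> FN; have F0 j : F j j = 0 by have := FN j j; lra.
rewrite inner2E !sum4 !F0 (FN o1 o0) (FN o2 o0) (FN o3 o0) (FN o2 o1) (FN o3 o1) (FN o3 o2).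
by field.
Qed.

Lemma dform_curl (G : 'I_4 -> sfun) x j k :
  dform (fun y => \row_i G i y) x j k = (D j (G k) - D k (G j)) x.
Proof.
have Gk l : (fun y : V => (\row_i G i y : V) 0 l) = G l by apply/funext => y; rewrite mxE.
by rewrite mxE !Gk sfunDE sfunNE !D_val.
Qed.

Lemma second_variation_densityE (p q : sfun) (G : 'I_4 -> sfun) x :
  second_variation_density u A (fun y => p y +i* q y) (fun y => \row_j G j y) x =
  second_var a b A' p q G x.
Proof.
have h1 j : (let v := nabla A (fun y => p y +i* q y) x (coordvec R j) -
      'i * ((\row_i G i x : V) 0 j)%:C * u x in cinner v v) =
    ((D j p + A' j * q + G j * b) ^+ 2 + (D j q - A' j * p - G j * a) ^+ 2) x.
  have -> : nabla A (fun y => p y +i* q y) x (coordvec R j) - 'i * ((\row_i G i x : V) 0 j)%:C * u x =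
      (D j p x + A' j x * q x + G j x * b x) +i* (D j q x - A' j x * p x - G j x * a x).
    rewrite nablaE mxE uE mul_i_real /covP /covQ !(sfunDE, sfunNE, sfunME).
    by apply/eqP; rewrite eq_complex /=; apply/andP; split; apply/eqP; ring.
  by cbv zeta; rewrite cinner_pair !(sfunDE, sfunXE, sfunNE, sfunME); ring.
have h2 j : cinner (nabla A u x (coordvec R j)) ('i * ((\row_i G i x : V) 0 j)%:C * (p x +i* q x)) =
    (covQ a b A' j * G j * p - covP a b A' j * G j * q) x.
  by rewrite u_fun nablaE mxE mul_i_real cinner_pair !(sfunDE, sfunNE, sfunME); ring.
have h3 : inner2 (dform (fun y => \row_j G j y) x) (dform (fun y => \row_j G j y) x) =
    (cstf 2^-1 * \sum_j \sum_k (D j (G k) - D k (G j)) ^+ 2) x.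
  rewrite inner2_self; last first.
    by move=> j k; rewrite !dform_curl !(sfunDE, sfunNE) opprB.
  rewrite sfunME cstfE sfun_sumE; congr (_ * _); apply: eq_bigr => j _.
  by rewrite sfun_sumE; apply: eq_bigr => k _; rewrite dform_curl sfunXE.
rewrite /second_variation_density /second_var !(sfunDE, sfunNE) !sfun_sumE.
rewrite (eq_bigr _ (fun j _ => h1 j)) (eq_bigr _ (fun j _ => h2 j)) h3 higgsE uE !cinner_pair.
by rewrite !(sfunME, sfunXE, sfunDE); ring.
Qed.

Lemma energy_densityE x : energy_density u A x =
  grad2 a b A' x + 2^-1 * (\sum_j \sum_k curv A' j k x ^+ 2) + higgsf a b x ^+ 2.
Proof.
rewrite /energy_density inner2_self; last by move=> j k; rewrite !dformE /curv !(sfunDE, sfunNE) opprB.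
have -> : 4^-1 * (1 - cinner (u x) (u x)) ^+ 2 = higgsf a b x ^+ 2.
  by rewrite -higgsE /higgs exprMn exprVn; congr (_ * _); congr (_^-1); rewrite -natrX.
rewrite /grad2 sfun_sumE; congr (_ + _ * _ + _).
  by apply: eq_bigr => j _; rewrite u_fun nablaE cinner_pair.
by apply: eq_bigr => j _; apply: eq_bigr => k _; rewrite dformE.
Qed.

End Translation.

(** * Cutoff functions *)

Section Cutoffs.
Variable R : realType.
Local Notation V := 'rV[R]_4.
Local Notation sfun := (sfun R).
Implicit Types (x : V) (f : sfun).

Lemma compactly_supported_bounded (T : zmodType) (f : V -> T) (M : R) :
  (forall x, (exists k, M < `|x 0 k|) -> f x = 0) -> compactly_supported f.
Proof.
move=> f0; apply: bounded_closed_compact; last exact: closed_closure.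
have boxc : closed [set x : V | forall k, x 0 k \in `[- M, M]].
  apply: compact_closed; first exact: norm_hausdorff.
  by apply: (@rV_compact _ _ (fun=> `[- M, M]%classic)) => k; exact: segment_compact.
have sub : closure [set x | f x != 0] `<=` [set x : V | forall k, x 0 k \in `[- M, M]].
  rewrite [X in _ `<=` X](iffLR (closure_id _) boxc); apply: closure_subset => x /= /eqP fx k.
  rewrite in_itv /= -ler_norml leNgt; apply/negP => kM; apply: fx; apply: f0; by exists k.
exists (`|M|); split; first exact: num_real.
move=> M' MM' x /sub xM; change (mx_norm x <= M'); rewrite mx_normrE.
apply/bigmax_leP; split; first by rewrite (le_trans (normr_ge0 M)) // ltW.
move=> [i k] _ /=; rewrite ord1; have := xM k; rewrite in_itv /= -ler_norml => xk.
by rewrite (le_trans xk) // (le_trans (ler_norm _)) // ltW.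
Qed.

(* exp(-1/t), the standard smooth function vanishing for t <= 0. *)
Definition expf f : sfun := flatf 1 (@ltr01 R) f.
Definition dexpf f : sfun := flatf ('X^2) (@ltr01 R) f.

Lemma D_expf j f : D j (expf f) = dexpf f * D j f.
Proof.
rewrite /expf D_flat /dexpf; congr (flatf _ _ _ * _).
by rewrite derivC subr0 scale1r mulr1.
Qed.

Lemma expf_ge0 f x : 0 <= expf f x.
Proof. exact: flat_ge0. Qed.

Lemma expf_gt0 f x : 0 < f x -> 0 < expf f x.
Proof. exact: flat_gt0. Qed.

Lemma expf_le0 f x : f x <= 0 -> expf f x = 0.
Proof. exact: flat_le0. Qed.

Lemma dexpf_le0 f x : f x <= 0 -> dexpf f x = 0.
Proof. exact: flat_le0. Qed.

Lemma dexpf_bounds f x : 0 <= dexpf f x <= 2.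
Proof.
rewrite flatfE /flat; case: ifP => f0; last by rewrite lexx /=.
have iv : 0 < (f x)^-1 by rewrite invr_gt0.
rewrite hornerXn; apply/andP; split; first by rewrite mulr_ge0 ?expR_ge0 ?exprn_ge0 // ltW.
by have := powM_expRN_le 2 ltr01 iv; rewrite expr1n divr1.
Qed.

Lemma expf_le1 f x : expf f x <= 1.
Proof.
rewrite flatfE /flat; case: ifP => // fx.
by rewrite hornerC !mul1r -[leRHS]expR0 ler_expR oppr_le0 invr_ge0 ltW.
Qed.

Lemma expf_ge f x : 1 <= f x -> expR (- 1) <= expf f x.
Proof.
move=> f1; have f0 : 0 < f x by exact: lt_le_trans f1.
rewrite flatfE /flat f0 hornerC mul1r ler_expR lerN2 mul1r.
by rewrite invf_le1.
Qed.

Lemma bump_exists x0 (r : R) : 0 < r ->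
  exists b : sfun, [/\ cs b, forall x, 0 <= b x <= 1, 0 < b x0 &
    forall x, (exists k, r <= `|x 0 k - x0 0 k|) -> b x = 0].
Proof.
move=> r0.
pose q : sfun := cstf (r ^+ 2) - \sum_k (coordf R k - cstf (x0 0 k)) ^+ 2.
have qE x : q x = r ^+ 2 - \sum_k (x 0 k - x0 0 k) ^+ 2.
  rewrite sfunDE sfunNE sfun_sumE cstfE.
  by under eq_bigr do rewrite sfunXE sfunDE sfunNE.
have q0 x : (exists k, r <= `|x 0 k - x0 0 k|) -> q x <= 0.
  move=> [k rk]; rewrite qE subr_le0 (bigD1 k) //= -[leLHS]addr0.
  by rewrite lerD ?sumr_ge0 // => [|i _]; [rewrite -[leRHS]real_normK ?num_real // ler_pXn2r ?nnegrE // ltW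
    |rewrite sqr_ge0].
exists (expf q); split.
- exists (r + \sum_k `|x0 0 k|) => x [k kM]; apply/expf_le0/q0; exists k.
  have : `|x 0 k| <= `|x 0 k - x0 0 k| + `|x0 0 k|.
    by rewrite (le_trans _ (ler_normD _ _)) // subrK.
  have : `|x0 0 k| <= \sum_k `|x0 0 k| by rewrite (bigD1 k) //= lerDl sumr_ge0.
  lra.
- by move=> x; rewrite expf_ge0 expf_le1.
- apply: expf_gt0; rewrite qE big1 ?subr0 ?exprn_gt0 // => k _.
  by rewrite subrr expr0n.
- by move=> x /q0; exact: expf_le0.
Qed.

Lemma step_den_gt0 f x : 0 < (expf (cstf 4 - f) + expf (f - cstf 1)) x.
Proof.
rewrite sfunDE; have [f4|f4] := ltP (f x) 4.
  by rewrite ltr_wpDr ?expf_ge0 // expf_gt0 // sfunDE sfunNE subr_gt0.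
rewrite ltr_wpDl ?expf_ge0 // expf_gt0 // sfunDE sfunNE subr_gt0.
by rewrite (lt_le_trans _ f4) // ltr1n.
Qed.

(* Equal to 1 where f <= 1 and to 0 where f >= 4; both terms of the denominator vanish nowhere at once. *)
Definition stepf f : sfun := expf (cstf 4 - f) * invf (step_den_gt0 f).

Lemma step_denE f x :
  stepf f x * (expf (cstf 4 - f) x + expf (f - cstf 1) x) = expf (cstf 4 - f) x.
Proof.
rewrite -sfunDE sfunME invfE mulfVK // gt_eqF //; exact: step_den_gt0.
Qed.

Lemma stepf_bounds f x : 0 <= stepf f x <= 1.
Proof.
have d0 := step_den_gt0 f x; rewrite sfunME invfE; apply/andP; split.
  by rewrite mulr_ge0 ?expf_ge0 // invr_ge0 ltW.
by rewrite ler_pdivrMr // mul1r sfunDE lerDl expf_ge0.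
Qed.

Lemma stepf1 f x : f x <= 1 -> stepf f x = 1.
Proof.
move=> f1; have e0 : expf (f - cstf 1) x = 0 by apply: expf_le0; rewrite sfunDE sfunNE subr_le0.
have := step_denE f x; rewrite e0 addr0 => E.
have e4 : 0 < expf (cstf 4 - f) x.
  by apply: expf_gt0; rewrite sfunDE sfunNE subr_gt0 (le_lt_trans f1) // ltr1n.
by apply: (mulIf (lt0r_neq0 e4)); rewrite E mul1r.
Qed.

Lemma stepf0 f x : 4 <= f x -> stepf f x = 0.
Proof.
by move=> f4; rewrite sfunME expf_le0 ?mul0r // sfunDE sfunNE subr_le0.
Qed.

(* The step has derivative - k; the cutoffs depend on k through its size and support. *)
Lemma D_stepf f : exists k : V -> R,
  [/\ forall j x, D j (stepf f) x = - (k x * D j f x),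
      forall x, `|k x| <= 2 * expR 1 & forall x, f x <= 1 \/ 4 <= f x -> k x = 0].
Proof.
pose a1 x := dexpf (cstf 4 - f) x; pose b1 x := dexpf (f - cstf 1) x.
pose den x := expf (cstf 4 - f) x + expf (f - cstf 1) x.
have den0 x : 0 < den x by rewrite /den -sfunDE step_den_gt0.
pose num x := (1 - stepf f x) * a1 x + stepf f x * b1 x.
exists (fun x => num x / den x); split => [j x|x|x fx].
- have E : stepf f * (expf (cstf 4 - f) + expf (f - cstf 1)) = expf (cstf 4 - f).
    by rewrite -mulrA invfM mulr1.
  have /(congr1 (fun g : sfun => g x)) := congr1 (D j) E.
  rewrite DM DD !D_expf !DD !DN !D_cst !(sfunDE, sfunME, sfunNE, sfun0E).
  rewrite -/(a1 x) -/(b1 x) -/(den x) => H.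
  apply: (mulIf (lt0r_neq0 (den0 x))).
  have -> : D j (stepf f) x * den x = a1 x * - D j f x - stepf f x * (a1 x * - D j f x + b1 x * D j f x).
    have -> : stepf f x = expf (cstf 4 - f) x * invf (step_den_gt0 f) x by exact: sfunME.
    by move: H; rewrite add0r subr0 => /(canRL (addrK _)).
  have dn : den x != 0 by rewrite gt_eqF.
  by rewrite /num; field.
- have /andP[s0 s1] := stepf_bounds f x.
  have /andP[a0 a2] := dexpf_bounds (cstf 4 - f) x.
  have /andP[b0 b2] := dexpf_bounds (f - cstf 1) x.
  have n0 : 0 <= num x by rewrite addr_ge0 // mulr_ge0 // subr_ge0.
  have n2 : num x <= 2.
    have h1 : (1 - stepf f x) * a1 x <= (1 - stepf f x) * 2 by rewrite ler_wpM2l // subr_ge0.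
    have h2 : stepf f x * b1 x <= stepf f x * 2 by rewrite ler_wpM2l.
    by rewrite /num; lra.
  have dl : expR (- 1) <= den x.
    have [f4|f4] := leP (f x) 3.
      rewrite (@le_trans _ _ (expf (cstf 4 - f) x)) ?lerDl ?expf_ge0 //.
      by apply: expf_ge; rewrite sfunDE sfunNE cstfE; lra.
    rewrite (@le_trans _ _ (expf (f - cstf 1) x)) ?lerDr ?expf_ge0 //.
    by apply: expf_ge; rewrite sfunDE sfunNE cstfE; lra.
  have dp := ltW (den0 x).
  rewrite ger0_norm ?divr_ge0 // ler_pM ?invr_ge0 //.
  by rewrite -[expR 1]invrK -expRN lef_pV2 // posrE ?expR_gt0.
- have -> : num x = 0; last by rewrite mul0r.
  rewrite /num; case: fx => fx.
    by rewrite stepf1 // subrr mul0r /b1 dexpf_le0 ?mulr0 ?addr0 // sfunDE sfunNE subr_le0.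
  by rewrite stepf0 // mul0r /a1 dexpf_le0 ?mulr0 ?addr0 // sfunDE sfunNE subr_le0.
Qed.

Definition sqnorm : sfun := \sum_k coordf R k * coordf R k.

Lemma sqnormE x : sqnorm x = euclid x x.
Proof. by rewrite sfun_sumE. Qed.

Lemma D_sqnorm j : D j sqnorm = coordf R j *+ 2.
Proof.
rewrite /sqnorm Dsum (bigD1 j) //= big1 ?addr0; last first.
  by move=> k kj; rewrite DM !D_coord eq_sym (negbTE kj) mul0r mulr0 addr0.
by rewrite DM !D_coord eqxx mul1r mulr1 mulr2n.
Qed.

Lemma coord_le_sqnorm x k : x 0 k ^+ 2 <= sqnorm x.
Proof.
by rewrite sqnormE /euclid (bigD1 k) //= expr2 lerDl sumr_ge0 // => i _; rewrite -expr2 sqr_ge0.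
Qed.

Lemma cs_sqnorm f (r : R) : (forall x, r < sqnorm x -> f x = 0) -> cs f.
Proof.
move=> f0; exists (1 + `|r|) => x [k kM]; apply: f0.
apply: lt_le_trans (coord_le_sqnorm x k).
rewrite -[ltRHS]real_normK ?num_real // (le_lt_trans (ler_norm r)) //.
have k1 : 1 <= `|x 0 k| by rewrite (le_trans _ (ltW kM)) // lerDl.
rewrite (@lt_le_trans _ _ `|x 0 k|) //; last by rewrite expr2 ler_peMl // (le_trans ler01).
by rewrite (le_lt_trans _ kM) // lerDr.
Qed.

(** In dimension 4 an energy of quadratic growth is parabolic: there are cutoffs equal to 1 on a
    given ball whose gradients see arbitrarily little energy. *)
Section LogarithmicCutoff.
Variables (e : sfun) (C r0 : R).
Hypotheses (e_ge0 : forall x, 0 <= e x) (C_ge0 : 0 <= C) (r0_ge1 : 1 <= r0).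
Hypothesis e_growth : forall r : R, 1 <= r ->
  (integral4 (euclid_ball r) e <= (C * r ^+ 2)%:E)%E.

Let rho n : R := r0 ^+ 2 * 4 ^+ n.
Let scaled n : sfun := cstf (rho n)^-1 * sqnorm.
Let zeta n : sfun := stepf (scaled n).
Let grad (f : sfun) : sfun := \sum_j D j f ^+ 2.

Let r0_gt0 : 0 < r0. Proof. exact: lt_le_trans ltr01 r0_ge1. Qed.
Let rho_gt0 n : 0 < rho n.
Proof. by rewrite mulr_gt0 // ?exprn_gt0. Qed.

Let scaledE n x : scaled n x = sqnorm x / rho n.
Proof. by rewrite sfunME cstfE mulrC. Qed.

Let D_scaled n j x : D j (scaled n) x = (rho n)^-1 * (x 0 j *+ 2).
Proof. by rewrite DM D_cst mul0r add0r D_sqnorm sfunME sfunMnE. Qed.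

Let zeta_grad n : exists k : V -> R,
  [/\ forall j x, D j (zeta n) x = - (k x * ((rho n)^-1 * (x 0 j *+ 2))),
      forall x, grad (zeta n) x <= 64 * expR 1 ^+ 2 / rho n &
      forall x, sqnorm x <= rho n \/ 4 * rho n <= sqnorm x -> k x = 0].
Proof.
have [k [Dk k2 k0]] := D_stepf (scaled n); exists k; split=> [j x|x|x H]; first by rewrite Dk D_scaled.
- rewrite sfun_sumE.
  have E : \sum_j (D j (zeta n) ^+ 2) x = k x ^+ 2 * (4 * scaled n x / rho n).
    rewrite scaledE sqnormE /euclid mulr_suml !mulr_sumr.
    rewrite mulr_suml mulr_sumr; apply: eq_bigr => j _.
    by rewrite sfunXE Dk D_scaled; ring.
  have B0 : 0 <= 64 * expR 1 ^+ 2 / rho n by rewrite divr_ge0 ?mulr_ge0 ?sqr_ge0 // ltW.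
  rewrite E; have [s1|s1] := leP (scaled n x) 1.
    by rewrite (k0 _ (or_introl s1)) expr0n mul0r.
  have [s4|s4] := leP 4 (scaled n x).
    by rewrite (k0 _ (or_intror s4)) expr0n mul0r.
  have -> : 64 * expR 1 ^+ 2 / rho n = (2 * expR 1) ^+ 2 * (4 * 4 / rho n) by ring.
  have ri : 0 < (rho n)^-1 by rewrite invr_gt0.
  apply: ler_pM; rewrite ?sqr_ge0 //.
  + by rewrite mulr_ge0 ?ltW // mulr_gt0 // (lt_trans ltr01).
  + by rewrite -[leLHS]real_normK ?num_real // lerXn2r ?nnegrE ?mulr_ge0 ?expR_ge0.
  + by rewrite ler_pM2r // ler_pM2l // ltW.
- apply: k0; rewrite scaledE ler_pdivrMr // mul1r ler_pdivlMr //.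
Qed.

Let zeta_cs n : cs (zeta n).
Proof.
apply: (@cs_sqnorm _ (4 * rho n)) => x xr; apply: stepf0.
by rewrite scaledE ler_pdivlMr // ltW.
Qed.

Let grad_cs n f : cs (grad (zeta n) * f).
Proof. by apply: csMr; apply: cs_sum => j; rewrite expr2; exact/csMr/cs_der/zeta_cs. Qed.

Let grad_ge0 f x : 0 <= grad f x.
Proof. by rewrite sfun_sumE sumr_ge0 // => j _; rewrite sfunXE sqr_ge0. Qed.

Let int_grad n : int4 (grad (zeta n) * e) <= 256 * expR 1 ^+ 2 * C.
Proof.
have [k [Dk gk k0]] := zeta_grad n.
pose r := 2 * r0 * 2 ^+ n.
have rE : r ^+ 2 = 4 * rho n.
  rewrite /r /rho !exprMn -!exprM mulnC exprM.
  have -> : (2 : R) ^+ 2 = 4 by ring.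
  by rewrite mulrA.
have rgt0 : 0 < r by rewrite !mulr_gt0 ?exprn_gt0.
have r1 : 1 <= r.
  by rewrite /r mulr_ege1 ?exprn_ege1 ?ler1n // mulr_ege1 ?ler1n.
have -> : 256 * expR 1 ^+ 2 * C = 64 * expR 1 ^+ 2 / rho n * (C * r ^+ 2).
  by rewrite rE; field; rewrite gt_eqF.
have c0 : 0 <= 64 * expR 1 ^+ 2 / rho n.
  by rewrite divr_ge0 ?mulr_ge0 ?sqr_ge0 // ltW.
apply: (int4_le_ball (grad_cs n e) c0 e_ge0) (e_growth r1) => x.
- by move=> _; rewrite sfunME ler_wpM2r.
- by rewrite sfunME mulr_ge0.
- move=> xr; rewrite sfunME sfun_sumE big1 ?mul0r // => j _.
  rewrite sfunXE Dk k0 ?mul0r ?oppr0 ?expr0n //; right.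
  rewrite -rE sqnormE leNgt; apply/negP => H; apply: xr.
  by rewrite /euclid_ball /= -[r]gtr0_norm // -sqrtr_sqr ltr_sqrt // exprn_gt0.
Qed.

Let zeta_disjoint n m j : n != m -> D j (zeta n) * D j (zeta m) = 0.
Proof.
wlog nm : n m / (n < m)%N => [H nm|_].
  have [?|?|E] := ltngtP n m; [exact: H|by rewrite mulrC; apply: H => //; rewrite eq_sym|].
  by rewrite E eqxx in nm.
have [k [Dk _ k0]] := zeta_grad n; have [l [Dl _ l0]] := zeta_grad m.
apply/sfun_ext => x; rewrite sfunME sfun0E.
have [xm|xm] := leP (sqnorm x) (rho m); first by rewrite Dl l0 ?mul0r ?oppr0 ?mulr0 //; left.
rewrite Dk k0 ?mul0r ?oppr0 ?mul0r //; right; rewrite (le_trans _ (ltW xm)) //.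
by rewrite /rho mulrCA -exprS ler_pM2l ?exprn_gt0 // ler_weXn2l // ler1n.
Qed.

(** Averaging N dyadic cutoffs, whose gradients live on disjoint annuli, divides
    the scale-invariant bound of [int_grad] by N. *)
Lemma log_cutoff (tau : R) : 0 < tau -> exists eta : sfun,
  [/\ cs eta, forall x, 0 <= eta x <= 1, forall x, sqnorm x <= r0 ^+ 2 -> eta x = 1 &
      int4 ((\sum_j D j eta ^+ 2) * e) <= tau].
Proof.
move=> tau0; pose K := 256 * expR 1 ^+ 2 * C.
have K0 : 0 <= K by rewrite /K mulr_ge0 // mulr_ge0 // sqr_ge0.
pose N := (Num.truncn (K / tau)).+1.
have N0 : (0 : R) < N%:R by rewrite ltr0n.
have KN : K / N%:R <= tau.
  rewrite ler_pdivrMr // mulrC -ler_pdivrMr // ltW //.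
  by have /andP[_] := truncn_itv (divr_ge0 K0 (ltW tau0)).
pose eta := cstf N%:R^-1 * \sum_(n < N) zeta n.
have etaE x : eta x = N%:R^-1 * \sum_(n < N) zeta n x by rewrite sfunME sfun_sumE.
have eta_cs : cs eta by apply: csMl; apply: cs_sum => n.
exists eta; split => // [x|x xr|].
- rewrite etaE; apply/andP; split.
    apply: mulr_ge0; first by rewrite invr_ge0 ltW.
    by apply: sumr_ge0 => n _; case/andP: (stepf_bounds (scaled n) x).
  rewrite ler_pdivrMl // mulr1 (@le_trans _ _ (\sum_(n < N) 1)) //.
    by apply: ler_sum => n _; case/andP: (stepf_bounds (scaled n) x).
  by rewrite sumr_const card_ord.
- rewrite etaE (eq_bigr (fun=> 1)) ?sumr_const ?card_ord ?mulVf ?gt_eqF // => n _.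
  apply: stepf1; rewrite scaledE ler_pdivrMr // mul1r (le_trans xr) // /rho.
  by rewrite ler_peMr ?sqr_ge0 // exprn_ege1 // ler1n.
- have E : (\sum_j D j eta ^+ 2) * e = cstf (N%:R^-1 ^+ 2) * \sum_(n < N) (grad (zeta n) * e).
    have Dsq j : D j eta ^+ 2 = cstf (N%:R^-1 ^+ 2) * \sum_(n < N) D j (zeta n) ^+ 2.
      rewrite /eta DM D_cst mul0r add0r Dsum exprMn; congr (_ * _).
        by apply/sfun_ext => x; rewrite sfunXE.
      rewrite expr2 mulr_suml; apply: eq_bigr => n _; rewrite mulr_sumr (bigD1 n) //= big1 ?addr0 //.
      by move=> m mn; apply: zeta_disjoint; rewrite eq_sym -val_eqE in mn *.
    rewrite (eq_bigr _ (fun j _ => Dsq j)) -mulr_sumr exchange_big /= -mulrA; congr (_ * _).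
    by rewrite mulr_suml.
  rewrite E int4_cstM; last by apply: cs_sum => n; exact: grad_cs.
  have S : int4 (\sum_(n < N) grad (zeta n) * e) <= N%:R * K.
    have [_ H] : cs (\sum_(n < N) grad (zeta n) * e) /\
        int4 (\sum_(n < N) grad (zeta n) * e) <= \sum_(n < N) K.
      elim/big_rec2: _ => [|n a c _ [ca ac]]; first by split; [exact: cs0|rewrite int4_0].
      split; first by apply: csD => //; exact: grad_cs.
      by rewrite int4D ?grad_cs // lerD // int_grad.
    by rewrite (le_trans H) // sumr_const card_ord mulr_natl.
  apply: le_trans KN; rewrite (@le_trans _ _ (N%:R^-1 ^+ 2 * (N%:R * K))) //.
    by rewrite ler_wpM2l // sqr_ge0.
  by rewrite le_eqVlt; apply/orP; left; apply/eqP; field; rewrite gt_eqF.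
Qed.

End LogarithmicCutoff.
End Cutoffs.

(** * Self-dual and anti-self-dual forms *)

Section SelfDualAlgebra.

Definition t0 : 'I_3 := @Ordinal 3 0 isT.
Definition t1 : 'I_3 := @Ordinal 3 1 isT.
Definition t2 : 'I_3 := @Ordinal 3 2 isT.

Lemma sum3 (G : nmodType) (f : 'I_3 -> G) : \sum_j f j = f t0 + f t1 + f t2.
Proof.
rewrite !big_ord_recr big_ord0 /= add0r.
by congr (f _ + f _ + f _); exact: val_inj.
Qed.

Section Generic.
Variable K : comPzRingType.
Implicit Types (s : K) (w : 'I_4 -> 'I_4 -> K) (v : 'I_3 -> K) (i j : 'I_4).

Definition sg (c : bool) : K := if c then - 1 else 1.

(* The components of the self-dual (s = 1) or anti-self-dual (s = -1) part of a
   two-form: its inner products with the three forms [Jm s v], v a basis vector. *)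
Definition sd s w (k : 'I_3) : K :=
  nth 0 [:: w o0 o1 + s * w o2 o3; w o0 o2 - s * w o1 o3; w o0 o3 + s * w o1 o2] k.

(* For s = 1 and s = -1 these matrices span two commuting copies of the imaginary
   quaternions. *)
Definition Jm s v i j : K :=
  nth 0 (nth [::] [:: [:: 0; v t0; v t1; v t2];
                      [:: - v t0; 0; s * v t2; - (s * v t1)];
                      [:: - v t1; - (s * v t2); 0; s * v t0];
                      [:: - v t2; s * v t1; - (s * v t0); 0]] i) j.

Definition mm v v' i j : K := \sum_k Jm 1 v i k * Jm (- 1) v' k j.

Definition dot v v' : K := \sum_k v k * v' k.

Lemma sd_pairing w (w' : 'I_4 -> 'I_4 -> K) :
  (forall i j, w i j = - w j i) -> (forall i j, w' i j = - w' j i) ->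
  (forall i, w i i = 0) ->
  \sum_i \sum_j w j i * w' j i = dot (sd 1 w) (sd 1 w') + dot (sd (- 1) w) (sd (- 1) w').
Proof.
move=> wN wN' w0; rewrite /dot !sum4 !sum3 /sd /= !w0.
rewrite (wN o1 o0) (wN o2 o0) (wN o3 o0) (wN o2 o1) (wN o3 o1) (wN o3 o2).
rewrite (wN' o1 o0) (wN' o2 o0) (wN' o3 o0) (wN' o2 o1) (wN' o3 o1) (wN' o3 o2).
ring.
Qed.

(* The real and imaginary parts of (r + i J) p, where J = [Jm s v] and p = P + i Q. *)
Definition rotP s (r : K) v (P Q : 'I_4 -> K) j := r * P j - \sum_k Jm s v j k * Q k.
Definition rotQ s (r : K) v (P Q : 'I_4 -> K) j := r * Q j + \sum_k Jm s v j k * P k.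

Definition sqsum (P Q : 'I_4 -> K) := \sum_j (P j * P j + Q j * Q j).
Definition wedge (P Q : 'I_4 -> K) j k := (P j * Q k - Q j * P k) *+ 2.
Definition mixed v v' (P Q : 'I_4 -> K) :=
  \sum_i \sum_j mm v v' i j * (P i * P j + Q i * Q j).

(* As i J is Hermitian, |(r + i J) p|^2 = <(r^2 + |v|^2 + 2 r i J) p, p>. *)
Lemma sqsum_rot s r v P Q : s * s = 1 -> sqsum (rotP s r v P Q) (rotQ s r v P Q) =
  (r ^+ 2 + dot v v) * sqsum P Q - (r * dot (sd s (wedge P Q)) v) *+ 2.
Proof.
move=> s1; rewrite /sqsum /dot !sum4 !sum3 /rotP /rotQ !sum4 /Jm /sd /wedge /=.
move: (P o0) (P o1) (P o2) (P o3) (Q o0) (Q o1) (Q o2) (Q o3) (v t0) (v t1) (v t2).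
move=> p0 p1 p2 p3 q0 q1 q2 q3 a b c.
ring: s1.
Qed.

(* The same computation for <i J' (r + i J) p, (r + i J) p>; J and J' commute. *)
Lemma wedge_rot r v v' P Q :
  dot (sd (- 1) (wedge (rotP 1 r v P Q) (rotQ 1 r v P Q))) v' =
  (r ^+ 2 + dot v v) * dot (sd (- 1) (wedge P Q)) v' + (r * mixed v v' P Q) *+ 2.
Proof.
rewrite /mixed /dot !sum4 !sum3 /sd /= /wedge /rotP /rotQ /mm !sum4 /Jm /=.
move: (P o0) (P o1) (P o2) (P o3) (Q o0) (Q o1) (Q o2) (Q o3) (v t0) (v t1) (v t2).
move: (v' t0) (v' t1) (v' t2).
move=> x y z p0 p1 p2 p3 q0 q1 q2 q3 a b c.
ring.
Qed.
End Generic.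

Section Reals.
Variable R : realType.
Implicit Types (v P Q : 'I_4 -> R).

(** Up to the factor 4, [(t, m) |-> t Id - J J'] is an isometry from scalars plus tensors
    to symmetric matrices. *)
Lemma mm_isometry (t tau th : R) (v v' x x' : 'I_3 -> R) :
  \sum_i \sum_j (2^-1 * (t * (i == j)%:R - tau * mm v v' i j
     - th * (mm x v' i j + mm v x' i j))) ^+ 2 =
  t ^+ 2 + \sum_a \sum_b (tau * (v a * v' b) + th * (x a * v' b + v a * x' b)) ^+ 2.
Proof.
rewrite !sum4 !sum3 /mm !sum4 /Jm /=.
by field.
Qed.

Lemma sqsum_ge0 P Q : 0 <= sqsum P Q.
Proof. by rewrite sumr_ge0 // => j _; rewrite addr_ge0 // -expr2 sqr_ge0. Qed.

Lemma le_sum_term (n : nat) (f : 'I_n -> R) i : (forall j, 0 <= f j) -> f i <= \sum_j f j.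
Proof. by move=> f0; rewrite (bigD1 i) //= lerDl sumr_ge0. Qed.

Lemma sqsum_eq0 P Q : sqsum P Q = 0 -> forall j, P j = 0 /\ Q j = 0.
Proof.
move=> S0 j; have : P j ^+ 2 + Q j ^+ 2 <= 0.
  rewrite -S0 !expr2; apply: (le_sum_term (f := fun j => P j * P j + Q j * Q j)) => l.
  by rewrite addr_ge0 // -expr2 sqr_ge0.
move=> H; split; apply/eqP; rewrite -sqrf_eq0 eq_le sqr_ge0 andbT (le_trans _ H) //.
  by rewrite lerDl sqr_ge0.
by rewrite lerDr sqr_ge0.
Qed.

Lemma wedge_le (s r : R) (v : 'I_3 -> R) P Q : s * s = 1 -> 0 <= r -> dot v v <= r ^+ 2 ->
  dot (sd s (wedge P Q)) v <= r * sqsum P Q.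
Proof.
move=> s1; rewrite le_eqVlt => /orP[/eqP <-|r0] vr.
  have v0 k : v k = 0.
    apply/eqP; rewrite -sqrf_eq0 eq_le sqr_ge0 andbT; apply: (le_trans _ (le_trans vr _)).
      2: by rewrite expr0n.
    by rewrite /dot (bigD1 k) //= expr2 lerDl sumr_ge0 // => i _; rewrite -expr2 sqr_ge0.
  by rewrite mul0r /dot big1 // => k _; rewrite v0 mulr0.
have := sqsum_ge0 (rotP s r v P Q) (rotQ s r v P Q); rewrite sqsum_rot // => H.
have : 0 <= (r * (r * sqsum P Q - dot (sd s (wedge P Q)) v)) *+ 2.
  apply: le_trans H _.
  have : (r ^+ 2 + dot v v) * sqsum P Q <= (r ^+ 2 *+ 2) * sqsum P Q.
    by rewrite ler_wpM2r ?sqsum_ge0 // mulr2n lerD2l.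
  lra.
by rewrite pmulrn_lge0 // pmulr_rge0 // subr_ge0.
Qed.

(* For r ^+ 2 = |v|^2 + d^2 the operators r + i J and (r + d + i J)^2 are proportional, so
   the left-hand side is a multiple of |(r + d + i J) (t + d + i J') p|^2. *)
Lemma mixed_bound (d r t : R) (v v' : 'I_3 -> R) P Q :
  0 <= d -> 0 < r -> 0 < t -> r ^+ 2 = dot v v + d ^+ 2 -> t ^+ 2 = dot v' v' + d ^+ 2 ->
  mixed v v' P Q <= r * t * sqsum P Q - t * dot (sd 1 (wedge P Q)) v
     - r * dot (sd (- 1) (wedge P Q)) v'.
Proof.
move=> d0 r0 t0' rE tE.
pose P1 := rotP 1 (r + d) v P Q; pose Q1 := rotQ 1 (r + d) v P Q.
have := sqsum_ge0 (rotP (- 1) (t + d) v' P1 Q1) (rotQ (- 1) (t + d) v' P1 Q1).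
rewrite sqsum_rot ?mulrNN ?mulr1 // {}/P1 {}/Q1 wedge_rot sqsum_rot ?mulr1 //.
have -> : dot v v = r ^+ 2 - d ^+ 2 by rewrite rE; ring.
have -> : dot v' v' = t ^+ 2 - d ^+ 2 by rewrite tE; ring.
move: (sqsum P Q) (dot _ v) (dot _ v') (mixed _ _ _ _) => e X Y G H.
have {H} : 0 <= (r + d) * ((t + d) * (r * t * e - t * X - r * Y - G)) by lra.
by rewrite pmulr_rge0 ?ltr_wpDr // pmulr_rge0 ?ltr_wpDr // subr_ge0.
Qed.

End Reals.
End SelfDualAlgebra.

(** * Local constructions *)

Section LocalTools.
Variable R : realType.
Local Notation V := 'rV[R]_4.
Local Notation sfun := (sfun R).
Implicit Types (x y z : V) (f g : sfun).

Lemma nbhs_box x (S : set V) :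
  nbhs x S <-> exists2 d : R, 0 < d & forall y, (forall k, `|y 0 k - x 0 k| < d) -> S y.
Proof.
split=> [/nbhs_ballP[d /= d0 H]|[d d0 H]].
  exists d => // y yx; apply: H; split=> // i k; rewrite ord1.
  by rewrite /ball /= distrC.
apply/nbhs_ballP; exists d => //= y [_ yx]; apply: H => k.
by have := yx 0 k; rewrite /ball /= distrC.
Qed.

Lemma near_gt (f : V -> R) x (c : R) : {for x, continuous f} -> c < f x -> \forall y \near x, c < f y.
Proof.
move=> cf cfx; have d0 : 0 < f x - c by rewrite subr_gt0.
have /cvgrPdist_lt /(_ _ d0) := cf; apply: filterS => y.
by rewrite ltr_norml => /andP[_]; rewrite ltrD2l ltrN2.
Qed.

Lemma near_near x (S : set V) : (\forall y \near x, S y) -> \forall y \near x, \forall z \near y, S z.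
Proof. exact: nbhs_interior. Qed.

Definition sqdist z : sfun := \sum_k (coordf R k - cstf (z 0 k)) ^+ 2.

Lemma sqdistE z x : sqdist z x = \sum_k (x 0 k - z 0 k) ^+ 2.
Proof. by rewrite sfun_sumE; apply: eq_bigr => k _; rewrite sfunXE. Qed.

Lemma D_sqdist z j : D j (sqdist z) = (coordf R j - cstf (z 0 j)) *+ 2.
Proof.
rewrite /sqdist Dsum (bigD1 j) //= big1 ?addr0; last first.
  move=> k kj; rewrite expr2 DM DD DN D_coord D_cst eq_sym (negbTE kj) mulr0n; ring.
rewrite expr2 DM DD DN D_coord D_cst eqxx mulr1n; ring.
Qed.

Lemma sqdist_ge0 z x : 0 <= sqdist z x.
Proof. by rewrite sqdistE sumr_ge0 // => k _; rewrite sqr_ge0. Qed.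

Lemma coord_le_sqdist z x k : (x 0 k - z 0 k) ^+ 2 <= sqdist z x.
Proof. by rewrite sqdistE (bigD1 k) //= lerDl sumr_ge0 // => i _; rewrite sqr_ge0. Qed.

Lemma sqdist_near z (r : R) : 0 < r -> \forall y \near z, sqdist z y < r.
Proof.
move=> r0; have E : 0 = (- sqdist z) z.
  by rewrite sfunNE sqdistE big1 ?oppr0 // => k _; rewrite subrr expr0n.
have := @near_gt (- sqdist z) z (- r) (sfun_continuous (f := - sqdist z) (x := z)).
by rewrite -E oppr_lt0 => /(_ r0); apply: filterS => y; rewrite sfunNE ltrN2.
Qed.

Lemma nbhs_sqdist z (S : set V) : nbhs z S -> exists2 r : R, 0 < r & forall y, sqdist z y < r -> S y.
Proof.
move=> /nbhs_box[d d0 H]; exists (d ^+ 2); first by rewrite exprn_gt0.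
move=> y yd; apply: H => k; rewrite -ltr_sqr ?nnegrE ?normr_ge0 ?(ltW d0) //.
by rewrite real_normK ?num_real // (le_lt_trans (coord_le_sqdist z y k)).
Qed.

Lemma cutoff_near x (S : set V) : nbhs x S -> exists s : sfun,
  [/\ forall y, 0 <= s y <= 1, \forall y \near x, s y = 1 & forall y, ~ S y -> s y = 0].
Proof.
move=> /nbhs_sqdist[r r0 H]; exists (stepf (cstf (4 / r) * sqdist x)); split.
- by move=> y; exact: stepf_bounds.
- have r4 : 0 < r / 4 by rewrite divr_gt0.
  apply: filterS (sqdist_near x r4) => y yr; apply: stepf1; rewrite sfunME cstfE.
  by rewrite mulrAC ler_pdivrMr // mul1r mulrC -ler_pdivlMr // ltW.
- move=> y Sy; apply: stepf0; rewrite sfunME cstfE mulrAC ler_pdivlMr // ler_pM2l //.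
  by rewrite leNgt; apply/negP => /H.
Qed.

(* If f = 0 near x and s is a cutoff supported there, then 0 = d (f s) = df at x. *)
Lemma D_near0 f x j : (\forall y \near x, f y = 0) -> D j f x = 0.
Proof.
move=> f0; have fx := nbhs_singleton f0.
have [s [_ s1 s0]] := cutoff_near f0; have {}s1 := nbhs_singleton s1.
have E : f * s = 0.
  apply/sfun_ext => y; rewrite sfunME sfun0E; have [->|fy] := eqVneq (f y) 0; rewrite ?mul0r //.
  by rewrite s0 ?mulr0 // => fy0; rewrite fy0 eqxx in fy.
have : D j (f * s) x = 0 by rewrite E D0.
by rewrite DM sfunDE !sfunME fx mul0r addr0 s1 mulr1.
Qed.

Lemma D_near f g x j : (\forall y \near x, f y = g y) -> D j f x = D j g x.
Proof.
move=> fg; apply/eqP; rewrite -subr_eq0 -sfunNE -sfunDE -DN -DD; apply/eqP/D_near0.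
by apply: filterS fg => y; rewrite sfunDE sfunNE => ->; rewrite subrr.
Qed.

Lemma D_near_nbhs f g x j : (\forall y \near x, f y = g y) ->
  \forall y \near x, D j f y = D j g y.
Proof. by move=> /near_near; apply: filterS => y; exact: D_near. Qed.

Lemma lap_near f g x : (\forall y \near x, f y = g y) -> lap f x = lap g x.
Proof.
move=> fg; rewrite /lap !sfun_sumE; apply: eq_bigr => j _.
exact/D_near/D_near_nbhs.
Qed.

(* Gives access to square roots and inverses of functions that are only locally positive. *)
Lemma positive_extension f x : 0 < f x ->
  exists g, (forall y, 0 < g y) /\ \forall y \near x, g y = f y.
Proof.
move=> fx; have [s [s01 s1 s0]] := cutoff_near (near_gt (sfun_continuous (f := f) (x := x)) fx).
exists (s * f + (1 - s)); split=> [y|]; last first.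
  by apply: filterS s1 => y sy; rewrite sfunDE sfunME sfunDE sfunNE sfun1E sy subrr mul1r addr0.
rewrite sfunDE sfunME sfunDE sfunNE sfun1E.
have /andP[sy0 sy1] := s01 y; have [fy|fy] := ltP 0 (f y); last first.
  by rewrite s0 ?mul0r ?add0r ?subr0 // => fy'; rewrite ltNge fy in fy'.
move: sy1; rewrite le_eqVlt => /orP[/eqP ->|sy1]; first by rewrite mul1r subrr addr0.
by rewrite ltr_wpDl ?subr_gt0 // mulr_ge0 // ltW.
Qed.

Lemma const_near f x : (\forall y \near x, forall k, D k f y = 0) -> \forall y \near x, f y = f x.
Proof.
move=> /nbhs_box[d d0 H]; apply/nbhs_box; exists d => // y yx.
have [c c1 E] := mvt_line x 1 (fun z => is_derive_dir f z (y - x)).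
have -> : y = 1 *: (y - x) + x by rewrite scale1r subrK.
apply/eqP; rewrite -subr_eq0 E mulr1 big1 // => k _; rewrite H ?mulr0 // => l.
rewrite !mxE addrK normrM (le_lt_trans _ (yx l)) // -[leRHS]mul1r.
by rewrite ler_wpM2r //; move: c1; rewrite normr1.
Qed.

Lemma const_everywhere f : (forall y k, D k f y = 0) -> forall x y, f x = f y.
Proof.
move=> H x y.
have [c c1 E] := mvt_line y 1 (fun z => is_derive_dir f z (x - y)).
have -> : x = 1 *: (x - y) + y by rewrite scale1r subrK.
by apply/eqP; rewrite -subr_eq0 E mulr1 big1 // => k _; rewrite H mulr0.
Qed.

Lemma euclid_ballE (r : R) x : 0 < r -> euclid_ball r x <-> sqnorm R x < r ^+ 2.
Proof.
move=> r0; rewrite /euclid_ball /= sqnormE.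
by rewrite -{1}[r]gtr0_norm // -sqrtr_sqr ltr_sqrt ?exprn_gt0.
Qed.

(** Four-dimensional volume beats quadratic growth. *)
Lemma quadratic_growth_inf (e : sfun) (C m : R) : (forall x, 0 <= e x) -> 0 <= C ->
  (forall r, 1 <= r -> (integral4 (euclid_ball r) e <= (C * r ^+ 2)%:E)%E) ->
  0 < m -> exists x, e x < m.
Proof.
move=> e0 C0 eC m0; apply: contrapT => /forallNP em.
have {}em x : m <= e x by rewrite leNgt; apply/negP/em.
pose r := 1 + 17 * (C / m).
have Cm : 0 <= C / m by rewrite divr_ge0 // ltW.
have r1 : 1 <= r by rewrite lerDl mulr_ge0.
have r0 : 0 < r := lt_le_trans ltr01 r1.
pose B := ball_box (0 : V) (r / 4).
have r4 : 0 < r / 4 by rewrite divr_gt0.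
have mB : measurable B := measurable_ball_box 0 (r / 4).
have /measurable_EFinP me := measurable_row4 (sfun_continuous (f := e)).
have BE : B `<=` @row4 R @^-1` euclid_ball r.
  move=> p Bp; apply/euclid_ballE => //; rewrite sqnormE /euclid.
  apply: (@le_lt_trans _ _ (\sum_(k < 4) (r / 4) ^+ 2)).
    apply: ler_sum => k _; rewrite -expr2 -real_normK ?num_real // ler_sqr ?nnegrE ?normr_ge0 ?(ltW r4) //.
    by have := Bp k; rewrite [(0 : V) _ _]mxE subr0.
  rewrite sumr_const card_ord; have := exprn_gt0 2 r0; lra.
have : (\int[lebesgue4 R]_(p in B) m%:E <= (C * r ^+ 2)%:E)%E.
  apply: le_trans (eC r r1); apply: (@le_trans _ _ (\int[lebesgue4 R]_(p in B) (e (row4 p))%:E)%E).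
    apply: ge0_le_integral => //.
    - by move=> p _; rewrite lee_fin ltW.
    - exact: measurable_funS me.
    - by move=> p _; rewrite lee_fin em.
  apply: ge0_subset_integral => //; first exact: measurable_euclid_ball.
    exact: measurable_funS me.
  by move=> p _; rewrite lee_fin.
rewrite integral_cst // measure_ball_box // -EFinM lee_fin.
have -> : m * (2 * (r / 4)) ^+ 4 = (m / 16 * r ^+ 2) * r ^+ 2 by field.
rewrite ler_pM2r ?exprn_gt0 // leNgt => /negP; apply.
rewrite -ltr_pdivrMl ?divr_gt0 // invf_div.
have -> : 16 / m * C = 16 * (C / m) by ring.
apply: (@lt_le_trans _ _ r); first by rewrite /r; lra.
by rewrite expr2 ler_peMr // ltW.
Qed.

Lemma near_gap (f g : V -> R) (x : V) : {for x, continuous f} -> {for x, continuous g} ->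
  g x < f x -> \forall y \near x, (f x - g x) / 2 < f y - g y.
Proof.
move=> cf cg gf; apply: (@near_gt (fun y => f y - g y)); last by lra.
exact: cvgB cf cg.
Qed.

Lemma near_lt2 (f g : V -> R) x : {for x, continuous f} -> {for x, continuous g} ->
  g x < f x -> \forall y \near x, g y < f y.
Proof.
move=> cf cg gf; apply: filterS (near_gap cf cg gf) => y; rewrite -[g y < _]subr_gt0.
by apply: le_lt_trans; rewrite divr_ge0 // subr_ge0 ltW.
Qed.

Lemma continuous_mul (f g : V -> R) (x : V) : {for x, continuous f} -> {for x, continuous g} ->
  {for x, continuous (fun y => f y * g y)}.
Proof. by move=> cf cg; exact: cvgM cf cg. Qed.

Lemma continuous_add (f g : V -> R) (x : V) : {for x, continuous f} -> {for x, continuous g} ->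
  {for x, continuous (fun y => f y + g y)}.
Proof. by move=> cf cg; exact: cvgD cf cg. Qed.

Lemma near_box (x : V) (S : set V) : nbhs x S ->
  exists2 r : R, 0 < r <= 1 & forall y, (forall k, `|y 0 k - x 0 k| < r) -> S y.
Proof.
move=> /nbhs_box[r r0 H]; exists (Num.min r 1); first by rewrite lt_min r0 ltr01 ge_min lexx orbT.
by move=> y yr; apply: H => k; apply: lt_le_trans (yr k) _; rewrite ge_min lexx.
Qed.

Lemma exists_box (x : V) (S T : set V) : nbhs x S -> ~ (\forall y \near x, T y) ->
  exists y, (\forall z \near y, S z) /\ ~ T y.
Proof.
move=> xS xT; apply: contrapT => H; apply: xT; apply: filterS (near_near xS) => y yS.
by apply: contrapT => Ty; apply: H; exists y.
Qed.

End LocalTools.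

(** * A convex smoothing of the positive part *)

Section SmoothPositivePart.
Variables (R : realType) (d : R) (d0 : 0 < d).
Local Notation V := 'rV[R]_4.
Local Notation sfun := (sfun R).
Variable w : sfun.

Let q1 : {poly R} := 'X^2 * (d *: 1 - 1^`()).
Let q2 : {poly R} := 'X^2 * (d *: q1 - q1^`()).

Let q1E : q1 = d *: 'X^2.
Proof. by rewrite /q1 derivC subr0 -scalerAr mulr1. Qed.

Let q1_t t : q1.[t] = d * t ^+ 2.
Proof. by rewrite q1E hornerZ hornerXn. Qed.

Let q2_t t : q2.[t] = t ^+ 2 * (d * (d * t ^+ 2) - d * (t *+ 2)).
Proof.
rewrite /q2 hornerM hornerXn hornerD hornerN hornerZ q1_t; congr (_ * (_ - _)).
by rewrite q1E derivZ derivXn hornerZ hornerMn hornerXn.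
Qed.

(** The convex smoothing t exp (- d / t) of the positive part of t, and its first two
    derivatives, evaluated at [w]. *)
Definition pos0 : sfun := w * flatf 1 d0 w.
Definition pos1 : sfun := flatf 1 d0 w + w * flatf q1 d0 w.
Definition pos2 : sfun := flatf q1 d0 w *+ 2 + w * flatf q2 d0 w.

Lemma D_pos0 k : D k pos0 = pos1 * D k w.
Proof. rewrite /pos0 DM D_flat -/q1 /pos1; ring. Qed.

Lemma D_pos1 k : D k pos1 = pos2 * D k w.
Proof. rewrite /pos1 DD DM !D_flat -/q1 -/q2 /pos2; ring. Qed.

Lemma lap_pos0 : lap pos0 = pos1 * lap w + pos2 * \sum_k D k w ^+ 2.
Proof.
rewrite /lap !mulr_sumr -big_split /=; apply: eq_bigr => k _.
rewrite D_pos0 DM D_pos1; ring.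
Qed.

Lemma pos_le0 x : w x <= 0 -> [/\ pos0 x = 0, pos1 x = 0 & pos2 x = 0].
Proof.
move=> w0; rewrite /pos0 /pos1 /pos2 !(sfunDE, sfunMnE, sfunME) !flatfE !flat_le0 //.
by rewrite !(mulr0, addr0, mul0rn).
Qed.

(* With s = d / w and z = exp (- s): 1 - s <= z <= 1. *)
Lemma pos_gt0 x : 0 < w x -> exists z s : R,
  [/\ 0 < z <= 1, 0 < s & s * w x = d] /\
  [/\ 1 - s <= z, pos0 x = w x * z, pos1 x = z * (1 + s) & 0 <= pos2 x].
Proof.
move=> w0; set t := (w x)^-1; have t0 : 0 < t by rewrite invr_gt0.
have wt : w x * t = 1 by rewrite /t mulfV // gt_eqF.
exists (expR (- (d * t))), (d * t); split; split.
- rewrite expR_gt0 /= -[leRHS]expR0 ler_expR oppr_le0 mulr_ge0 // ltW //.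
- by rewrite mulr_gt0.
- by rewrite -mulrA [t * _]mulrC wt mulr1.
- exact: expR_ge1Dx.
- by rewrite /pos0 sfunME flatfE /flat w0 hornerC mul1r.
- rewrite /pos1 sfunDE sfunME !flatfE /flat w0 -/t hornerC q1_t.
  by transitivity (expR (- (d * t)) * (1 + d * t * (w x * t))); [ring|rewrite wt mulr1].
- rewrite /pos2 sfunDE sfunMnE sfunME !flatfE /flat w0 -/t q1_t q2_t.
  move: (expR _) (expR_ge0 (- (d * t))) => z z0.
  have -> : (d * t ^+ 2 * z) *+ 2 + w x * (t ^+ 2 * (d * (d * t ^+ 2) - d * (t *+ 2)) * z) =
    (w x * t) * (d ^+ 2 * t ^+ 3 * z) + (1 - w x * t) * (d * t ^+ 2 * z) *+ 2 by ring.
  rewrite wt subrr mul1r !mul0r mul0rn addr0.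
  by rewrite mulr_ge0 // mulr_ge0 ?sqr_ge0 // exprn_ge0 // ltW.
Qed.

Lemma pos_bounds x : [/\ 0 <= pos0 x, 0 <= pos1 x & 0 <= pos2 x] /\
  [/\ pos0 x * (pos0 x - pos1 x * w x) <= 0, w x - pos0 x *+ 2 + pos0 x * pos1 x <= d *+ 2 &
      0 < w x -> pos0 x *+ 2 - pos0 x * pos1 x <= w x].
Proof.
have [w0|w0] := leP (w x) 0.
  have [-> -> ->] := pos_le0 w0; rewrite !(lexx, mul0r, mul0rn, subr0, addr0); split=> //; split=> //.
  by rewrite (le_trans w0) // mulrn_wge0 // ltW.
have [z [s [[/andP[z0 z1] s0 sw] [sz -> -> ->]]]] := pos_gt0 w0.
have zs0 : 0 <= z * (1 + s) by rewrite mulr_ge0 ?addr_ge0 // ltW.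
have wz0 : 0 <= w x * z by rewrite mulr_ge0 // ltW.
have dz2 : d * z ^+ 2 <= d by rewrite ler_piMr ?(ltW d0) // expr_le1 // ltW.
have E : w x * z * (z * (1 + s)) = w x * z ^+ 2 + d * z ^+ 2 by rewrite -sw; ring.
split; split=> //.
- have -> : w x * z - z * (1 + s) * w x = - (z * (s * w x)) by ring.
  by rewrite sw mulrN oppr_le0 mulr_ge0 // mulr_ge0 // ltW.
- rewrite E; have : w x * (1 - z) ^+ 2 <= d.
    rewrite -sw mulrC ler_pM2r // expr2.
    apply: (@le_trans _ _ (1 - z)); last by lra.
    by rewrite ler_piMr ?subr_ge0 // gerBl ltW.
  lra.
- move=> _; rewrite E; have : 0 <= w x * (1 - z) ^+ 2 by rewrite mulr_ge0 ?sqr_ge0 // ltW.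
  have : 0 <= d * z ^+ 2 by rewrite mulr_ge0 ?sqr_ge0 // ltW.
  lra.
Qed.

Lemma pos0_le x : pos0 x <= Num.max 0 (w x).
Proof.
have [w0|w0] := leP (w x) 0; first by have [-> _ _] := pos_le0 w0.
by have [z [s [[/andP[_ z1] _ _] [_ -> _ _]]]] := pos_gt0 w0; rewrite ler_piMr // ltW.
Qed.

End SmoothPositivePart.

(* Where w stays away from 0 the smoothing is nondegenerate uniformly in d. *)
Lemma pos_lower (R : realType) (d : R) (d0 : 0 < d) (w : sfun R) x (m : R) : m / 2 <= w x -> d < m / 4 ->
  m / 4 <= pos0 d0 w x /\
  forall r t, 0 <= r -> 0 <= t -> w x + t <= r -> t / 2 <= pos1 d0 w x * r - pos0 d0 w x.
Proof.
move=> w2 dm; have m0 : 0 < m by have := lt_trans d0 dm; lra.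
have w0 : 0 < w x by apply: lt_le_trans w2; rewrite divr_gt0.
have [z [s [[/andP[z0 z1] s0 sw] [sz -> -> _]]]] := pos_gt0 d0 w0.
have z2 : 2^-1 <= z.
  apply: le_trans sz; have : s * (m / 2) <= m / 4.
    by rewrite (le_trans _ (ltW dm)) // -sw ler_wpM2l // ltW.
  rewrite -ler_pdivlMr ?divr_gt0 //.
  have -> : m / 4 / (m / 2) = 2^-1 by field; rewrite gt_eqF.
  lra.
split=> [|r t r0 t0' wt].
  apply: (@le_trans _ _ (m / 2 * 2^-1)); first by lra.
  by rewrite ler_pM // ltW // divr_gt0.
have -> : z * (1 + s) * r - w x * z = z * (r - w x + s * r) by ring.
rewrite mulrC ler_pM // ?invr_ge0 //.
have : 0 <= s * r by rewrite mulr_ge0 // ltW.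
lra.
Qed.

(** * Pointwise inequalities *)

Section Evaluation.
Variable R : realType.
Local Notation sfun := (sfun R).
Implicit Types (v : 'I_3 -> sfun) (w : 'I_4 -> 'I_4 -> sfun) (c : bool).

Lemma sg_val c x : (sg sfun c) x = sg R c.
Proof. by case: c; rewrite /sg ?sfunNE sfun1E. Qed.

Lemma sgE c : sg sfun c = cstf (sg R c).
Proof. by apply/sfun_ext => x; rewrite sg_val. Qed.

Lemma sg_sqr (K : comPzRingType) c : sg K c * sg K c = 1.
Proof. by case: c; rewrite /sg ?mulrNN mulr1. Qed.

Lemma ord3_case (Pr : 'I_3 -> Prop) : Pr t0 -> Pr t1 -> Pr t2 -> forall k, Pr k.
Proof.
move=> H0 H1 H2 [[|[|[|k]]] lk] //; [move: H0|move: H1|move: H2];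
  by congr (Pr _); exact: val_inj.
Qed.

Lemma ord4_case (Pr : 'I_4 -> Prop) : Pr o0 -> Pr o1 -> Pr o2 -> Pr o3 -> forall k, Pr k.
Proof.
move=> H0 H1 H2 H3 [[|[|[|[|k]]]] lk] //; [move: H0|move: H1|move: H2|move: H3];
  by congr (Pr _); exact: val_inj.
Qed.

Lemma JmE (K : comPzRingType) (s : K) (v : 'I_3 -> K) :
  (Jm s v o0 o0 = 0) * (Jm s v o0 o1 = v t0) * (Jm s v o0 o2 = v t1) * (Jm s v o0 o3 = v t2) *
  (Jm s v o1 o0 = - v t0) * (Jm s v o1 o1 = 0) * (Jm s v o1 o2 = s * v t2) * (Jm s v o1 o3 = - (s * v t1)) *
  (Jm s v o2 o0 = - v t1) * (Jm s v o2 o1 = - (s * v t2)) * (Jm s v o2 o2 = 0) * (Jm s v o2 o3 = s * v t0) *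
  (Jm s v o3 o0 = - v t2) * (Jm s v o3 o1 = s * v t1) * (Jm s v o3 o2 = - (s * v t0)) * (Jm s v o3 o3 = 0).
Proof. by []. Qed.

Lemma Jm_scale (K : comPzRingType) (s n t : K) (v v' : 'I_3 -> K) j k :
  (forall l, n * v l = t * v' l) -> n * Jm s v j k = t * Jm s v' j k.
Proof.
move=> E; elim/ord4_case: j; elim/ord4_case: k; rewrite !JmE.
all: by rewrite ?mulr0 ?mulrN ?[n * (s * _)]mulrCA ?[t * (s * _)]mulrCA ?E.
Qed.

Lemma Jm_sqr (K : comPzRingType) (s : K) (v : 'I_3 -> K) (y : 'I_4 -> K) l : s * s = 1 ->
  \sum_k (\sum_j y j * Jm s v j k) * Jm s v k l = - (dot v v * y l).
Proof.
move=> s1; rewrite !sum4 /dot !sum3.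
elim/ord4_case: l; rewrite !JmE.
all: move: (y _) (y _) (y _) (y _) (v _) (v _) (v _) => y0 y1 y2 y3 v0 v1 v2.
all: ring: s1.
Qed.

Lemma sdE (K : comPzRingType) (s : K) (w : 'I_4 -> 'I_4 -> K) :
  (sd s w t0 = w o0 o1 + s * w o2 o3) * (sd s w t1 = w o0 o2 - s * w o1 o3) *
  (sd s w t2 = w o0 o3 + s * w o1 o2).
Proof. by []. Qed.

Lemma dotZr (K : comPzRingType) (r : K) (v x : 'I_3 -> K) : dot v (fun k => r * x k) = r * dot v x.
Proof. by rewrite /dot mulr_sumr; apply: eq_bigr => k _; rewrite mulrCA. Qed.

Lemma sd_val c w k x : sd (sg sfun c) w k x = sd (sg R c) (fun i j => w i j x) k.
Proof.
elim/ord3_case: k; cbv [sd nth nat_of_ord t0 t1 t2].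
all: by rewrite !(sfunDE, sfunNE, sfunME) sg_val.
Qed.

Lemma dot_val v (v' : 'I_3 -> sfun) x : dot v v' x = dot (fun k => v k x) (fun k => v' k x).
Proof. by rewrite /dot sfun_sumE. Qed.

Lemma Jm_val c v i j x : Jm (sg sfun c) v i j x = Jm (sg R c) (fun k => v k x) i j.
Proof.
elim/ord4_case: i; elim/ord4_case: j; cbv [Jm nth nat_of_ord o0 o1 o2 o3].
all: by rewrite ?(sfunNE, sfunME) ?sg_val ?sfun0E.
Qed.

Lemma mm_val v (v' : 'I_3 -> sfun) i j x :
  mm v v' i j x = mm (fun k => v k x) (fun k => v' k x) i j.
Proof.
by rewrite /mm sfun_sumE; apply: eq_bigr => k _; rewrite sfunME (Jm_val false) (Jm_val true).
Qed.

Lemma D_Jm c v i j k : D k (Jm (sg sfun c) v i j) = Jm (sg sfun c) (fun l => D k (v l)) i j.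
Proof.
elim/ord4_case: i; elim/ord4_case: j; cbv [Jm nth nat_of_ord o0 o1 o2 o3].
all: by rewrite ?D0 ?DN ?DM ?sgE ?D_cst ?mul0r ?add0r.
Qed.

Lemma D_mm v (v' : 'I_3 -> sfun) i j k : D k (mm v v' i j) =
  mm (fun l => D k (v l)) v' i j + mm v (fun l => D k (v' l)) i j.
Proof.
rewrite /mm Dsum -big_split /=; apply: eq_bigr => l _.
by rewrite DM (D_Jm false) (D_Jm true).
Qed.

Lemma D_dot v (v' : 'I_3 -> sfun) k : D k (dot v v') =
  dot (fun l => D k (v l)) v' + dot v (fun l => D k (v' l)).
Proof. by rewrite /dot Dsum -big_split /=; apply: eq_bigr => l _; rewrite DM. Qed.

End Evaluation.

Section RealInequalities.
Variable R : realType.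

Lemma half_lt (p : R) : 0 < p / 2 -> p / 2 < p.
Proof. lra. Qed.

Lemma double_inj (p q : R) : p *+ 2 = q *+ 2 -> p = q.
Proof. lra. Qed.

Lemma quotient_lower (m E r : R) : 0 <= m -> 0 < r -> r <= 2 -> m <= r ^+ 2 * E -> m / 16 <= E / r ^+ 2.
Proof.
move=> m0 r0 r2 mE; have r4 : 0 < r ^+ 4 by rewrite exprn_gt0.
have -> : E / r ^+ 2 = r ^+ 2 * E / r ^+ 4 by field; rewrite gt_eqF.
rewrite ler_pdivlMr // (le_trans _ mE) //.
have : m / 16 * r ^+ 4 <= m / 16 * 2 ^+ 4.
  by rewrite ler_wpM2l ?divr_ge0 // lerXn2r ?nnegrE ?(ltW r0).
lra.
Qed.

Lemma sum_squares_eq (I : finType) (f g : I -> R) : (forall i, f i <= g i) ->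
  \sum_i g i <= \sum_i f i -> forall i, f i = g i.
Proof.
move=> fg S i; apply/eqP; rewrite eq_le fg andTb -subr_le0.
apply: (@le_trans _ _ (\sum_i (g i - f i))); last by rewrite sumrB subr_le0.
by rewrite (bigD1 i) // lerDl sumr_ge0 // => j _; rewrite subr_ge0.
Qed.

End RealInequalities.

Section TensorBound.
Variable R : realType.
Implicit Types (v x : 'I_3 -> R) (r t : R).

Lemma dotC v x : dot v x = dot x v.
Proof. by apply: eq_bigr => k _; rewrite mulrC. Qed.

Lemma dot_ge0 v : 0 <= dot v v.
Proof. by rewrite sumr_ge0 // => k _; rewrite -expr2 sqr_ge0. Qed.

Lemma cauchy_schwarz v x : dot v x ^+ 2 <= dot v v * dot x x.
Proof.
rewrite -subr_ge0 /dot !sum3.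
have -> : (v t0 * v t0 + v t1 * v t1 + v t2 * v t2) * (x t0 * x t0 + x t1 * x t1 + x t2 * x t2) -
    (v t0 * x t0 + v t1 * x t1 + v t2 * x t2) ^+ 2 =
    (v t0 * x t1 - v t1 * x t0) ^+ 2 + (v t0 * x t2 - v t2 * x t0) ^+ 2
    + (v t1 * x t2 - v t2 * x t1) ^+ 2 by ring.
by rewrite !addr_ge0 ?sqr_ge0.
Qed.

Lemma cauchy_schwarz_eq v x : dot v x ^+ 2 = dot v v * dot x x ->
  forall k, dot v v * x k = dot v x * v k.
Proof.
move=> E; pose y k := dot v v * x k - dot v x * v k.
have Ey : dot y y = dot v v * (dot v v * dot x x - dot v x ^+ 2).
  by rewrite /y /dot !sum3; ring.
move=> k; apply/eqP; rewrite -subr_eq0 -/(y k) -sqrf_eq0; apply/eqP/le_anti.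
rewrite sqr_ge0 andbT; apply: (@le_trans _ _ (dot y y)); last by rewrite Ey E subrr mulr0.
by rewrite /dot (bigD1 k) //= expr2 lerDl sumr_ge0 // => l _; rewrite -expr2 sqr_ge0.
Qed.

(** Kato's inequality for a product of regularized norms r t, weighted by tau and th: the difference
    of the two sides is
    d^2 (|tau v + th x|^2 + |tau v' + th x'|^2) + tau^2 d^4. *)
Lemma tensor_bound (tau th r t dr dt d : R) v (v' : 'I_3 -> R) x (x' : 'I_3 -> R) :
  r ^+ 2 = dot v v + d ^+ 2 -> t ^+ 2 = dot v' v' + d ^+ 2 ->
  r * dr = dot v x -> t * dt = dot v' x' ->
  \sum_a \sum_b (tau * (v a * v' b) + th * (x a * v' b + v a * x' b)) ^+ 2 <=
  (tau * (r * t) + th * (dr * t + r * dt)) ^+ 2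
  + th ^+ 2 * (t ^+ 2 * (dot x x - dr ^+ 2) + r ^+ 2 * (dot x' x' - dt ^+ 2)).
Proof.
move=> rE tE rx tx.
have E : \sum_a \sum_b (tau * (v a * v' b) + th * (x a * v' b + v a * x' b)) ^+ 2 =
  tau ^+ 2 * (dot v v * dot v' v') +
  (tau * th * (dot v x * dot v' v' + dot v v * dot v' x')) *+ 2 +
  th ^+ 2 * (dot x x * dot v' v' + (dot v x * dot v' x') *+ 2 + dot v v * dot x' x').
  by rewrite /dot !sum3; ring.
have pos (y z : 'I_3 -> R) : 0 <= tau ^+ 2 * dot y y + (tau * th * dot y z) *+ 2 + th ^+ 2 * dot z z.
  have -> : tau ^+ 2 * dot y y + (tau * th * dot y z) *+ 2 + th ^+ 2 * dot z z =
    dot (fun k => tau * y k + th * z k) (fun k => tau * y k + th * z k).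
    by rewrite /dot !sum3; ring.
  exact: dot_ge0.
have := pos v x; have := pos v' x'; rewrite {}E.
have -> : dot v v = r ^+ 2 - d ^+ 2 by rewrite rE addrK.
have -> : dot v' v' = t ^+ 2 - d ^+ 2 by rewrite tE addrK.
rewrite -rx -tx; move: (dot x x) (dot x' x') => xx xx' p2 p1.
rewrite -subr_ge0.
set lhs := (X in 0 <= X).
have -> : lhs = d ^+ 2 * (tau ^+ 2 * (r ^+ 2 - d ^+ 2) + (tau * th * (r * dr)) *+ 2 + th ^+ 2 * xx)
  + d ^+ 2 * (tau ^+ 2 * (t ^+ 2 - d ^+ 2) + (tau * th * (t * dt)) *+ 2 + th ^+ 2 * xx')
  + tau ^+ 2 * d ^+ 4 by rewrite /lhs; ring.
have d2 := sqr_ge0 d; apply: addr_ge0; first by apply: addr_ge0; rewrite mulr_ge0.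
by rewrite mulr_ge0 ?sqr_ge0 // (exprM d 2 2) sqr_ge0.
Qed.

(** The integrand of the stability inequality at a point, without divergences: h, e, u2, c, chi
    stand for h, |nabla u|^2, |u|^2, [quot] and [chi], X and Y for the pairings of the two
    halves of the curvature with those of the vorticity, r, t for their regularized norms, T, T'
    for the [excess]es, and Lr, Lt, Lh, Lchi for Laplacians.  Everything cancels except the two slacks,
    because c is chosen with chi = c r t and because G is bounded by [mixed_bound]. *)
Lemma bracket_bound (X Y h e G u2 chi chi1 c T T' r t d Lr Lt Lh Lchi : R) :
  0 < r -> 0 < t -> 0 <= d -> d <= r -> d <= t -> 0 <= u2 -> 0 <= e -> 0 <= chi1 -> 0 <= c ->
  chi = c * (r * t) ->
  chi * (chi - chi1 * (r + t - h - d *+ 2)) <= 0 ->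
  (r + t - h - d *+ 2) - chi *+ 2 + chi * chi1 <= d *+ 2 ->
  G <= r * t * e - t * X - r * Y ->
  r * Lr = T + u2 * (r ^+ 2 - d ^+ 2) - X -> t * Lt = T' + u2 * (t ^+ 2 - d ^+ 2) - Y ->
  Lh = u2 * h - e -> chi1 * (Lr + Lt - Lh) <= Lchi ->
  X + Y - (h * e) *+ 2 + (c * G) *+ 2 + u2 * (h ^+ 2 + chi ^+ 2) - h * Lh - chi * Lchi
  + c ^+ 2 * (t ^+ 2 * T + r ^+ 2 * T')
  + ((r - (chi *+ 2 - chi * chi1)) * (e - X / r) + chi * (chi1 * r - chi) * (T / r ^+ 2))
  + ((t - (chi *+ 2 - chi * chi1)) * (e - Y / t) + chi * (chi1 * t - chi) * (T' / t ^+ 2))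
  <= (d *+ 4) * e.
Proof.
move=> r0 t0' d0 dr dt u20 e0 chi10 c0 chiE chiw wd GB rL tL LhE LchiB.
have rn : r != 0 by rewrite gt_eqF.
have tn : t != 0 by rewrite gt_eqF.
have chi0 : 0 <= chi by rewrite chiE mulr_ge0 // mulr_ge0 // ltW.
pose Xr := X / r; pose Yt := Y / t; pose Tr := T / r; pose Tt := T' / t.
have XE : X = r * Xr by rewrite /Xr mulrC divfK.
have YE : Y = t * Yt by rewrite /Yt mulrC divfK.
have TE : T = r * Tr by rewrite /Tr mulrC divfK.
have T'E : T' = t * Tt by rewrite /Tt mulrC divfK.
have E1 : c ^+ 2 * (t ^+ 2 * T + r ^+ 2 * T') = chi ^+ 2 * (Tr / r + Tt / t).
  by rewrite chiE /Tr /Tt; field; apply/andP.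
have E2 : chi * (chi1 * r - chi) * (T / r ^+ 2) = chi * chi1 * Tr - chi ^+ 2 * (Tr / r).
  by rewrite /Tr; field.
have E3 : chi * (chi1 * t - chi) * (T' / t ^+ 2) = chi * chi1 * Tt - chi ^+ 2 * (Tt / t).
  by rewrite /Tt; field.
rewrite E1 E2 E3 -/Xr -/Yt.
have H1 : c * G <= chi * (e - Xr - Yt).
  rewrite chiE; apply: le_trans (ler_wpM2l c0 GB) _.
  by rewrite XE YE le_eqVlt; apply/orP; left; apply/eqP; ring.
have Lb (s L S Z : R) : 0 < s -> d <= s -> s * L = s * S + u2 * (s ^+ 2 - d ^+ 2) - s * Z ->
    S + u2 * (s - d) - Z <= L.
  move=> s0 ds sL; rewrite -(ler_pM2l s0) sL -subr_ge0.
  have -> : s * S + u2 * (s ^+ 2 - d ^+ 2) - s * Z - s * (S + u2 * (s - d) - Z) =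
    u2 * (d * (s - d)) by ring.
  by rewrite mulr_ge0 // mulr_ge0 // subr_ge0.
have Lr1 : Tr + u2 * (r - d) - Xr <= Lr by apply: Lb => //; rewrite rL XE TE.
have Lt1 : Tt + u2 * (t - d) - Yt <= Lt by apply: Lb => //; rewrite tL YE T'E.
have H2 : chi * (chi1 * ((Tr + u2 * (r - d) - Xr) + (Tt + u2 * (t - d) - Yt) - (u2 * h - e)))
    <= chi * Lchi.
  rewrite ler_wpM2l // (le_trans _ LchiB) // ler_wpM2l // LhE lerD2r; exact: lerD.
have H4 : u2 * (chi * (chi - chi1 * (r + t - h - d *+ 2))) <= 0 by rewrite mulr_ge0_le0.
have H5 : ((r + t - h - d *+ 2) - chi *+ 2 + chi * chi1) * e <= (d *+ 2) * e by rewrite ler_wpM2r.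
rewrite LhE XE YE.
move: (Tr / r) (Tt / t) => U U'.
clear -H1 H2 H4 H5; lra.
Qed.

End TensorBound.

Create HintDb cs.
#[export] Hint Resolve csMr csMl csD csN cs_der cs_sum : cs.

Lemma cs_sqr (R : realType) (f : sfun R) : cs f -> cs (f ^+ 2).
Proof. by move=> cf; rewrite expr2; exact: csMr. Qed.

Lemma csMn (R : realType) (f : sfun R) n : cs f -> cs (f *+ n).
Proof. by move=> cf; rewrite -mulr_natr; exact: csMr. Qed.
#[export] Hint Resolve cs_sqr csMn : cs.

Lemma int4_sum (R : realType) (I : Type) (r : seq I) (F : I -> sfun R) :
  (forall i, cs (F i)) -> int4 (\sum_(i <- r) F i) = \sum_(i <- r) int4 (F i).
Proof.
move=> cF; elim: r => [|i r IH]; first by rewrite !big_nil int4_0.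
by rewrite !big_cons int4D ?IH //; exact: cs_sum.
Qed.

Lemma mm_norm (R : realType) (t q : R) (v v' : 'I_3 -> R) :
  \sum_i \sum_j (2^-1 * (t * (i == j)%:R - q * mm v v' i j)) ^+ 2 =
  t ^+ 2 + q ^+ 2 * (dot v v * dot v' v').
Proof.
transitivity (\sum_i \sum_j (2^-1 * (t * (i == j)%:R - q * mm v v' i j
     - 0 * (mm v v' i j + mm v v' i j))) ^+ 2).
  by apply: eq_bigr => i _; apply: eq_bigr => j _; rewrite mul0r subr0.
rewrite mm_isometry /dot !sum3; ring.
Qed.

(** * Laplacians *)

Section Laplacian.
Variable R : realType.
Local Notation sfun := (sfun R).

Lemma lapD f g : lap (f + g) = lap f + lap g :> sfun.
Proof. by rewrite /lap -big_split /=; apply: eq_bigr => j _; rewrite !DD. Qed.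

Lemma lapN f : lap (- f) = - lap f :> sfun.
Proof. by rewrite /lap -sumrN; apply: eq_bigr => j _; rewrite !DN. Qed.

Lemma lap_cstM (c : R) f : lap (cstf c * f) = cstf c * lap f :> sfun.
Proof.
by rewrite /lap mulr_sumr; apply: eq_bigr => j _; rewrite !(DM, D_cst, mul0r, add0r).
Qed.

Lemma lap_cst (c : R) : lap (cstf c) = 0 :> sfun.
Proof. by rewrite /lap big1 // => j _; rewrite D_cst D0. Qed.

Lemma lap_sqr (g : sfun) : lap (g * g) = (\sum_k D k g ^+ 2 + g * lap g) *+ 2.
Proof.
rewrite /lap mulr_sumr -big_split /= -sumrMnl; apply: eq_bigr => k _.
rewrite (DM k g g) DD !(DM k) expr2; ring.
Qed.

End Laplacian.

(** * Unique continuation *)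

Section UniqueContinuation.
Variable R : realType.
Local Notation V := 'rV[R]_4.
Local Notation sfun := (sfun R).
Implicit Types (x y z : V).

Lemma lap_flat (N : R) (N0 : 0 < N) (g : sfun) y : 0 < g y ->
  lap (flatf 1 N0 g) y = flatf 1 N0 g y * (N / g y ^+ 2 * lap g y
    + (N ^+ 2 / g y ^+ 4 - 2 * N / g y ^+ 3) * \sum_k D k g y ^+ 2).
Proof.
move=> gy; rewrite /lap sfun_sumE.
set q1 := 'X^2 * (N *: 1 - 1^`()).
have q1E : q1 = N *: 'X^2 by rewrite /q1 derivC subr0 -scalerAr mulr1.
have E k : D k (D k (flatf 1 N0 g)) y = flatf 1 N0 g y * (N / g y ^+ 2 * D k (D k g) y
    + (N ^+ 2 / g y ^+ 4 - 2 * N / g y ^+ 3) * D k g y ^+ 2).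
  rewrite D_flat -/q1 DM D_flat (sfunDE (_ * D k g * D k g)) (sfunME _ (D k (D k g))).
  rewrite (sfunME (_ * D k g)) (sfunME _ (D k g)) !flatfE /flat gy hornerC mul1r.
  have -> : q1.[(g y)^-1] = N * (g y)^-1 ^+ 2 by rewrite q1E hornerZ hornerXn.
  have -> : ('X^2 * (N *: q1 - q1^`())).[(g y)^-1] =
      (g y)^-1 ^+ 2 * (N * (N * (g y)^-1 ^+ 2) - N * ((g y)^-1 *+ 2)).
    rewrite hornerM hornerXn hornerD hornerN hornerZ {1}q1E hornerZ hornerXn.
    by rewrite q1E derivZ derivXn hornerZ hornerMn hornerXn expr1.
  have gn : g y != 0 by rewrite gt_eqF.
  move: (D k (D k g) y) (D k g y) (g y) gn => r s t tn.
  by move: (expR (- (N / t))) => e; field.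
rewrite (eq_bigr _ (fun k _ => E k)) -mulr_sumr big_split -!mulr_sumr.
by rewrite sfun_sumE.
Qed.

Lemma lap_sqdist z : lap (sqdist z) = cstf 8.
Proof.
apply/sfun_ext => x; rewrite /lap sfun_sumE.
rewrite (eq_bigr (fun=> 2)) ?sumr_const ?card_ord => [|k _]; first by rewrite cstfE -mulr_natr; ring.
by rewrite D_sqdist DMn DD DN D_coord D_cst eqxx subr0 sfunMnE.
Qed.

Lemma cs_sqdist (f : sfun) z (r : R) : (forall x, r < sqdist z x -> f x = 0) -> cs f.
Proof.
move=> f0; exists (1 + `|r| + \sum_k `|z 0 k|) => x [k kM]; apply: f0.
apply: lt_le_trans (coord_le_sqdist z x k).
have zk : `|z 0 k| <= \sum_k `|z 0 k| by apply: (le_sum_term (f := fun k => `|z 0 k|)) => j.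
have rk : 1 + `|r| < `|x 0 k - z 0 k|.
  have := lerB_dist (x 0 k) (z 0 k); move: kM zk; move: `|_| `|_| `|_| `|_| (\sum_k _) => *; lra.
rewrite -[ltRHS]real_normK ?num_real //.
apply: (@lt_le_trans _ _ ((1 + `|r|) ^+ 2)).
  have := normr_ge0 r; have := ler_norm r; move: `|r| => s r1 s0.
  by have := sqr_ge0 s; lra.
by rewrite ler_sqr ?nnegrE ?normr_ge0 ?addr_ge0 // ltW.
Qed.

(* What lap zeta > zeta means for zeta = exp (- N / t), with t = T - q and q = |x - z|^2. *)
Lemma barrier_const (T s : R) : 0 < T -> 0 < s -> exists2 N : R, 0 < N &
  forall t q, 0 < t -> t <= T -> s <= q -> q <= T ->
  1 < N / t ^+ 2 * - 8 + (N ^+ 2 / t ^+ 4 - 2 * N / t ^+ 3) * (4 * q).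
Proof.
move=> T0 s0; pose B := T ^+ 4 + 16 * T ^+ 2.
have B0 : 0 < B by rewrite addr_gt0 ?mulr_gt0 ?exprn_gt0.
pose N := 1 + (B + 1) / (4 * s).
have N1 : 1 <= N by rewrite lerDl divr_ge0 ?mulr_ge0 ?(ltW s0) // addr_ge0 // ltW.
have N0 : 0 < N := lt_le_trans ltr01 N1.
have NS : B < 4 * s * N.
  have -> : 4 * s * N = 4 * s + (B + 1) by rewrite /N; field; rewrite gt_eqF.
  lra.
exists N => // t q t0' tT sq qT.
have -> : N / t ^+ 2 * - 8 + (N ^+ 2 / t ^+ 4 - 2 * N / t ^+ 3) * (4 * q) =
  (4 * q * N * N - 8 * N * (t ^+ 2) - 8 * N * (q * t)) / t ^+ 4 by field; rewrite gt_eqF.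
rewrite ltr_pdivlMr ?exprn_gt0 // mul1r.
have t2 : t ^+ 2 <= T ^+ 2 by rewrite lerXn2r ?nnegrE ?(ltW t0') ?(ltW T0).
have t4 : t ^+ 4 <= T ^+ 4 by rewrite lerXn2r ?nnegrE ?(ltW t0') ?(ltW T0).
have qt : q * t <= T ^+ 2 by rewrite expr2 ler_pM // ?(ltW t0') // (le_trans (ltW s0)).
have a1 : 8 * N * t ^+ 2 <= 8 * N * T ^+ 2 by rewrite ler_wpM2l // mulr_ge0 // ltW.
have a2 : 8 * N * (q * t) <= 8 * N * T ^+ 2 by rewrite ler_wpM2l // mulr_ge0 // ltW.
have a3 : T ^+ 4 <= N * T ^+ 4 by rewrite ler_peMl // exprn_ge0 // ltW.
have a4 : 4 * s * N * N <= 4 * q * N * N by rewrite !ler_wpM2r ?(ltW N0) // ler_wpM2l.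
have a5 : B * N < 4 * s * N * N by rewrite ltr_pM2r.
move: a1 a2 a3 a4 a5 t4; rewrite /B; move: (4 * s * N * N) (4 * q * N * N) => *; lra.
Qed.

(** Unique continuation for nonnegative v with lap v <= v: the integral of
    v (lap zeta - zeta) = zeta (lap v - v) is nonpositive for zeta = exp (- N / (T - |x - z|^2)),
    while lap zeta - zeta is positive off the ball on which v is known to vanish. *)
Lemma unique_continuation (v : sfun) z : (forall x, 0 <= v x) -> (forall x, lap v x <= v x) ->
  (\forall y \near z, v y = 0) -> forall x, v x = 0.
Proof.
move=> v0 lv /nbhs_sqdist[s s0 vs] x.
have [xs|xs] := ltP (sqdist z x) s; first exact: vs.
pose T := sqdist z x + 1.
have T0 : 0 < T by rewrite /T ltr_wpDl // sqdist_ge0.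
have [N N0 NB] := barrier_const T0 s0.
pose g : sfun := cstf T - sqdist z.
have gE y : g y = T - sqdist z y by rewrite /g (sfunDE (cstf T)) sfunNE.
pose zt := flatf 1 N0 g.
have cz : cs zt.
  by apply: (@cs_sqdist _ z T) => y yT; rewrite /zt flatfE flat_le0 // gE subr_le0 ltW.
have gT y : g y <= T by rewrite gE gerBl sqdist_ge0.
have lzt y : s <= sqdist z y -> 0 < g y -> zt y < lap zt y.
  move=> ys gy; rewrite /zt lap_flat // -[ltLHS]mulr1 ltr_pM2l; last by rewrite flatfE flat_gt0.
  have -> : lap g y = - 8 by rewrite /g lapD lap_cst add0r lapN lap_sqdist sfunNE.
  have -> : \sum_k D k g y ^+ 2 = 4 * sqdist z y.
    rewrite sqdistE mulr_sumr; apply: eq_bigr => k _.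
    rewrite /g DD D_cst add0r DN D_sqdist sfunNE sfunMnE (sfunDE (coordf R k)) sfunNE coordfE cstfE.
    ring.
  by apply: NB => //; rewrite -subr_ge0 -gE ltW.
have H0 : int4 (v * lap zt - zt * lap v) = 0.
  have -> : v * lap zt - zt * lap v = \sum_k D k (v * D k zt - zt * D k v).
    rewrite /lap !mulr_sumr -sumrB; apply: eq_bigr => k _.
    rewrite (DD k (v * _)) DN (DM k v) (DM k zt); ring.
  by apply: int4_divergence => k; apply: csD; [apply/csMl/cs_der|apply/csN/csMr].
pose W : sfun := v * (lap zt - zt).
have lcz : cs (lap zt) by apply: cs_sum => k; apply/cs_der/cs_der.
have cW : cs W by apply/csMl/csD => //; exact: csN.
have zt0 y : 0 <= zt y by exact: flat_ge0.
have zout y : g y <= 0 -> zt y = 0 by move=> gy; rewrite /zt flatfE flat_le0.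
have lzout y : g y <= 0 -> lap zt y = 0.
  move=> gy; rewrite /lap sfun_sumE big1 // => k _.
  rewrite /zt D_flat DM D_flat (sfunDE (_ * D k g * D k g)) (sfunME (_ * D k g)) (sfunME _ (D k g)).
  by rewrite (sfunME _ (D k (D k g))) !flatfE !flat_le0 // !mul0r addr0.
have W0 y : 0 <= W y.
  rewrite (sfunME v) (sfunDE (lap zt)) sfunNE.
  have [ys|ys] := ltP (sqdist z y) s; first by rewrite vs ?mul0r.
  rewrite mulr_ge0 // subr_ge0; have [gy|gy] := leP (g y) 0; first by rewrite zout // lzout.
  by rewrite ltW // lzt.
have IW : int4 W <= 0.
  rewrite -H0; apply: int4_le => // [|y].
    by apply: csD; [exact: csMl|exact/csN/csMr].
  rewrite (sfunME v) (sfunDE (lap zt)) sfunNE (sfunDE (v * _)) sfunNE (sfunME v) (sfunME zt).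
  by rewrite mulrBr lerD2l lerN2 mulrC ler_wpM2r.
have := int4_eq0 cW W0 IW x; rewrite (sfunME v) (sfunDE (lap zt)) sfunNE => /eqP.
rewrite mulf_eq0 => /orP[/eqP //|/eqP E].
have gx : 0 < g x by rewrite gE subr_gt0 /T ltrDl.
by have := lzt x xs gx; rewrite -subr_gt0 E ltxx.
Qed.

End UniqueContinuation.

(** * The stability inequality *)

Section StabilityInequality.
Variable R : realType.
Local Notation V := 'rV[R]_4.
Local Notation sfun := (sfun R).
Variables (a b : sfun) (A : 'I_4 -> sfun).
Local Notation P := (covP a b A).
Local Notation Q := (covQ a b A).
Local Notation F := (curv A).
Local Notation h := (higgsf a b).
Local Notation u2 := (normu a b).
Local Notation eps := (grad2 a b A).
Local Notation W := (vort a b A).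

Hypothesis eq_re : \sum_j covPP a b A j j = - (h * a).
Hypothesis eq_im : \sum_j covQQ a b A j j = - (h * b).
Hypothesis eq_curv : forall k, \sum_j D j (F j k) = - (Q k * a - P k * b).
Hypothesis stable : forall p q (G : 'I_4 -> sfun), cs p -> cs q -> (forall j, cs (G j)) ->
  0 <= int4 (second_var a b A p q G).

(* The halves f (c = false) and f' (c = true) of the curvature, psi and psi' of the vorticity, as
   vectors with three components. *)
Definition sdF c := sd (sg sfun c) F.
Definition sdW c := sd (sg sfun c) W.
Definition sdF2 c := dot (sdF c) (sdF c).
Definition sdFW c := dot (sdF c) (sdW c).

Lemma lap_sdF c k : lap (sdF c k) = u2 * sdF c k - sdW c k.
Proof.
rewrite /sdF /sdW sgE; elim/ord3_case: k; rewrite !sdE lapD ?lapN lap_cstM !(lap_curv eq_curv); ring.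
Qed.

Lemma curv_diag i : F i i = 0. Proof. by rewrite /curv subrr. Qed.
Lemma vortN i j : W i j = - W j i. Proof. rewrite /vort; ring. Qed.

Lemma curv_vort : \sum_i \sum_j F j i * W j i = sdFW false + sdFW true.
Proof.
rewrite (sd_pairing (w := F) (w' := W)) //.
- by move=> i j; rewrite curvN.
- exact: vortN.
- exact: curv_diag.
Qed.

(** Stability along the directions of [second_var_test] with M = e N_i, summed over i: the sum
    is frame independent, and only the trace of N against the symmetric tensor
    Re <nabla_i u, nabla_j u> survives. *)
Lemma stability_trace (e : sfun) (N : 'I_4 -> 'I_4 -> sfun) : cs e ->
  0 <= int4 (e ^+ 2 * (sdFW false + sdFW true)
    - (e ^+ 2 * \sum_i \sum_j N i j * (P i * P j + Q i * Q j)) *+ 4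
    + e ^+ 2 * u2 * (\sum_i \sum_j N i j ^+ 2)
    + \sum_i \sum_j \sum_k D j (e * N i k) ^+ 2
    + (\sum_j D j e ^+ 2) * eps
    - \sum_i (\sum_j D j (e * N i j) - e * D i h) ^+ 2).
Proof.
move=> ce.
pose M i j := e * N i j.
pose T i := e ^+ 2 * (\sum_j F j i * W j i) - (e * \sum_j M i j * (P i * P j + Q i * Q j)) *+ 4
  + u2 * (\sum_j M i j ^+ 2) + \sum_j \sum_k D j (M i k) ^+ 2
  + (\sum_j D j e ^+ 2) * (P i * P i + Q i * Q i)
  - (\sum_j D j (M i j) - e * D i h) ^+ 2.
have cM i j : cs (M i j) by exact: csMr.
have cT i : cs (T i) by rewrite /T; auto 15 with cs.
have T0 i : 0 <= int4 (T i).
  have := stable (csN (csMr (Q i) ce)) (csMr (P i) ce) (fun j => csN (cM i j)).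
  rewrite (second_var_test eq_re eq_im eq_curv) -/(T i) int4D ?int4_divergence ?addr0 //.
  - by move=> j; auto 15 with cs.
  - by apply: cs_sum => j; auto 15 with cs.
suff -> : e ^+ 2 * (sdFW false + sdFW true)
    - (e ^+ 2 * \sum_i \sum_j N i j * (P i * P j + Q i * Q j)) *+ 4
    + e ^+ 2 * u2 * (\sum_i \sum_j N i j ^+ 2)
    + \sum_i \sum_j \sum_k D j (e * N i k) ^+ 2
    + (\sum_j D j e ^+ 2) * eps
    - \sum_i (\sum_j D j (e * N i j) - e * D i h) ^+ 2 = \sum_i T i.
  by rewrite int4_sum // sumr_ge0.
rewrite -curv_vort /T sumrB 3!big_split /= sumrB sumrMnl -!mulr_sumr -/eps.
have -> : e ^+ 2 * (\sum_i \sum_j N i j * (P i * P j + Q i * Q j)) =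
    e * \sum_i \sum_j M i j * (P i * P j + Q i * Q j).
  rewrite expr2 -mulrA; congr (_ * _); rewrite mulr_sumr; apply: eq_bigr => i _.
  by rewrite mulr_sumr; apply: eq_bigr => j _; rewrite /M mulrA.
have -> : e ^+ 2 * u2 * (\sum_i \sum_j N i j ^+ 2) = u2 * \sum_i \sum_j M i j ^+ 2.
  rewrite [_ * u2]mulrC -mulrA; congr (_ * _); rewrite mulr_sumr; apply: eq_bigr => i _.
  by rewrite mulr_sumr; apply: eq_bigr => j _; rewrite /M exprMn.
by [].
Qed.

Lemma higgsf_val x : h x = 2^-1 * (1 - u2 x).
Proof.
rewrite /higgsf /normu sfunME cstfE !(sfunDE, sfunNE, sfunME) sfun1E; congr (_ * _).
by rewrite opprD addrA.
Qed.

Lemma normu_ge0 x : 0 <= u2 x.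
Proof. by rewrite sfunDE !sfunME addr_ge0 // -expr2 sqr_ge0. Qed.

Lemma eps_val x : eps x = sqsum (fun j => P j x) (fun j => Q j x).
Proof. by rewrite sfun_sumE; apply: eq_bigr => j _; rewrite sfunDE !sfunME. Qed.

Lemma eps_ge0 x : 0 <= eps x.
Proof. by rewrite eps_val sqsum_ge0. Qed.

Lemma sdW_val c k x : sdW c k x =
  sd (sg R c) (wedge (fun j => P j x) (fun j => Q j x)) k.
Proof.
exact: sd_val.
Qed.

Lemma sdF2_ge0 c x : 0 <= sdF2 c x.
Proof. by rewrite dot_val dot_ge0. Qed.

Lemma sdFW_le c x (r : R) : 0 <= r -> sdF2 c x <= r ^+ 2 -> sdFW c x <= r * eps x.
Proof.
move=> r0; rewrite /sdF2 /sdFW !dot_val dotC eps_val => rF.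
rewrite (_ : (fun k => sdW c k x) = sd (sg R c) (wedge (fun j => P j x) (fun j => Q j x))).
  by apply: wedge_le => //; exact: sg_sqr.
by apply/funext => k; exact: sdW_val.
Qed.

Section TestForm.
Variable d : R.
Hypothesis d0 : 0 < d.

Lemma rho_pos c x : 0 < (sdF2 c + cstf (d ^+ 2)) x.
Proof. by rewrite sfunDE cstfE ltr_wpDl ?sdF2_ge0 // exprn_gt0. Qed.

Definition rho c : sfun := sqrtf (rho_pos c).

Lemma rho_gt0 c x : 0 < rho c x.
Proof. by rewrite sqrtfE sqrtr_gt0 rho_pos. Qed.

Definition irho c : sfun := invf (rho_gt0 c).

Lemma rho_sqr c : rho c * rho c = sdF2 c + cstf (d ^+ 2).
Proof. exact: sqrtf_sqr. Qed.

Lemma rho_sqr_val c x : rho c x ^+ 2 = sdF2 c x + d ^+ 2.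
Proof. by rewrite expr2 -sfunME rho_sqr. Qed.

Lemma D_rho c k : rho c * D k (rho c) = dot (sdF c) (fun l => D k (sdF c l)).
Proof.
have : D k (rho c * rho c) = D k (sdF2 c + cstf (d ^+ 2)) by rewrite rho_sqr.
rewrite DM DD D_cst addr0 /sdF2 D_dot.
have -> : dot (fun l => D k (sdF c l)) (sdF c) = dot (sdF c) (fun l => D k (sdF c l)).
  by apply: eq_bigr => l _; rewrite mulrC.
rewrite mulrC -!mulr2n => E; apply/sfun_ext => x.
by have := congr1 (fun f : sfun => f x) E; rewrite !sfunMnE; lra.
Qed.

(* |df|^2 - (d rho)^2, nonnegative by Kato's inequality. *)
Definition excess c : sfun :=
  \sum_k (dot (fun l => D k (sdF c l)) (fun l => D k (sdF c l)) - D k (rho c) ^+ 2).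

Lemma lap_rho c : rho c * lap (rho c) = excess c + u2 * sdF2 c - sdFW c.
Proof.
have E k : rho c * D k (D k (rho c)) =
    dot (fun l => D k (sdF c l)) (fun l => D k (sdF c l)) - D k (rho c) ^+ 2
    + dot (sdF c) (fun l => D k (D k (sdF c l))).
  have := congr1 (D k) (D_rho c k); rewrite DM D_dot => /eqP; rewrite addrC -subr_eq => /eqP <-.
  rewrite expr2; ring.
rewrite /lap mulr_sumr (eq_bigr _ (fun k _ => E k)) big_split /= -/(excess c) -addrA; congr (_ + _).
rewrite /dot exchange_big /= /sdF2 /sdFW /dot mulr_sumr -sumrB; apply: eq_bigr => l _.
rewrite -mulr_sumr -/(lap (sdF c l)) lap_sdF; ring.
Qed.

Lemma excess_term c k x : D k (rho c) x ^+ 2 <=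
  dot (fun l => D k (sdF c l) x) (fun l => D k (sdF c l) x).
Proof.
have r0 : 0 < rho c x ^+ 2 by rewrite exprn_gt0 // rho_gt0.
rewrite -(ler_pM2l r0) -exprMn -sfunME D_rho dot_val.
apply: le_trans (cauchy_schwarz _ _) _; rewrite ler_wpM2r ?dot_ge0 //.
by rewrite rho_sqr_val /sdF2 dot_val lerDl sqr_ge0.
Qed.

Lemma excess_ge0 c x : 0 <= excess c x.
Proof.
by rewrite sfun_sumE sumr_ge0 // => k _; rewrite sfunDE sfunNE sfunXE dot_val subr_ge0 excess_term.
Qed.

Lemma d_le_rho c x : d <= rho c x.
Proof.
rewrite -ler_sqr ?nnegrE ?(ltW d0) ?(ltW (rho_gt0 c x)) //.
by rewrite rho_sqr_val lerDr sdF2_ge0.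
Qed.

(* Approximates |f| + |f'| - h with an error of order d; the shift by 2 d makes it nonpositive
   where |f| + |f'| <= h. *)
Definition gap : sfun := rho false + rho true - h - cstf (d *+ 2).
Definition chi : sfun := pos0 d0 gap.
Definition chi1 : sfun := pos1 d0 gap.
Definition quot : sfun := chi * (irho false * irho true).

(** As d tends to 0 this approximates half of h Id - (|f| + |f'| - h)_+ J J', where f = |f| J
    and f' = |f'| J' are the two halves of the curvature. *)
Definition testN i j : sfun :=
  cstf 2^-1 * (h *+ (i == j) - quot * mm (sdF false) (sdF true) i j).

Lemma rhoV c : irho c * rho c = 1. Proof. exact: invfM. Qed.

Lemma quotE : chi = quot * (rho false * rho true).
Proof.
rewrite /quot.
have -> : chi * (irho false * irho true) * (rho false * rho true) =
  chi * (irho false * rho false) * (irho true * rho true) by ring.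
by rewrite !rhoV !mulr1.
Qed.

Lemma testN_sqr x : (\sum_i \sum_j testN i j ^+ 2) x =
  h x ^+ 2 + quot x ^+ 2 * (sdF2 false x * sdF2 true x).
Proof.
rewrite sfun_sumE.
have E i j : (testN i j ^+ 2) x = (2^-1 * (h x * (i == j)%:R
    - quot x * mm (fun k => sdF false k x) (fun k => sdF true k x) i j)) ^+ 2.
  rewrite sfunXE (sfunME (cstf _)) cstfE (sfunDE (h *+ _)) sfunNE (sfunME quot) sfunMnE mm_val.
  by rewrite mulr_natr.
under eq_bigr do rewrite sfun_sumE; under eq_bigr do under eq_bigr do rewrite E.
by rewrite mm_norm /sdF2 !dot_val.
Qed.

Lemma testN_grad x : (\sum_i \sum_j testN i j * (P i * P j + Q i * Q j)) x =
  2^-1 * (h x * eps x - quot x * mixed (fun k => sdF false k x) (fun k => sdF true k x)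
     (fun j => P j x) (fun j => Q j x)).
Proof.
rewrite eps_val /mixed /sqsum sfun_sumE !mulr_sumr -sumrB mulr_sumr; apply: eq_bigr => i _.
rewrite sfun_sumE.
transitivity (\sum_j (2^-1 * (h x * ((P j x * P j x + Q j x * Q j x) *+ (j == i))
   - quot x * (mm (fun k => sdF false k x) (fun k => sdF true k x) i j
       * (P i x * P j x + Q i x * Q j x))))).
  apply: eq_bigr => j _; rewrite (sfunME (testN i j)) (sfunME (cstf _)) cstfE.
  rewrite (sfunDE (h *+ _)) sfunNE (sfunME quot) sfunMnE mm_val.
  rewrite (sfunDE (P i * P j)) (sfunME (P i)) (sfunME (Q i)).
  move: (h x) (quot x) (mm _ _ _ _) => y q m.
  by rewrite eq_sym; case: eqP => [->|_]; rewrite ?(mulr0n, mulr1n); ring.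
rewrite -mulr_sumr sumrB -!mulr_sumr; congr (_ * (_ * _ - _)).
by rewrite (bigD1 i) //= eqxx big1 ?addr0 // => j ji; rewrite (negbTE ji).
Qed.

(* [mm_isometry] turns the gradient of the matrix into that of h and of the tensor of f and f'. *)
Lemma testN_der (e : sfun) k x : (\sum_i \sum_j D k (e * testN i j) ^+ 2) x <=
  D k (e * h) x ^+ 2 + D k (e * chi) x ^+ 2 + (e x * quot x) ^+ 2 *
   (rho true x ^+ 2 * (dot (fun l => D k (sdF false l)) (fun l => D k (sdF false l)) - D k (rho false) ^+ 2) x
   + rho false x ^+ 2 * (dot (fun l => D k (sdF true l)) (fun l => D k (sdF true l)) - D k (rho true) ^+ 2) x).
Proof.
have E i j : (D k (e * testN i j) ^+ 2) x = (2^-1 * (D k (e * h) x * (i == j)%:R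
    - D k (e * quot) x * mm (fun l => sdF false l x) (fun l => sdF true l x) i j
    - (e x * quot x) * (mm (fun l => D k (sdF false l) x) (fun l => sdF true l x) i j
       + mm (fun l => sdF false l x) (fun l => D k (sdF true l) x) i j))) ^+ 2.
  have -> : e * testN i j = cstf 2^-1 * ((e * h) *+ (i == j) - (e * quot) * mm (sdF false) (sdF true) i j).
    by rewrite /testN; move: h quot (mm _ _ _ _) => y q m; rewrite -mulrnAr; ring.
  rewrite sfunXE (DM k (cstf _)) D_cst mul0r add0r DD DN DMn (DM k (e * quot)) D_mm.
  rewrite (sfunME (cstf _)) cstfE (sfunDE (_ *+ _)) sfunNE sfunMnE.
  rewrite (sfunDE (_ * mm _ _ _ _)) (sfunME (D k (e * quot))) (sfunME (e * quot)) (sfunME e).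
  by rewrite (sfunDE (mm _ _ _ _)) !mm_val mulr_natr opprD addrA.
rewrite sfun_sumE; under eq_bigr do rewrite sfun_sumE; under eq_bigr do under eq_bigr do rewrite E.
rewrite mm_isometry -addrA lerD2l.
have DE' : D k (e * chi) x = D k (e * quot) x * (rho false x * rho true x) +
   (e x * quot x) * (D k (rho false) x * rho true x + rho false x * D k (rho true) x).
  have -> : e * chi = (e * quot) * (rho false * rho true) by rewrite quotE mulrA.
  by rewrite DM (DM k (rho false)) !(sfunDE, sfunME).
rewrite DE' !sfunDE !sfunNE !dot_val !sfunXE.
apply: (@tensor_bound _ _ _ _ _ _ _ d).
- by rewrite rho_sqr_val /sdF2 dot_val.
- by rewrite rho_sqr_val /sdF2 dot_val.
- by rewrite -sfunME D_rho dot_val.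
- by rewrite -sfunME D_rho dot_val.
Qed.

(* What is lost in the pointwise estimate of the stability integrand: the first term measures how
   far nabla u is from being complex linear for the structure of f, the second how far the
   direction of f is from being parallel. *)
Definition slack c : sfun :=
  (rho c - (chi *+ 2 - chi * chi1)) * (eps - sdFW c * irho c)
  + chi * irho c ^+ 2 * (chi1 * rho c - chi) * excess c.

(* The square that [second_var_test] leaves with a negative sign. *)
Definition misfit (e : sfun) : sfun := \sum_i (\sum_j D j (e * testN i j) - e * D i h) ^+ 2.

Lemma normu_gradient (e g : sfun) : \sum_k D k (e * g) ^+ 2 =
  (\sum_k D k e ^+ 2) * g ^+ 2 + \sum_k D k (e ^+ 2 * (g * D k g)) - e ^+ 2 * (g * lap g).
Proof.
rewrite /lap !mulr_sumr mulr_suml -big_split /= -sumrB; apply: eq_bigr => k _.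
rewrite DM (DM k (e ^+ 2)) (DM k g) expr2 (DM k e); ring.
Qed.

Lemma chi_ge0 x : 0 <= chi x.
Proof. by have [[]] := pos_bounds d0 gap x. Qed.

Lemma quot_ge0 x : 0 <= quot x.
Proof.
by rewrite (sfunME chi) (sfunME (irho _)) !invfE mulr_ge0 ?chi_ge0 // mulr_ge0 // invr_ge0 ltW ?rho_gt0.
Qed.

(* By convexity of the smoothed positive part. *)
Lemma lap_chi_ge x : chi1 x * (lap (rho false) x + lap (rho true) x - lap h x) <= lap chi x.
Proof.
rewrite /chi lap_pos0 (sfunDE (pos1 d0 gap * lap gap)) (sfunME (pos1 d0 gap)).
have -> : lap gap x = lap (rho false) x + lap (rho true) x - lap h x.
  by rewrite /gap 3!lapD !lapN lap_cst oppr0 addr0 (sfunDE _ (- lap h)) sfunNE (sfunDE (lap _)).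
rewrite -/chi1 lerDl (sfunME (pos2 d0 gap)) mulr_ge0 //.
  by have [[]] := pos_bounds d0 gap x.
by rewrite sfun_sumE sumr_ge0 // => k _; rewrite sfunXE sqr_ge0.
Qed.

Lemma gap_val x : gap x = rho false x + rho true x - h x - d *+ 2.
Proof. by rewrite /gap !sfunDE !sfunNE cstfE. Qed.

Lemma slack_val c x : slack c x =
  (rho c x - (chi x *+ 2 - chi x * chi1 x)) * (eps x - sdFW c x / rho c x)
    + chi x * (chi1 x * rho c x - chi x) * (excess c x / rho c x ^+ 2).
Proof.
rewrite (sfunDE (_ * (eps - _))) (sfunME (rho c - _)) (sfunDE (rho c)) sfunNE.
rewrite (sfunDE (chi *+ 2)) sfunNE sfunMnE (sfunME chi) (sfunDE eps) sfunNE (sfunME (sdFW c)) invfE.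
rewrite (sfunME _ (excess c)) (sfunME _ (chi1 * _ - _)) (sfunME chi) sfunXE invfE.
rewrite (sfunDE (chi1 * _)) sfunNE (sfunME chi1) exprVn; congr (_ + _).
by move: (chi x) (excess c x) (rho c x ^+ 2)^-1 (_ - _) => p q r s; ring.
Qed.

Lemma pointwise_bound x :
  sdFW false x + sdFW true x - (h x * eps x) *+ 2
  + (quot x * mixed (fun k => sdF false k x) (fun k => sdF true k x)
     (fun j => P j x) (fun j => Q j x)) *+ 2
  + u2 x * (h x ^+ 2 + chi x ^+ 2) - h x * lap h x - chi x * lap chi x
  + quot x ^+ 2 * (rho true x ^+ 2 * excess false x + rho false x ^+ 2 * excess true x)
  + slack false x + slack true x <= (d *+ 4) * eps x.
Proof.
have [[c0 c10 _] [cw wd _]] := pos_bounds d0 gap x.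
rewrite -/chi -/chi1 gap_val in c0 c10 cw wd.
rewrite (slack_val false) (slack_val true).
have lr c : rho c x * lap (rho c) x = excess c x + u2 x * (rho c x ^+ 2 - d ^+ 2) - sdFW c x.
  rewrite rho_sqr_val addrK -(sfunME (rho c)) lap_rho.
  by rewrite (sfunDE _ (- sdFW c)) sfunNE (sfunDE (excess c)) (sfunME u2).
apply: bracket_bound (lr false) (lr true) _ (lap_chi_ge x); rewrite ?rho_gt0 ?d_le_rho ?(ltW d0) //.
- exact: normu_ge0.
- exact: eps_ge0.
- exact: quot_ge0.
- by have := congr1 (fun f : sfun => f x) quotE; rewrite (sfunME quot) (sfunME (rho _)).
- have r2 c : rho c x ^+ 2 = dot (fun k => sdF c k x) (fun k => sdF c k x) + d ^+ 2.
    by rewrite rho_sqr_val /sdF2 dot_val.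
  have := @mixed_bound R d (rho false x) (rho true x) (fun k => sdF false k x)
    (fun k => sdF true k x) (fun j => P j x) (fun j => Q j x) (ltW d0) (rho_gt0 _ _) (rho_gt0 _ _)
    (r2 false) (r2 true).
  rewrite -eps_val /sdFW !dot_val.
  have sW c : (fun k => sdW c k x) = sd (sg R c) (wedge (fun j => P j x) (fun j => Q j x)).
    by apply/funext => k; rewrite sdW_val.
  by rewrite !sW ![dot _ (sd _ _)]dotC.
- by rewrite (lap_higgs eq_re eq_im) (sfunDE (u2 * h)) sfunNE (sfunME u2).
Qed.

Lemma testN_gradient (e : sfun) x : (\sum_i \sum_j \sum_k D j (e * testN i k) ^+ 2) x <=
  ((\sum_k D k e ^+ 2) x) * (h x ^+ 2 + chi x ^+ 2)
  + (\sum_k D k (e ^+ 2 * (h * D k h)) + \sum_k D k (e ^+ 2 * (chi * D k chi))) x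
  - e x ^+ 2 * (h x * lap h x + chi x * lap chi x)
  + (e x * quot x) ^+ 2 * (rho true x ^+ 2 * excess false x + rho false x ^+ 2 * excess true x).
Proof.
have -> : \sum_i \sum_j \sum_k D j (e * testN i k) ^+ 2 =
    \sum_k \sum_i \sum_j D k (e * testN i j) ^+ 2.
  by rewrite [RHS]exchange_big.
rewrite sfun_sumE; apply: le_trans (ler_sum _ (fun k _ => testN_der e k x)) _.
have sumD (f g : 'I_4 -> R) : \sum_k (f k + g k) = \sum_k f k + \sum_k g k by exact: big_split.
rewrite 2!sumD.
have sq (g : sfun) : \sum_k D k (e * g) x ^+ 2 = (\sum_k D k e ^+ 2) x * g x ^+ 2
    + (\sum_k D k (e ^+ 2 * (g * D k g))) x - e x ^+ 2 * (g x * lap g x).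
  rewrite -(sfunXE g) -(sfunME (\sum_k D k e ^+ 2)) -sfunXE -(sfunME g) -(sfunME (e ^+ 2)) -sfunDE.
  rewrite -sfunNE -sfunDE -normu_gradient sfun_sumE.
  by apply: eq_bigr => k _; rewrite sfunXE.
rewrite !sq -mulr_sumr sumD -!mulr_sumr -!sfun_sumE -/(excess false) -/(excess true).
rewrite (sfunDE (\sum_k D k (e ^+ 2 * (h * _)))).
move: ((\sum_k D k e ^+ 2) x) (h x) (chi x) (lap h x) (lap chi x) (e x) (quot x).
move: ((\sum_k D k (e ^+ 2 * (h * D k h))) x) ((\sum_k D k (e ^+ 2 * (chi * D k chi))) x) => *.
by rewrite le_eqVlt; apply/orP; left; apply/eqP; ring.
Qed.

(** Once integrated, the nonnegative quantities [slack] and [misfit] are controlled by the energy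
    seen by the gradient of the cutoff, up to an error of order d. *)
Lemma stability_slack (e : sfun) : cs e ->
  int4 (e ^+ 2 * (slack false + slack true) + misfit e) <=
  int4 (cstf (d *+ 4) * (e ^+ 2 * eps) + (\sum_k D k e ^+ 2) * (eps + h ^+ 2 + chi ^+ 2)).
Proof.
move=> ce.
set lhs := e ^+ 2 * _ + _; set rhs := cstf _ * _ + _.
pose dv := \sum_k D k (e ^+ 2 * (h * D k h)) + \sum_k D k (e ^+ 2 * (chi * D k chi)).
have cdv : cs dv by apply: csD; apply: cs_sum => k; auto with cs.
have idv : int4 dv = 0.
  rewrite int4D ?int4_divergence ?addr0 //; last by apply: cs_sum => k; auto with cs.
  all: try (by move=> k; auto with cs).
  by apply: cs_sum => k; auto with cs.
have clhs : cs lhs.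
  apply: csD; first by auto with cs.
  apply: cs_sum => i; apply: cs_sqr; apply: csD; first by apply: cs_sum => j; auto with cs.
  by auto with cs.
have crhs : cs rhs.
  apply: csD; first by auto with cs.
  by apply: csMr; apply: cs_sum => k; auto with cs.
have := stability_trace testN ce; set I := (X in int4 X); move=> I0.
have cI : cs I.
  rewrite /I; apply: csD; last by apply/csN/cs_sum => i; apply: cs_sqr; apply: csD;
    [apply: cs_sum => j; auto with cs|auto with cs].
  apply: csD; last by apply: csMr; apply: cs_sum => k; auto with cs.
  apply: csD; last by do 3!apply: cs_sum => ?; auto with cs.
  apply: csD; last by do 2!apply: csMr; exact: cs_sqr.
  apply: csD; first by apply: csMr; exact: cs_sqr.
  by apply: csN; apply: csMn; apply: csMr; exact: cs_sqr.
rewrite -subr_ge0 -int4N // -int4D //; last exact: csN.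
have crl : cs (rhs - lhs) := csD crhs (csN clhs).
have -> : int4 (rhs - lhs) = int4 (rhs - lhs + dv) by rewrite (int4D crl cdv) idv addr0.
apply: le_trans I0 _; apply: (int4_le cI (csD crl cdv)) => x.
rewrite /I /rhs /lhs -/(misfit e) -/dv.
have mf := testN_gradient e x; have pb := pointwise_bound x.
have gr := testN_grad x; have n2 := testN_sqr x.
have qc : u2 x * (quot x ^+ 2 * (sdF2 false x * sdF2 true x)) <= u2 x * chi x ^+ 2.
  rewrite ler_wpM2l ?normu_ge0 //.
  have -> : chi x = quot x * (rho false x * rho true x).
    by have := congr1 (fun f : sfun => f x) quotE; rewrite (sfunME quot) (sfunME (rho _)).
  rewrite [leRHS]exprMn ler_wpM2l ?sqr_ge0 // exprMn ler_pM ?sdF2_ge0 //.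
    by rewrite rho_sqr_val lerDl sqr_ge0.
  by rewrite rho_sqr_val lerDl sqr_ge0.
rewrite -/dv in mf.
pose G := \sum_i \sum_j testN i j * (P i * P j + Q i * Q j).
pose N2 := \sum_i \sum_j testN i j ^+ 2.
pose T := \sum_i \sum_j \sum_k D j (e * testN i k) ^+ 2.
pose De := \sum_j D j e ^+ 2.
rewrite -/G in gr; rewrite -/N2 in n2; rewrite -/T -/De in mf.
rewrite -/G -/N2 -/T -/De.
have -> : (e ^+ 2 * (sdFW false + sdFW true) - e ^+ 2 * G *+ 4 + e ^+ 2 * u2 * N2 + T + De * eps
    - misfit e) x = e x ^+ 2 * (sdFW false x + sdFW true x) - (e x ^+ 2 * G x) *+ 4
    + e x ^+ 2 * u2 x * N2 x + T x + De x * eps x - misfit e x.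
  rewrite (sfunDE _ (- misfit e)) sfunNE (sfunDE _ (De * eps)) (sfunME De) (sfunDE _ T).
  rewrite (sfunDE _ (e ^+ 2 * u2 * N2)) (sfunME _ N2) (sfunME _ u2) sfunXE.
  by rewrite (sfunDE _ (- _)) sfunNE sfunMnE (sfunME _ G) (sfunME (e ^+ 2)) sfunXE (sfunDE (sdFW _)).
have -> : (cstf (d *+ 4) * (e ^+ 2 * eps) + De * (eps + h ^+ 2 + chi ^+ 2)
    - (e ^+ 2 * (slack false + slack true) + misfit e) + dv) x =
  (d *+ 4) * (e x ^+ 2 * eps x) + De x * (eps x + h x ^+ 2 + chi x ^+ 2)
    - (e x ^+ 2 * (slack false x + slack true x) + misfit e x) + dv x.
  rewrite (sfunDE _ dv) (sfunDE _ (- _)) sfunNE (sfunDE _ (misfit e)) (sfunME (e ^+ 2)) sfunXE.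
  rewrite (sfunDE (slack _)) (sfunDE (cstf _ * _)) (sfunME (cstf _)) cstfE (sfunME (e ^+ 2)) sfunXE.
  by rewrite (sfunME De) (sfunDE _ (chi ^+ 2)) (sfunDE eps) !sfunXE.
rewrite gr n2.
have e2 : 0 <= e x ^+ 2 by rewrite sqr_ge0.
have {}pb := ler_wpM2l e2 pb; have {}qc := ler_wpM2l e2 qc.
move: mf pb qc; rewrite exprMn.
move: (mixed _ _ _ _) (T x) (De x) (dv x) (misfit e x) => ? ? ? ? ?.
move: (slack false x) (slack true x) (lap h x) (lap chi x) (chi x) (quot x) (eps x) (h x) (u2 x).
move: (excess false x) (excess true x) (rho false x) (rho true x) (sdFW false x) (sdFW true x).
move: (sdF2 false x) (sdF2 true x) (e x) => {}*.
lra.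
Qed.

End TestForm.

(** * The curvature is bounded by h *)

Lemma sdF2E x : 2^-1 * (\sum_j \sum_k F j k x ^+ 2) = 2^-1 * (sdF2 false x + sdF2 true x).
Proof.
congr (_ * _); rewrite -sfunDE -(sd_pairing (w := F) (w' := F)) ?curv_diag //.
- rewrite exchange_big /= sfun_sumE; apply: eq_bigr => i _; rewrite sfun_sumE.
  by apply: eq_bigr => j _; rewrite sfunME expr2.
- by move=> i j; rewrite curvN.
- by move=> i j; rewrite curvN.
- exact: curv_diag.
Qed.

Definition energy : sfun := eps + cstf 2^-1 * (sdF2 false + sdF2 true) + h ^+ 2.

Variable C : R.
Hypothesis C_ge0 : 0 <= C.
Hypothesis growth : forall r : R, 1 <= r ->
  (integral4 (euclid_ball r) energy <= (C * r ^+ 2)%:E)%E.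

Lemma energy_val x : energy x = eps x + 2^-1 * (sdF2 false x + sdF2 true x) + h x ^+ 2.
Proof.
by rewrite /energy (sfunDE _ (h ^+ 2)) sfunXE (sfunDE eps) (sfunME (cstf _)) cstfE (sfunDE (sdF2 _)).
Qed.

Lemma energy_bounds x : [/\ 0 <= energy x, eps x <= energy x, h x ^+ 2 <= energy x,
  sdF2 false x <= 2 * energy x & sdF2 true x <= 2 * energy x].
Proof.
have e0 := eps_ge0 x; have f0 := sdF2_ge0 false x; have f1 := sdF2_ge0 true x.
have h2 := sqr_ge0 (h x); rewrite energy_val; move: h2 e0 f0 f1.
move: (h x ^+ 2) (eps x) (sdF2 _ _) (sdF2 _ _) => *; split; lra.
Qed.

Lemma cutoff_at (x : V) (tau : R) : 0 < tau -> exists eta : sfun,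
  [/\ cs eta, forall y, 0 <= eta y <= 1, forall y : V, (forall k, `|y 0 k - x 0 k| < 1) -> eta y = 1 &
      int4 ((\sum_j D j eta ^+ 2) * energy) <= tau].
Proof.
move=> tau0; pose r0 := 9 + 2 * sqnorm R x.
have sx : 0 <= sqnorm R x by apply: le_trans (coord_le_sqnorm x o0); exact: sqr_ge0.
have r1 : 1 <= r0 by rewrite /r0; lra.
have e0 y : 0 <= energy y by have [] := energy_bounds y.
have [eta [ce e01 e1 et]] := log_cutoff e0 C_ge0 r1 growth tau0.
exists eta; split => // y yx; apply: e1.
apply: (@le_trans _ _ r0); last by rewrite expr2 ler_peMr // (le_trans ler01).
rewrite /r0 !sqnormE /euclid.
apply: (@le_trans _ _ (\sum_(k < 4) (2 + 2 * (x 0 k * x 0 k)))); last first.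
  by rewrite big_split /= -mulr_sumr sumr_const card_ord; lra.
apply: ler_sum => k _; have := yx k; rewrite ltr_norml => /andP[y1 y2].
have : (y 0 k - x 0 k) ^+ 2 <= 1.
  by rewrite -[leRHS](expr1n _ 2) -real_normK ?num_real // ler_sqr ?nnegrE //; apply/ltW/yx.
have := sqr_ge0 (y 0 k - x 0 k *+ 2); lra.
Qed.

(** Caccioppoli's inequality with logarithmic cutoffs: a nonnegative subharmonic function
    dominated by the square root of the energy is constant, hence zero. *)
Lemma subharmonic_vanishes (z : sfun) (K : R) : 0 <= K -> (forall x, 0 <= z x) ->
  (forall x, 0 <= lap z x) -> (forall x, z x ^+ 2 <= K * energy x) -> forall x, z x = 0.
Proof.
move=> K0 z0 lz zK.
pose gz : sfun := \sum_k D k z ^+ 2.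
have gz0 x : 0 <= gz x by rewrite sfun_sumE sumr_ge0 // => k _; rewrite sfunXE sqr_ge0.
have Dz x k : D k z x = 0.
  have [bu [cb b01 bx b0]] := bump_exists x ltr01.
  have I0 tau : 0 < tau -> int4 (bu * gz) <= 0 + tau.
    move=> tau0; have t0' : 0 < tau / (4 * (K + 1)) by rewrite divr_gt0 // mulr_gt0 // ltr_wpDl.
    have [e [ce e01 e1 et]] := cutoff_at x t0'.
    pose ge : sfun := \sum_j D j e ^+ 2.
    pose dv : sfun := \sum_j D j (e ^+ 2 * (z * D j z)).
    have cge : cs ge by apply: cs_sum => j; apply/cs_sqr/cs_der.
    have cdv : cs dv by apply: cs_sum => j; apply/cs_der/csMr/cs_sqr.
    have c1 : cs (cstf (4 * K) * (ge * energy)) by apply/csMl/csMr.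
    apply: (@le_trans _ _ (int4 (dv *+ 2 + cstf (4 * K) * (ge * energy)))); last first.
      have d0 : int4 (dv *+ 2) = 0.
        by rewrite mulr2n int4D // int4_divergence ?addr0 // => j; apply/csMr/cs_sqr.
      rewrite int4D ?d0 ?add0r //; last exact: csMn.
      rewrite int4_cstM; last exact: csMr.
      apply: (@le_trans _ _ (4 * K * (tau / (4 * (K + 1))))).
        by rewrite ler_wpM2l // mulr_ge0.
      have -> : 4 * K * (tau / (4 * (K + 1))) = tau * (K / (K + 1)).
        by field; rewrite gt_eqF // ltr_wpDl.
      rewrite ler_piMr ?(ltW tau0) // ler_pdivrMr ?mul1r ?lerDl // ltr_wpDl //.
    apply: int4_le; [exact: csMr| exact: csD (csMn _ cdv) c1|move=> y].
    pose cr : sfun := \sum_k (e * z * (D k e * D k z)) *+ 2.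
    have dvE : dv = e ^+ 2 * gz + cr + e ^+ 2 * (z * lap z).
      rewrite /dv /gz /cr /lap !mulr_sumr -!big_split /=; apply: eq_bigr => j _.
      rewrite (DM j (e ^+ 2)) (DM j z) expr2 (DM j e); ring.
    have {}dvE : dv y = e y ^+ 2 * gz y + cr y + e y ^+ 2 * (z y * lap z y).
      rewrite dvE (sfunDE _ (_ * (z * _))) (sfunDE _ cr) (sfunME _ gz) (sfunME (e ^+ 2)) sfunXE.
      by rewrite (sfunME z).
    have cross : - (2^-1 * (e y ^+ 2 * gz y) + 2 * (z y ^+ 2 * ge y)) <= cr y.
      rewrite /gz /ge /cr !sfun_sumE !mulr_sumr -big_split -sumrN; apply: ler_sum => j _.
      rewrite !sfunXE sfunMnE (sfunME (e * z)) (sfunME e) (sfunME (D j e)) -subr_ge0.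
      move: (e y) (z y) (D j e y) (D j z y) => p q r s.
      have -> : (p * q * (r * s)) *+ 2 - - (2^-1 * (p ^+ 2 * s ^+ 2) + 2 * (q ^+ 2 * r ^+ 2)) =
          2^-1 * (p * s + 2 * (q * r)) ^+ 2 by field.
      by rewrite mulr_ge0 ?sqr_ge0.
    have be : bu y * gz y <= e y ^+ 2 * gz y.
      rewrite ler_wpM2r //; have [/forallP H|] := boolP [forall k, `|y 0 k - x 0 k| < 1].
        by rewrite e1 ?expr1n //; have /andP[] := b01 y.
      by rewrite negb_forall => /existsP[j]; rewrite -leNgt => H; rewrite b0 ?sqr_ge0 //; exists j.
    have zz : 0 <= e y ^+ 2 * (z y * lap z y) by rewrite mulr_ge0 ?sqr_ge0 // mulr_ge0.
    have ge0 : 0 <= ge y by rewrite sfun_sumE sumr_ge0 // => j _; rewrite sfunXE sqr_ge0.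
    have zge := ler_wpM2r ge0 (zK y).
    rewrite (sfunME bu) (sfunDE (dv *+ 2)) sfunMnE (sfunME (cstf _)) cstfE (sfunME ge) dvE.
    move: cross be zz zge ge0; move: (gz y) (ge y) (cr y) (energy y) (bu y) (e y) (lap z y) (z y).
    move=> *; lra.
  have := int4_eq0 (csMr gz cb) _ _ x; rewrite (sfunME bu) => H.
  have /eqP : bu x * gz x = 0.
    apply: H; first by move=> y; rewrite sfunME mulr_ge0 //; have /andP[] := b01 y.
    by apply/ler_addgt0Pr => tau /I0.
  rewrite mulf_eq0 gt_eqF //= => /eqP gx; apply/eqP; rewrite -sqrf_eq0 eq_le sqr_ge0 andbT.
  by rewrite -sfunXE -gx sfun_sumE (bigD1 k) // lerDl sumr_ge0 // => j _; rewrite sfunXE sqr_ge0.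
move=> x; apply/eqP; rewrite eq_le z0 andbT leNgt; apply/negP => zx.
have K1 : 0 < K + 1 by rewrite ltr_wpDl.
have m0 : 0 < z x ^+ 2 / (K + 1) by rewrite divr_gt0 // exprn_gt0.
have e0 y : 0 <= energy y by have [] := energy_bounds y.
have [y ey] := quadratic_growth_inf e0 C_ge0 growth m0.
have := zK y; rewrite (const_everywhere Dz y x) leNgt => /negP; apply.
rewrite ltr_pdivlMr // in ey; apply: le_lt_trans ey.
by have := e0 y; move: (energy y) => p p0; lra.
Qed.

(** For unit v the function xi = f . v - h satisfies lap xi >= |u|^2 xi, as psi . v <= |nabla u|^2,
    and xi^2 is dominated by the energy; so its smoothed positive part vanishes. *)
Lemma curvature_pairing_le c (v : 'I_3 -> R) x : dot v v = 1 ->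
  dot (fun k => sdF c k x) v <= h x.
Proof.
move=> v1; pose xi : sfun := \sum_k cstf (v k) * sdF c k - h.
pose g : sfun := \sum_k cstf (v k) * sdW c k.
have xiE y : xi y = dot (fun k => sdF c k y) v - h y.
  rewrite (sfunDE _ (- h)) sfunNE sfun_sumE; congr (_ - _); apply: eq_bigr => k _.
  by rewrite (sfunME (cstf _)) cstfE mulrC.
have gE y : g y <= eps y.
  rewrite eps_val -[leRHS]mul1r.
  have -> : g y = dot (sd (sg R c) (wedge (fun j => P j y) (fun j => Q j y))) v.
    by rewrite sfun_sumE; apply: eq_bigr => k _; rewrite (sfunME (cstf _)) cstfE sdW_val mulrC.
  by apply: wedge_le; rewrite ?sg_sqr // v1 expr1n.
have lxi : lap xi = u2 * xi + (eps - g).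
  rewrite /xi /g lapD lapN (lap_higgs eq_re eq_im).
  have -> : lap (\sum_k cstf (v k) * sdF c k) =
      u2 * (\sum_k cstf (v k) * sdF c k) - \sum_k cstf (v k) * sdW c k.
    rewrite mulr_sumr -sumrB {1}/lap; under eq_bigr do rewrite !Dsum.
    rewrite exchange_big /=; apply: eq_bigr => k _; rewrite -/(lap (cstf (v k) * sdF c k)) lap_cstM.
    by rewrite lap_sdF; ring.
  ring.
pose z := pos0 ltr01 xi.
have xi2 y : xi y ^+ 2 <= 6 * energy y.
  rewrite xiE; have := cauchy_schwarz (fun k => sdF c k y) v; rewrite v1 mulr1 -dot_val -/(sdF2 c).
  have [e0 e1 e2 e3 e4] := energy_bounds y.
  have {e3 e4}: sdF2 c y <= 2 * energy y by move: (c); case.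
  have := sqr_ge0 (dot (fun k => sdF c k y) v + h y).
  move: (dot _ _) (h y) (energy y) (sdF2 c y) e2 => p q *; lra.
have zxi y : z y = 0 \/ 0 <= z y <= xi y.
  have [w0|w0] := leP (xi y) 0; first by left; have [] := pos_le0 ltr01 w0.
  right; have := pos0_le ltr01 xi y; rewrite max_r ?(ltW w0) // => ->.
  by rewrite andbT; have [[]] := pos_bounds ltr01 xi y.
have z0 : z x = 0.
  apply: (@subharmonic_vanishes z 6) => // y.
  - by have [[]] := pos_bounds ltr01 xi y.
  - rewrite /z lap_pos0 sfunDE (sfunME (pos2 _ _)) (sfunME (pos1 _ _)).
    have [[_ p1 p2] _] := pos_bounds ltr01 xi y.
    apply: addr_ge0; last first.
      by apply: mulr_ge0 => //; rewrite sfun_sumE sumr_ge0 // => k _; rewrite sfunXE sqr_ge0.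
    have [w0|w0] := leP (xi y) 0; first by have [_ -> _] := pos_le0 ltr01 w0; rewrite mul0r.
    rewrite mulr_ge0 // lxi (sfunDE (u2 * xi)) (sfunME u2) (sfunDE eps) sfunNE.
    by rewrite addr_ge0 ?subr_ge0 // mulr_ge0 ?normu_ge0 // ltW.
  - case: (zxi y) => [->|/andP[z1 z2]].
      by rewrite expr0n /= mulr_ge0 //; have [] := energy_bounds y.
    by apply: le_trans (xi2 y); rewrite ler_sqr ?nnegrE // (le_trans z1).
rewrite -subr_le0 -xiE leNgt; apply/negP => w0.
have : 0 < z x by rewrite /z /pos0 (sfunME xi) mulr_gt0 // flatfE flat_gt0.
by rewrite z0 ltxx.
Qed.

(* Take v = f / |f| in [curvature_pairing_le], and two opposite v to see that h >= 0. *)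
Lemma curvature_le c x : 0 <= h x /\ sdF2 c x <= h x ^+ 2.
Proof.
have h0 : 0 <= h x.
  pose v (s : R) (k : 'I_3) : R := s * (k == t0)%:R.
  have v1 s : s * s = 1 -> dot (v s) (v s) = 1 by move=> s1; rewrite /dot sum3 /v /= !mulr0 !addr0 mulr1.
  have := curvature_pairing_le c x (v1 1 (mulr1 1)).
  have := curvature_pairing_le c x (v1 (- 1) _); rewrite mulrNN mulr1 => /(_ erefl).
  rewrite /dot !sum3 /v /= !mulr0 !addr0 !mulr1; lra.
split=> //; have [f0|f0] := leP (sdF2 c x) 0; first by apply: le_trans f0 _; rewrite sqr_ge0.
pose r := Num.sqrt (sdF2 c x).
have r0 : 0 < r by rewrite sqrtr_gt0.
have r2 : r ^+ 2 = sdF2 c x by rewrite sqr_sqrtr // ltW.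
have fE : dot (fun k => sdF c k x) (fun k => sdF c k x) = r ^+ 2 by rewrite r2 /sdF2 dot_val.
have := @curvature_pairing_le c (fun k => r^-1 * sdF c k x) x.
rewrite !dotZr dotC dotZr fE.
have -> : r^-1 * (r^-1 * r ^+ 2) = 1 by field; rewrite gt_eqF.
have -> : r^-1 * r ^+ 2 = r by field; rewrite gt_eqF.
by move=> /(_ erefl) rh; rewrite -r2 ler_sqr ?nnegrE // ltW.
Qed.

(** * Pointwise consequences of stability *)

Lemma sdF2_val c x : sdF2 c x = dot (fun k => sdF c k x) (fun k => sdF c k x).
Proof. exact: dot_val. Qed.

Lemma sdFW_val c x : sdFW c x = dot (fun k => sdF c k x) (fun k => sdW c k x).
Proof. exact: dot_val. Qed.

Lemma D_sdF2 c k : D k (sdF2 c) = dot (sdF c) (fun l => D k (sdF c l)) *+ 2.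
Proof.
by rewrite /sdF2 D_dot mulr2n; congr (_ + _); apply: eq_bigr => l _; rewrite mulrC.
Qed.
Lemma normu_val x : u2 x = a x * a x + b x * b x.
Proof. by []. Qed.

(* From here on these functions are used through the lemmas about them only; unification
   would otherwise evaluate them down to the partial derivatives of a, b and A. *)
Opaque rho higgsf normu grad2 sdF2 sdFW.

Definition nrm c x := Num.sqrt (sdF2 c x).

Lemma nrm_ge0 c x : 0 <= nrm c x. Proof. exact: sqrtr_ge0. Qed.

Lemma nrm_sqr c x : nrm c x ^+ 2 = sdF2 c x.
Proof. by rewrite sqr_sqrtr // sdF2_ge0. Qed.

Lemma nrm_continuous c : continuous (nrm c).
Proof.
by move=> x; apply: continuous_comp; [exact: sfun_continuous|exact: sqrt_continuous].
Qed.

Lemma h_ge0 x : 0 <= h x. Proof. by have [] := curvature_le false x. Qed.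

Lemma nrm_le c x : nrm c x <= h x.
Proof.
by have [h0 fh] := curvature_le c x; rewrite -ler_sqr ?nnegrE ?nrm_ge0 // nrm_sqr.
Qed.

Lemma h_half x : h x <= 2^-1.
Proof. rewrite higgsf_val; have := normu_ge0 x; lra. Qed.

Section SlackBounds.
Variable d : R.
Hypothesis d0 : 0 < d.
Local Notation rho := (rho d0).
Local Notation chi := (chi d0).
Local Notation chi1 := (chi1 d0).
Local Notation gap := (gap d0).

Lemma rho_bounds c x : nrm c x <= rho c x <= nrm c x + d.
Proof.
have r0 := ltW (rho_gt0 d0 c x); have n0 := nrm_ge0 c x.
rewrite -ler_sqr ?nnegrE // -[_ <= _ + d]ler_sqr ?nnegrE ?addr_ge0 ?(ltW d0) //.
rewrite rho_sqr_val -nrm_sqr lerDl sqr_ge0 /= sqrrD addrAC lerDl mulrn_wge0 //.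
by rewrite mulr_ge0 // ltW.
Qed.

Lemma rho_le_h c x : rho c x <= h x + d.
Proof. by have /andP[_] := rho_bounds c x; have := nrm_le c x; lra. Qed.

Lemma gapC c x : gap x = rho c x + rho (~~ c) x - h x - d *+ 2.
Proof. rewrite gap_val; move: (h x) => y.
by have -> : rho false x + rho true x = rho c x + rho (~~ c) x by case: c; [exact: addrC|]. Qed.

Lemma chi_le_h x : chi x <= h x.
Proof.
apply: le_trans (pos0_le d0 gap x) _; rewrite ge_max h_ge0 gap_val andTb.
have := rho_le_h false x; have := rho_le_h true x.
by move: (rho false x) (rho true x) (h x) => p q y *; lra.
Qed.

Lemma slack_factor c x (t : R) : t <= rho c x -> t <= h x + d *+ 2 - rho (~~ c) x ->
  t <= rho c x - (chi x *+ 2 - chi x * chi1 x).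
Proof.
move=> t1 t2; have [w0|w0] := leP (gap x) 0.
  by have [-> _ _] := pos_le0 d0 w0; rewrite mul0rn mul0r subr0 subr0.
have [_ [_ _ /(_ w0)]] := pos_bounds d0 gap x; rewrite -/chi -/chi1 (gapC c).
by move: t1 t2; move: (chi x *+ 2 - _) (rho c x) (rho _ x) (h x) => q p p' y *; lra.
Qed.

Lemma slack_factor2 c x : 0 <= chi1 x * rho c x - chi x.
Proof.
have [w0|w0] := leP (gap x) 0.
  by have [-> -> _] := pos_le0 d0 w0; rewrite mul0r subr0.
have [z [s [[/andP[z0 z1] s0 sw] [sz cE c1E _]]]] := pos_gt0 d0 w0.
rewrite /chi cE /chi1 c1E.
have -> : z * (1 + s) * rho c x - gap x * z = z * (rho c x - gap x + s * rho c x) by ring.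
rewrite mulr_ge0 ?(ltW z0) // addr_ge0 //; last by rewrite mulr_ge0 ?ltW ?rho_gt0.
rewrite (gapC c); have := ltW d0; have := rho_le_h (~~ c) x.
by clear cE c1E sw; move: (rho c x) (rho _ x) (h x) => p q y *; lra.
Qed.

Lemma grad_ge c x : 0 <= eps x - sdFW c x / rho c x.
Proof.
rewrite subr_ge0 ler_pdivrMr ?rho_gt0 // mulrC; apply: sdFW_le; first by rewrite ltW ?rho_gt0.
by rewrite rho_sqr_val lerDl sqr_ge0.
Qed.

Lemma slack_ge_grad c x (t : R) : t <= rho c x -> t <= h x + d *+ 2 - rho (~~ c) x ->
  t * (eps x - sdFW c x / rho c x) <= slack d0 c x.
Proof.
move=> t1 t2; rewrite slack_val -[leLHS]addr0 lerD //.
  by rewrite ler_wpM2r ?grad_ge // slack_factor.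
rewrite mulr_ge0 ?divr_ge0 ?excess_ge0 ?sqr_ge0 //.
by rewrite mulr_ge0 ?chi_ge0 // slack_factor2.
Qed.

Lemma slack_ge0 c x : 0 <= slack d0 c x.
Proof.
rewrite -[leLHS](mul0r (eps x - sdFW c x / rho c x)); apply: slack_ge_grad.
  by rewrite ltW ?rho_gt0.
by have hd := d0; have := rho_le_h (~~ c) x; move: (rho _ x) (h x) => *; lra.
Qed.

Lemma slack_ge_excess c x : chi x * (chi1 x * rho c x - chi x) * (excess d0 c x / rho c x ^+ 2)
  <= slack d0 c x.
Proof.
rewrite slack_val lerDr mulr_ge0 ?grad_ge // slack_factor ?ltW ?rho_gt0 //.
by have hd := d0; have := rho_le_h (~~ c) x; move: (rho _ x) (h x) => *; lra.
Qed.

End SlackBounds.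

Implicit Types (x y z : V).

(** A pointwise lower bound of the slacks, uniform as d tends to 0, contradicts stability:
    first choose the cutoff, then d. *)
Lemma no_uniform_slack (x0 : V) (c0 d1 r : R) : 0 < c0 -> 0 < d1 -> 0 < r <= 1 ->
  (forall (d : R) (d0 : 0 < d), d < d1 -> forall e : sfun,
     (forall y, (forall k, `|y 0 k - x0 0 k| < 1) -> e y = 1) ->
     forall y, (forall k, `|y 0 k - x0 0 k| < r) ->
     c0 <= slack d0 false y + slack d0 true y + misfit d0 e y) -> False.
Proof.
move=> c00 d10 /andP[r0 r1] H.
have [bu [cb b01 bx b0]] := bump_exists x0 r0.
have I0 : 0 < int4 bu.
  rewrite ltNge; apply/negP => Ib.
  have b_ge0 y : 0 <= bu y by have /andP[] := b01 y.
  by have := int4_eq0 cb b_ge0 Ib x0 => bx0; rewrite bx0 ltxx in bx.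
pose m := c0 * int4 bu.
have m0 : 0 < m by rewrite mulr_gt0.
have t0' : 0 < m / 8 by rewrite divr_gt0.
have [e [ce e01 e1 et]] := cutoff_at x0 t0'.
pose K := int4 (e ^+ 2 * eps).
have cK : cs (e ^+ 2 * eps) by apply/csMr/cs_sqr.
have K0 : 0 <= K.
  rewrite -(int4_0 R); apply: int4_le => // [|y]; first exact: cs0.
  by rewrite (sfunME (e ^+ 2)) sfunXE mulr_ge0 ?sqr_ge0 ?eps_ge0.
pose d := Num.min (d1 / 2) (m / (16 * (K + 1))).
have d0 : 0 < d by rewrite lt_min divr_gt0 //= divr_gt0 // mulr_gt0 // ltr_wpDl.
have dd1 : d < d1 by rewrite gt_min ltr_pdivrMr // ltr_pMr // ltr1n.
have dK : d *+ 4 * K <= m / 4.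
  apply: (@le_trans _ _ ((m / (16 * (K + 1))) *+ 4 * (K + 1))).
    by rewrite ler_pM ?mulrn_wge0 ?(ltW d0) ?lerDl // lerMn2r /= ge_min lexx orbT.
  by rewrite le_eqVlt; apply/orP; left; apply/eqP; field; rewrite gt_eqF // ltr_wpDl.
have H1 := H d d0 dd1 e e1.
have := stability_slack d0 ce.
set L := (X in int4 X <= _); set S := (X in _ <= int4 X).
pose De : sfun := \sum_k D k e ^+ 2.
have cDe : cs De by apply: cs_sum => k; apply/cs_sqr/cs_der.
have cL : cs L.
  apply: csD; first by apply/csMr/cs_sqr.
  apply: cs_sum => i; apply: cs_sqr; apply: csD; first by apply: cs_sum => j; apply/cs_der/csMr.
  by apply/csN/csMr.
have De0 y : 0 <= De y by rewrite sfun_sumE sumr_ge0 // => k _; rewrite sfunXE sqr_ge0.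
have mf0 y : 0 <= misfit d0 e y by rewrite sfun_sumE sumr_ge0 // => k _; rewrite sfunXE sqr_ge0.
have L1 : m <= int4 L.
  rewrite /m -int4_cstM //; apply: int4_le => // [|y]; first exact: csMl.
  rewrite (sfunME (cstf c0)) cstfE (sfunDE _ (misfit d0 e)) (sfunME (e ^+ 2)) sfunXE (sfunDE (slack _ _)).
  have sl : 0 <= slack d0 false y + slack d0 true y by rewrite addr_ge0 ?slack_ge0.
  have [/forallP yr|] := boolP [forall k, `|y 0 k - x0 0 k| < r]; last first.
    rewrite negb_forall => /existsP[j]; rewrite -leNgt => jr.
    rewrite b0; last by exists j.
    by rewrite mulr0; apply: addr_ge0 => //; apply: mulr_ge0 => //; exact: sqr_ge0.
  rewrite e1; last by move=> k; exact: lt_le_trans (yr k) r1.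
  rewrite expr1n mul1r (le_trans _ (H1 y yr)) // ler_piMr ?(ltW c00) //.
  by have /andP[] := b01 y.
have S1 : int4 S <= m / 4 + m / 4.
  apply: (@le_trans _ _ (int4 (cstf (d *+ 4) * (e ^+ 2 * eps) + cstf 2 * (De * energy)))).
    apply: int4_le => [||y].
    - by apply: csD; [apply/csMl|apply: csMr].
    - by apply: csD; [apply/csMl|apply/csMl/csMr].
    rewrite (sfunDE (cstf _ * _)) [leRHS](sfunDE (cstf _ * _)) lerD2l.
    rewrite (sfunME De) (sfunME (cstf 2)) cstfE (sfunME De) mulrCA ler_wpM2l //.
    rewrite (sfunDE _ (_ ^+ 2)) (sfunDE eps) !sfunXE.
    have c2 : chi d0 y ^+ 2 <= h y ^+ 2.
      by rewrite ler_sqr ?nnegrE ?chi_ge0 ?h_ge0 // chi_le_h.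
    have e0 := eps_ge0 y; have f0 := sdF2_ge0 false y; have f1 := sdF2_ge0 true y.
    rewrite energy_val; move: c2 e0 f0 f1.
    move: (chi d0 y ^+ 2) (h y ^+ 2) (eps y) (sdF2 false y) (sdF2 true y) => *; lra.
  rewrite int4D; [|by apply/csMl|by apply/csMl/csMr].
  rewrite !int4_cstM //; last exact: csMr.
  apply: lerD => //; have : 2 * int4 (De * energy) <= 2 * (m / 8) by rewrite ler_wpM2l.
  lra.
move: L1 S1; rewrite /S -/De; move: (int4 _) (int4 _) => p q *; lra.
Qed.

Lemma slack_le_total (d : R) (d0 : 0 < d) c (e : sfun) y :
  slack d0 c y <= slack d0 false y + slack d0 true y + misfit d0 e y.
Proof.
have s0 := slack_ge0 d0 false y; have s1 := slack_ge0 d0 true y.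
have m0 : 0 <= misfit d0 e y by rewrite sfun_sumE sumr_ge0 // => k _; rewrite sfunXE sqr_ge0.
by case: c; move: s0 s1 m0;
  move: (slack _ false y) (slack _ true y) (misfit _ _ y) => *; lra.
Qed.

Lemma rho_le2 c y (d : R) (d0 : 0 < d) : d < 1 -> rho d0 c y <= 2.
Proof.
have := rho_le_h d0 c y; have := h_half y; move: (rho _ _ y) (h y) => *; lra.
Qed.

Lemma nrm_eq0 c x : nrm c x = 0 -> forall k, sdF c k x = 0.
Proof.
move=> n0 k; apply/eqP; rewrite -sqrf_eq0 eq_le sqr_ge0 andbT.
apply: (@le_trans _ _ (sdF2 c x)); last by rewrite -nrm_sqr n0 expr0n.
by rewrite sdF2_val /dot (bigD1 k) // -expr2 lerDl sumr_ge0 // => j _; rewrite -expr2 sqr_ge0.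
Qed.

Lemma sdFW_le_nrm c x : sdFW c x <= nrm c x * eps x.
Proof. by apply: sdFW_le; rewrite ?nrm_ge0 // nrm_sqr. Qed.

(** Where |f'| < h the first term of the slack of f is at least a positive multiple of
    |nabla u|^2 - f . psi / |f|, so this quantity has to vanish. *)
Lemma gradient_aligned c x : nrm (~~ c) x < h x -> sdFW c x = nrm c x * eps x.
Proof.
move=> xh; apply/le_anti/andP; split; first exact: sdFW_le_nrm.
rewrite leNgt; apply/negP => lt_x.
have n0 : 0 < nrm c x.
  rewrite lt_neqAle nrm_ge0 andbT; apply/eqP => n0; move: lt_x; rewrite -n0 mul0r.
  by rewrite sdFW_val /dot big1 ?ltxx // => k _; rewrite nrm_eq0 ?mul0r.
pose m1 := (h x - nrm (~~ c) x) / 2; pose m2 := nrm c x / 2.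
pose m3 := (nrm c x * eps x - sdFW c x) / 2.
have hc1 := near_gap (sfun_continuous (f := h) (x := x)) (@nrm_continuous (~~ c) x) xh.
have hc2 := near_gap (continuous_mul (@nrm_continuous c x) (sfun_continuous (f := eps) (x := x)))
  (sfun_continuous (f := sdFW c) (x := x)) lt_x.
have m10 : 0 < m1 by rewrite divr_gt0 // subr_gt0.
have m20 : 0 < m2 by rewrite divr_gt0.
have m30 : 0 < m3 by rewrite divr_gt0 // subr_gt0.
have N : nbhs x [set y | [/\ m1 < h y - nrm (~~ c) y, m2 < nrm c y & m3 < nrm c y * eps y - sdFW c y]].
  by apply: filterS3 hc1 (near_gt (@nrm_continuous c x) (half_lt m20)) hc2 => y.
have [r r01 Hr] := near_box N.
clearbody m1 m2 m3; clear hc1 hc2 N.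
have t0' : 0 < Num.min m1 m2 by rewrite lt_min m10.
apply: (@no_uniform_slack x (Num.min m1 m2 * (m3 / 2)) 1 r) => //.
  by rewrite mulr_gt0 // divr_gt0.
move=> d d0 d1 e _ y /Hr[H1 H2 H3]; apply: le_trans (slack_le_total d0 c e y).
have /andP[rn rnd] := rho_bounds d0 c y; have /andP[_ rnd'] := rho_bounds d0 (~~ c) y.
apply: (@le_trans _ _ (Num.min m1 m2 * (eps y - sdFW c y / rho d0 c y))); last first.
  apply: slack_ge_grad; rewrite ge_min.
    by rewrite (le_trans (ltW H2) rn) orbT.
  by apply/orP; left; move: H1 rnd' (ltW d0); move: (rho d0 (~~ c) y) (h y) (nrm (~~ c) y) => *; lra.
rewrite ler_wpM2l ?(ltW t0') // -(ler_pM2r (rho_gt0 d0 c y)).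
have -> : (eps y - sdFW c y / rho d0 c y) * rho d0 c y = rho d0 c y * eps y - sdFW c y.
  by rewrite mulrBl divfK ?gt_eqF ?rho_gt0 // mulrC.
have r2 := rho_le2 c y d0 d1.
have e1 : nrm c y * eps y <= rho d0 c y * eps y by rewrite ler_wpM2r ?eps_ge0.
apply: (@le_trans _ _ m3); last by rewrite (le_trans (ltW H3)) // lerD2r.
have : m3 / 2 * rho d0 c y <= m3 / 2 * 2 by rewrite ler_wpM2l // divr_ge0 // ltW.
by rewrite divfK.
Qed.

(** Where |f'| < h < |f| + |f'| the second term of the slack stays bounded below as d tends to 0,
    unless f . df carries all of df, that is, unless the direction of f is parallel. *)
Lemma direction_parallel c x : nrm (~~ c) x < h x -> h x < nrm c x + nrm (~~ c) x -> forall k l,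
  sdF2 c x * D k (sdF c l) x = dot (fun i => sdF c i x) (fun i => D k (sdF c i) x) * sdF c l x.
Proof.
move=> xh xn.
pose Tf k : sfun := sdF2 c * dot (fun l => D k (sdF c l)) (fun l => D k (sdF c l))
   - dot (sdF c) (fun l => D k (sdF c l)) ^+ 2.
pose T : sfun := \sum_k Tf k.
have Tk y k : Tf k y =
   sdF2 c y * dot (fun l => D k (sdF c l) y) (fun l => D k (sdF c l) y)
   - dot (fun l => sdF c l y) (fun l => D k (sdF c l) y) ^+ 2.
  by rewrite (sfunDE (sdF2 c * _)) sfunNE sfunXE (sfunME (sdF2 c)) !dot_val.
have Tk0 y k : 0 <= sdF2 c y * dot (fun l => D k (sdF c l) y) (fun l => D k (sdF c l) y)
   - dot (fun l => sdF c l y) (fun l => D k (sdF c l) y) ^+ 2.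
  by rewrite subr_ge0 sdF2_val; exact: cauchy_schwarz.
suff Tx : T x <= 0.
  move=> k l; rewrite sdF2_val; apply: cauchy_schwarz_eq.
  apply/eqP; rewrite eq_sym -subr_eq0 -sdF2_val eq_le Tk0 andbT.
  apply: le_trans Tx; rewrite /T sfun_sumE (bigD1 k) // Tk lerDl sumr_ge0 // => j _.
  by rewrite Tk.
rewrite leNgt; apply/negP => T0.
pose m1 := (h x - nrm (~~ c) x) / 2; pose m2 := (nrm c x + nrm (~~ c) x - h x) / 2.
pose m3 := T x / 2.
have hc1 := near_gap (sfun_continuous (f := h) (x := x)) (@nrm_continuous (~~ c) x) xh.
have hc2 := near_gap (continuous_add (@nrm_continuous c x) (@nrm_continuous (~~ c) x))
  (sfun_continuous (f := h) (x := x)) xn.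
have m10 : 0 < m1 by rewrite divr_gt0 // subr_gt0.
have m20 : 0 < m2 by rewrite divr_gt0 // subr_gt0.
have m30 : 0 < m3 by rewrite divr_gt0.
have N : nbhs x [set y | [/\ m1 < h y - nrm (~~ c) y, m2 < nrm c y + nrm (~~ c) y - h y & m3 < T y]].
  by apply: filterS3 hc1 hc2 (near_gt (sfun_continuous (f := T) (x := x)) (half_lt m30)) => y.
have [r r01 Hr] := near_box N.
clearbody m1 m2 m3; clear hc1 hc2 N.
have q1 : 0 <= m1 / 2 by rewrite divr_ge0 // ltW.
have q2 : 0 <= m2 / 4 by rewrite divr_ge0 // ltW.
have q3 : 0 <= m3 / 16 by rewrite divr_ge0 // ltW.
apply: (@no_uniform_slack x (m2 / 4 * (m1 / 2) * (m3 / 16)) (Num.min 1 (m2 / 4)) r) => //.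
- by rewrite !mulr_gt0 ?divr_gt0 // invr_gt0.
- by rewrite lt_min ltr01 divr_gt0.
move=> d d0; rewrite lt_min => /andP[d1 dm] e _ y /Hr[H1 H2 H3].
apply: le_trans (slack_le_total d0 c e y); apply: le_trans (slack_ge_excess d0 c y).
have /andP[rn rnd] := rho_bounds d0 c y; have /andP[rn' rnd'] := rho_bounds d0 (~~ c) y.
have r0 := rho_gt0 d0 c y.
have gE := gapC d0 c y.
have w2 : m2 / 2 <= gap d0 y.
  clear rnd rnd' H1 H3 Hr; rewrite gE; clear gE.
  move: (rho d0 c y) (rho d0 (~~ c) y) (h y) (nrm c y) (nrm (~~ c) y) rn rn' H2 => *; lra.
have [A1 /(_ (rho d0 c y) m1 (ltW r0) (ltW m10))] := pos_lower d0 w2 dm.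
rewrite -/(chi d0) -/(chi1 d0) in A1 *.
have -> : gap d0 y + m1 <= rho d0 c y.
  clear rnd rn rn' H2 H3 Hr w2 A1; rewrite gE; clear gE.
  move: (rho d0 c y) (rho d0 (~~ c) y) (h y) (nrm (~~ c) y) rnd' (ltW H1) (ltW d0) => *; lra.
move=> /(_ isT) A2.
have A3 : m3 / 16 <= excess d0 c y / rho d0 c y ^+ 2.
  have r2 := rho_le2 c y d0 d1.
  have TE : T y <= rho d0 c y ^+ 2 * excess d0 c y.
    rewrite /T /excess !sfun_sumE mulr_sumr; apply: ler_sum => k _; rewrite Tk.
    rewrite (sfunDE (dot _ _)) sfunNE sfunXE dot_val mulrBr -exprMn -(sfunME (rho _ _)) D_rho.
    rewrite [X in _ <= _ - X ^+ 2]dot_val lerD2r ler_wpM2r ?dot_ge0 //.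
    by rewrite rho_sqr_val lerDl sqr_ge0.
  by apply: quotient_lower (ltW m30) r0 r2 (le_trans (ltW H3) TE).
exact: ler_pM (mulr_ge0 q2 q1) q3 (ler_pM q2 q1 A1 A2) A3.
Qed.

(** Where |f| + |f'| <= h on an open set the test form is h Id / 2, whose divergence does
    not match the gradient of h. *)
Lemma higgs_locally_constant x :
  (\forall y \near x, nrm false y + nrm true y <= h y) -> forall k, D k h x = 0.
Proof.
move=> N k; apply/eqP; rewrite -sqrf_eq0 eq_le sqr_ge0 andbT.
pose G : sfun := \sum_i D i h ^+ 2.
suff Gx : G x <= 0.
  apply: le_trans Gx; rewrite -sfunXE /G sfun_sumE (bigD1 k) // lerDl sumr_ge0 // => j _.
  by rewrite sfunXE sqr_ge0.
rewrite leNgt; apply/negP => G0.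
have G2 : 0 < G x / 2 by rewrite divr_gt0.
have half : G x / 2 < G x by move: G0; move: (G x) => *; lra.
have : \forall y \near x, (\forall z \near y, nrm false z + nrm true z <= h z) /\ G x / 2 < G y.
  by apply: filterS2 (near_near N) (near_gt (sfun_continuous (f := G) (x := x)) half) => y.
move=> /near_box[r r01 Hr].
have /andP[r0 r1] := r01.
apply: (@no_uniform_slack x (4^-1 * (G x / 2)) 1 (r / 2)) => //.
- by rewrite mulr_gt0 // invr_gt0.
- by rewrite divr_gt0 //= ler_pdivrMr // mul1r (le_trans r1) // ler1n.
move=> d d0 d1 e e1 y yr2.
have yr k' : `|y 0 k' - x 0 k'| < r by apply: lt_trans (yr2 k') _; rewrite ltr_pdivrMr // ltr_pMr // ltr1n.
have [Ny Gy] := Hr y yr.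
have mE : misfit d0 e y = 4^-1 * G y.
  have loc i j : \forall z \near y, (e * testN d0 i j) z = (cstf 2^-1 * (h *+ (i == j))) z.
    have ey : \forall z \near y, e z = 1.
      apply/nbhs_box; exists (1 / 2) => [|z zy]; first by rewrite divr_gt0.
      apply: e1 => l; have := yr2 l; have := zy l; rewrite !ltr_norml; move: r1; lra.
    apply: filterS2 Ny ey => z Nz ez.
    rewrite (sfunME e) ez mul1r (sfunME (cstf _)) cstfE.
    rewrite /testN (sfunME (cstf _)) cstfE (sfunDE (h *+ _)) sfunNE (sfunME (quot d0)) (sfunME (chi d0)).
    have [-> _ _] : [/\ chi d0 z = 0, chi1 d0 z = 0 & pos2 d0 (gap d0) z = 0].
      apply: pos_le0; rewrite gap_val.
      have /andP[_] := rho_bounds d0 false z; have /andP[_] := rho_bounds d0 true z.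
      by move: Nz; move: (rho d0 false z) (rho d0 true z) (nrm false z) (nrm true z) (h z) => *; lra.
    by rewrite !mul0r oppr0 addr0.
  have ey : e y = 1 by apply: e1 => l; exact: lt_le_trans (yr l) r1.
  rewrite /misfit /G !sfun_sumE mulr_sumr; apply: eq_bigr => i _.
  rewrite sfunXE (sfunDE (\sum_j _)) sfunNE (sfunME e) ey mul1r sfun_sumE.
  have -> : \sum_j D j (e * testN d0 i j) y = 2^-1 * D i h y.
    have off j : j != i -> D j (e * testN d0 i j) y = 0.
      by move=> ji; rewrite (D_near _ (loc i j)) eq_sym (negbTE ji) mulr0n mulr0 D0.
    rewrite (bigD1 i) // (D_near _ (loc i i)) eqxx mulr1n DM D_cst mul0r add0r (sfunME (cstf _)) cstfE.
    by rewrite big1 //; exact: addr0.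
  by rewrite sfunXE; move: (D i h y) => p; field.
rewrite mE; apply: (@le_trans _ _ (4^-1 * G y)); first by rewrite ler_wpM2l ?invr_ge0 // ltW.
by rewrite lerDr addr_ge0 ?slack_ge0.
Qed.

(** * Saturation of one half of the curvature *)

Lemma D_higgs_val k x : D k h x = - (P k x * a x + Q k x * b x).
Proof. by rewrite (D_higgs a b A) sfunNE (sfunDE (P k * a)) (sfunME (P k)) (sfunME (Q k)). Qed.

Lemma lap_h_val x : lap h x = u2 x * h x - eps x.
Proof. by rewrite (lap_higgs eq_re eq_im) (sfunDE (u2 * h)) sfunNE (sfunME u2). Qed.

(* If dh = 0 then all nabla_j u are real multiples of the same number i u. *)
Lemma vortex_zero x : 0 < u2 x -> (forall k, D k h x = 0) -> forall c k, sdW c k x = 0.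
Proof.
move=> u0 Dh c k; rewrite sdW_val.
have Wz i j : wedge (fun j => P j x) (fun j => Q j x) i j = 0.
  have E l : P l x * a x + Q l x * b x = 0 by apply/eqP; rewrite -oppr_eq0 -D_higgs_val Dh.
  have Ei := E i; have Ej := E j; rewrite /wedge.
  move: u0 Ei Ej; rewrite normu_val.
  move: (P i x) (P j x) (Q i x) (Q j x) (a x) (b x) => p p' q q' s t u0 e e'.
  have H : (s * s + t * t) * (p * q' - q * p') = 0.
    have -> : (s * s + t * t) * (p * q' - q * p') =
      (p * s + q * t) * (q' * s - p' * t) - (p' * s + q' * t) * (q * s - p * t) by ring.
    by rewrite e e' !mul0r subr0.
  by move/eqP: H; rewrite mulf_eq0 gt_eqF //= => /eqP ->; rewrite mul0rn.
by rewrite /sd; elim/ord3_case: k; cbv [nth nat_of_ord t0 t1 t2]; rewrite !Wz mulr0 ?subr0 ?addr0.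
Qed.

Lemma curv_zero x : (forall c, nrm c x = 0) -> forall j k, F j k x = 0.
Proof.
move=> n0 j k; have := sdF2E x; rewrite -!nrm_sqr !n0 expr0n addr0 mulr0 => /eqP.
rewrite mulf_eq0 invr_eq0 pnatr_eq0 orFb => /eqP E; apply/eqP.
rewrite -sqrf_eq0 eq_le sqr_ge0 andbT -E.
apply: le_trans (le_sum_term (f := fun l => \sum_k F l k x ^+ 2) j _) => [|l].
  by apply: (le_sum_term (f := fun l => F j l x ^+ 2)) => l; exact: sqr_ge0.
by rewrite sumr_ge0 // => m _; exact: sqr_ge0.
Qed.

Lemma eps_zero x : 0 < u2 x -> (forall k, D k h x = 0) ->
  (forall k, Q k x * a x - P k x * b x = 0) -> eps x = 0.
Proof.
move=> u0 Dh Eq; rewrite eps_val /sqsum big1 // => k _.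
have E : P k x * a x + Q k x * b x = 0 by apply/eqP; rewrite -oppr_eq0 -D_higgs_val Dh.
have E' := Eq k; move: u0 E E'; rewrite normu_val.
move: (P k x) (Q k x) (a x) (b x) => p q s t u0 e e'.
have : (s * s + t * t) * (p * p + q * q) = (p * s + q * t) ^+ 2 + (q * s - p * t) ^+ 2 by ring.
rewrite e e' expr0n addr0 => /eqP; rewrite mulf_eq0 gt_eqF //= => /eqP -> //.
Qed.

Lemma eq_curv_val k x : (\sum_j D j (F j k)) x = - (Q k x * a x - P k x * b x).
Proof. by rewrite eq_curv sfunNE (sfunDE (Q k * a)) sfunNE (sfunME (P k)) (sfunME (Q k)). Qed.

(* By the Bianchi identity both halves of the curvature have half its divergence. *)
Lemma div_Jm c k : \sum_j D j (Jm (sg sfun c) (sdF c) j k) = \sum_j D j (F j k).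
Proof.
have -> : sdF c = sd (sg sfun c) F by [].
rewrite !sum4; elim/ord4_case: k; rewrite !JmE !sdE sgE.
all: rewrite !(DD, DN, DM, D_cst, D0, mul0r, add0r).
all: rewrite -sgE.
all: rewrite ?(D_comm o1 o0) ?(D_comm o2 o0) ?(D_comm o3 o0) ?(D_comm o2 o1) ?(D_comm o3 o1) ?(D_comm o3 o2).
all: have s1 := sg_sqr sfun c; move: (sg sfun c) s1 => s s1.
all: ring: s1.
Qed.

(* Equality in the pointwise bound says that nabla_X u + i nabla_{JX} u = 0 for J = f / |f|. *)
Lemma rot_vanish c x : sdFW c x = nrm c x * eps x -> forall j,
  nrm c x * P j x = \sum_k Jm (sg R c) (fun l => sdF c l x) j k * Q k x /\
  nrm c x * Q j x = - \sum_k Jm (sg R c) (fun l => sdF c l x) j k * P k x.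
Proof.
move=> E j.
have := sqsum_rot (nrm c x) (fun l => sdF c l x) (fun j => P j x) (fun j => Q j x) (sg_sqr R c).
have -> : sd (sg R c) (wedge (fun j => P j x) (fun j => Q j x)) = fun k => sdW c k x.
  by apply/funext => k; rewrite sdW_val.
rewrite [dot (fun k => sdW c k x) _]dotC -sdFW_val E -sdF2_val -eps_val -nrm_sqr.
have -> : (nrm c x ^+ 2 + nrm c x ^+ 2) * eps x - (nrm c x * (nrm c x * eps x)) *+ 2 = 0 by ring.
move/sqsum_eq0/(_ j) => [p0 q0].
split; first by apply/eqP; rewrite -subr_eq0; apply/eqP; exact: p0.
by apply/eqP; rewrite -addr_eq0; apply/eqP; exact: q0.
Qed.

Lemma lap_sdF2 c : lap (sdF2 c) =
  (\sum_k dot (fun l => D k (sdF c l)) (fun l => D k (sdF c l)) + u2 * sdF2 c - sdFW c) *+ 2.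
Proof.
rewrite /lap (eq_bigr _ (fun k _ => congr1 (D k) (D_sdF2 c k))).
have E k : D k (dot (sdF c) (fun l => D k (sdF c l)) *+ 2) =
    (dot (fun l => D k (sdF c l)) (fun l => D k (sdF c l)) +
     dot (sdF c) (fun l => D k (D k (sdF c l)))) *+ 2 by rewrite DMn D_dot.
rewrite (eq_bigr _ (fun k _ => E k)) sumrMnl; congr (_ *+ 2).
rewrite big_split -addrA; congr (_ + _).
rewrite /dot exchange_big.
transitivity (\sum_l (u2 * (sdF c l * sdF c l) - sdF c l * sdW c l)).
  by apply: eq_bigr => l _; rewrite -mulr_sumr -/(lap (sdF c l)) lap_sdF; ring.
by rewrite sumrB -mulr_sumr.
Qed.

(* Bianchi, the equation d^* F = <nabla u, i u> and f = |f| J with J constant give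
   d |f| = d h. *)
Lemma radial_gradient c x : nrm (~~ c) x < h x -> h x < nrm c x + nrm (~~ c) x -> forall k,
  D k (sdF2 c) x = (nrm c x * D k h x) *+ 2.
Proof.
move=> xh xn.
have r0 : 0 < nrm c x by move: xh xn; move: (nrm c x) (nrm _ x) (h x) => *; lra.
have Dir := direction_parallel xh xn.
have Rot := rot_vanish (gradient_aligned xh).
pose J := Jm (sg R c) (fun l => sdF c l x).
pose y j := dot (fun i => sdF c i x) (fun i => D j (sdF c i) x).
have JN j k : J j k = - J k j.
  by rewrite /J; elim/ord4_case: j; elim/ord4_case: k; rewrite !JmE ?oppr0 ?opprK.
have DJ j k : nrm c x ^+ 2 * D j (Jm (sg sfun c) (sdF c) j k) x = y j * J j k.
  rewrite D_Jm Jm_val nrm_sqr /J.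
  by apply: Jm_scale => l; exact: Dir.
have div k : \sum_j y j * J j k = nrm c x * \sum_j D j h x * J j k.
  transitivity (nrm c x ^+ 2 * (\sum_j D j (Jm (sg sfun c) (sdF c) j k)) x).
    by rewrite sfun_sumE mulr_sumr; apply: eq_bigr => j _; rewrite DJ.
  rewrite div_Jm eq_curv_val; have [RP RQ] := Rot k.
  transitivity (nrm c x * - (nrm c x * Q k x * a x - nrm c x * P k x * b x)); first by ring.
  rewrite RP RQ; congr (_ * _); rewrite mulNr !mulr_suml -opprD opprK -big_split /=.
  apply: eq_bigr => j _; rewrite D_higgs_val (JN j k) -/J.
  change (J k j * P j x * a x + J k j * Q j x * b x = - (P j x * a x + Q j x * b x) * - J k j).
  by move: (P j x) (Q j x) (J k j) (a x) (b x) => *; ring.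
move=> k; rewrite D_sdF2 sfunMnE dot_val -/(y k); congr (_ *+ 2).
pose z j := y j - nrm c x * D j h x.
have z0 j : \sum_i z i * J i j = 0.
  rewrite /z; under eq_bigr do rewrite mulrBl -mulrA.
  by rewrite sumrB -mulr_sumr div subrr.
have := Jm_sqr (fun l => sdF c l x) z k (sg_sqr R c).
rewrite big1 => [|j _]; last by rewrite -/J z0 mul0r.
rewrite -sdF2_val -nrm_sqr => /eqP; rewrite eq_sym oppr_eq0 mulf_eq0 expf_eq0 gt_eqF //=.
by rewrite subr_eq0 => /eqP.
Qed.

Lemma nrm_lt_near c x : nrm c x < h x -> \forall y \near x, nrm c y < h y.
Proof.
by apply: near_lt2; [exact: (@sfun_continuous R h x)|exact: nrm_continuous].
Qed.

(* Both halves shorter than h, but not jointly: then d |f| = d h contradicts the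
   Laplacians of |f| and h. *)
Lemma no_long_point x : nrm false x < h x -> nrm true x < h x -> 0 < u2 x ->
  ~ h x < nrm false x + nrm true x.
Proof.
move=> x0 x1 ux xn.
have n0 : 0 < sdF2 false x.
  rewrite -nrm_sqr exprn_gt0 //; move: x1 xn; move: (nrm _ x) (nrm true x) (h x) => *; lra.
have [g [g0 gE]] := positive_extension n0.
pose r := sqrtf g0.
have r_pos y : 0 < r y by rewrite sqrtfE sqrtr_gt0.
have rr : r * r = g by exact: sqrtf_sqr.
have N1 := nrm_lt_near x0; have N2 := nrm_lt_near x1.
have N3 : \forall y \near x, h y < nrm false y + nrm true y.
  apply: near_lt2 xn; last exact: (@sfun_continuous R h x).
  by apply: continuous_add; exact: nrm_continuous.
have Dr : \forall y \near x, forall k, D k r y = D k h y.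
  apply: filterS3 (near_near gE) N2 (filterI N1 N3) => y gy y1 [y0 yn] k.
  have E := radial_gradient (c := false) y1 yn k.
  have rn : r y = nrm false y by rewrite sqrtfE (nbhs_singleton gy).
  have : D k (r * r) y = (r y * D k h y) *+ 2 by rewrite rr rn -E; exact: D_near.
  rewrite DM (sfunDE (D k r * r)) (sfunME (D k r)) (sfunME r) mulrC -mulr2n => /double_inj.
  by apply: mulfI; rewrite gt_eqF.
have L1 : lap r x = lap h x.
  rewrite /lap !sfun_sumE; apply: eq_bigr => k _; apply: D_near.
  by apply: filterS Dr => y /(_ k).
have L2 : lap (r * r) x = lap (sdF2 false) x by rewrite rr; exact: lap_near.
have rx : r x = nrm false x by rewrite sqrtfE (nbhs_singleton gE).
have Drx := nbhs_singleton Dr.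
have al := gradient_aligned (c := false) x1.
have Dx k : dot (fun l => D k (sdF false l) x) (fun l => D k (sdF false l) x) = D k h x ^+ 2.
  have par := direction_parallel (c := false) x1 xn k.
  have rad := radial_gradient (c := false) x1 xn k.
  rewrite D_sdF2 sfunMnE dot_val in rad.
  have {}rad : dot (fun l => sdF false l x) (fun l => D k (sdF false l) x) = nrm false x * D k h x.
    exact: double_inj.
  apply: (mulfI (x := sdF2 false x)); first by rewrite gt_eqF.
  transitivity (dot (fun l => D k (sdF false l) x) (fun l => sdF2 false x * D k (sdF false l) x)).
    by rewrite dotZr.
  transitivity (dot (fun l => D k (sdF false l) x) (fun l => (nrm false x * D k h x) * sdF false l x)).
    by apply: eq_bigr => l _; rewrite par rad.
  by rewrite dotZr dotC rad -nrm_sqr; ring.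
move: L2; rewrite lap_sqr lap_sdF2 !sfunMnE => /double_inj.
rewrite (sfunDE _ (r * lap r)) (sfunDE _ (- sdFW _)) sfunNE (sfunDE _ (u2 * sdF2 _)) (sfunME r) (sfunME u2).
have -> : (\sum_k D k r ^+ 2) x = (\sum_k dot (fun l => D k (sdF false l)) (fun l => D k (sdF false l))) x.
  by rewrite !sfun_sumE; apply: eq_bigr => k _; rewrite sfunXE dot_val Dx Drx.
rewrite -addrA => /addrI; rewrite L1 lap_h_val al -nrm_sqr rx => E.
have r0 : 0 < nrm false x by rewrite -rx.
have : nrm false x * u2 x * (h x - nrm false x) = 0.
  move: E; move: (nrm false x) (u2 x) (h x) (eps x) => p q s t E.
  have -> : p * q * (s - p) = p * (q * s - t) - (q * p ^+ 2 - p * t) by ring.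
  by rewrite E subrr.
by move/eqP; rewrite !mulf_eq0 !gt_eqF // subr_gt0.
Qed.

(** Where u does not vanish, one half of the curvature is as long as possible.  Otherwise both
    halves are shorter than h on an open set where, by [no_long_point] and
    [higgs_locally_constant], h is constant; then nabla u is a real multiple of i u, so the
    vorticity vanishes, [gradient_aligned] kills both halves of F, and d^* F = <nabla u, i u> kills
    nabla u, against 0 = lap h = |u|^2 h - |nabla u|^2. *)
Lemma one_half_saturated x : 0 < u2 x -> nrm false x = h x \/ nrm true x = h x.
Proof.
move=> ux; apply: contrapT => /not_orP[x0 x1].
have {}x0 : nrm false x < h x by rewrite lt_neqAle nrm_le andbT; apply/eqP.
have {}x1 : nrm true x < h x by rewrite lt_neqAle nrm_le andbT; apply/eqP.
have N1 := nrm_lt_near x0; have N2 := nrm_lt_near x1.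
have N3 : \forall y \near x, 0 < u2 y := near_gt (sfun_continuous (f := u2) (x := x)) ux.
have N4 : \forall y \near x, nrm false y + nrm true y <= h y.
  apply: filterS3 N1 N2 N3 => y y0 y1 uy; rewrite leNgt; apply/negP.
  exact: no_long_point.
have Dh : \forall y \near x, forall k, D k h y = 0.
  by apply: filterS (near_near N4) => y; exact: higgs_locally_constant.
have fz : \forall y \near x, forall c, nrm c y = 0.
  apply: filterS3 (near_near Dh) N3 (filterI N1 N2) => y Dy uy [y0 y1] c.
  have Dy0 := nbhs_singleton Dy.
  have lz : lap h y = 0.
    by rewrite /lap sfun_sumE big1 // => k _; apply: D_near0; apply: filterS Dy => z.
  have ch : nrm (~~ c) y < h y by case: (c).
  have al := gradient_aligned ch.
  have h0 : 0 < h y by apply: le_lt_trans y0; exact: nrm_ge0.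
  move: al; rewrite sdFW_val /dot big1 => [|k _]; last by rewrite vortex_zero // mulr0.
  move/eqP; rewrite eq_sym mulf_eq0 => /orP[/eqP //|/eqP e0].
  move: lz; rewrite lap_h_val e0 subr0 => /eqP; rewrite mulf_eq0 !gt_eqF //.
have Fz : \forall y \near x, forall j k, F j k y = 0 by apply: filterS fz => y; exact: curv_zero.
have Dx := nbhs_singleton Dh.
have e0 : eps x = 0.
  apply: eps_zero => // k; apply/eqP; rewrite -oppr_eq0 -eq_curv_val sfun_sumE big1 // => j _.
  by apply: D_near0; apply: filterS Fz => y.
have : lap h x = 0.
  by rewrite /lap sfun_sumE big1 // => k _; apply: D_near0; apply: filterS Dh => z.
rewrite lap_h_val e0 subr0 => /eqP; rewrite mulf_eq0 !gt_eqF //.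
by apply: le_lt_trans x0; exact: nrm_ge0.
Qed.

(** * A parallel complex structure *)

Lemma u_nonzero_somewhere : exists x, 0 < u2 x.
Proof.
apply: contrapT => /forallNP H.
have u0 x : u2 x = 0 by apply/eqP; rewrite eq_le normu_ge0 andbT leNgt; apply/negP/H.
have e0 y : 0 <= energy y by have [] := energy_bounds y.
have [y ey] := quadratic_growth_inf e0 C_ge0 growth (divr_gt0 ltr01 (ltr0n R 4)).
have [_ _ hy _ _] := energy_bounds y.
move: hy ey; rewrite higgsf_val u0; move: (energy y) => p *; lra.
Qed.

(* Either |f| = h near a point where u does not vanish, or |f| < h, hence |f'| = h, near a nearby one. *)
Lemma saturated_open : exists c y, \forall z \near y, nrm c z = h z.
Proof.
have [x ux] := u_nonzero_somewhere.
have N : \forall y \near x, 0 < u2 y := near_gt (sfun_continuous (f := u2) (x := x)) ux.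
have [H|H] := pselect (\forall y \near x, nrm false y = h y); first by exists false, x.
have [y [Ny ny]] := exists_box N H; exists true, y.
have {}ny : nrm false y < h y by rewrite lt_neqAle nrm_le andbT; apply/eqP.
apply: filterS2 Ny (nrm_lt_near ny) => z uz nz.
case: (one_half_saturated uz) => [E|E]; last exact: E.
by move: (lt_eqF nz); move/eqP: E => ->.
Qed.

(* Where |f| = h > 0, comparing the Laplacians of |f|^2 and h^2 makes f / h parallel. *)
Lemma saturated_parallel c y : (\forall z \near y, nrm c z = h z) -> 0 < h y -> forall k l,
  h y * D k (sdF c l) y = D k h y * sdF c l y.
Proof.
move=> N h0.
have ny := nbhs_singleton N.
have E2 : \forall z \near y, sdF2 c z = (h * h) z.
  by apply: filterS N => z nz; rewrite -nrm_sqr nz sfunME expr2.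
pose p k := dot (fun l => sdF c l y) (fun l => D k (sdF c l) y).
pose q k := dot (fun l => D k (sdF c l) y) (fun l => D k (sdF c l) y).
have Dp k : p k = h y * D k h y.
  have := D_near k E2; rewrite D_sdF2 sfunMnE dot_val -/(p k) DM (sfunDE (D k h * h)).
  rewrite (sfunME h) (sfunME (D k h)) => E; apply: double_inj; rewrite E.
  by rewrite mulrC mulr2n.
have pq k : h y ^+ 2 * D k h y ^+ 2 <= h y ^+ 2 * q k.
  by rewrite -exprMn -Dp -ny nrm_sqr sdF2_val; exact: cauchy_schwarz.
have h2 : 0 < h y ^+ 2 by rewrite exprn_gt0.
have {}pq k : D k h y ^+ 2 <= q k by have := pq k; rewrite ler_pM2l.
have Lq : \sum_k q k <= \sum_k D k h y ^+ 2.
  have := lap_near E2; rewrite lap_sqr lap_sdF2 !sfunMnE => /double_inj.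
  rewrite (sfunDE _ (h * lap h)) (sfunDE _ (- sdFW _)) sfunNE (sfunDE _ (u2 * sdF2 _)).
  rewrite (sfunME h) (sfunME u2) lap_h_val.
  have -> : (\sum_k dot (fun l => D k (sdF c l)) (fun l => D k (sdF c l))) y = \sum_k q k.
    by rewrite sfun_sumE; apply: eq_bigr => k _; rewrite dot_val.
  have -> : (\sum_k D k h ^+ 2) y = \sum_k D k h y ^+ 2.
    by rewrite sfun_sumE; apply: eq_bigr => k _; rewrite sfunXE.
  have := sdFW_le_nrm c y; rewrite -nrm_sqr ny.
  move: (\sum_k q k) (\sum_k _) (h y) (u2 y) (eps y) (sdFW c y) => *; lra.
have {}Lq := sum_squares_eq pq Lq.
move=> k l; apply: (mulfI (x := h y)); first by rewrite gt_eqF.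
have CS : p k ^+ 2 = dot (fun l => sdF c l y) (fun l => sdF c l y) * q k.
  by rewrite -sdF2_val -nrm_sqr ny -Lq Dp exprMn.
have := cauchy_schwarz_eq CS l; rewrite -/(p k) Dp -sdF2_val -nrm_sqr ny => H.
by rewrite [RHS]mulrA -H expr2 mulrA.
Qed.

Lemma saturated_direction : exists c (v : 'I_3 -> R) y, dot v v = 1 /\
  \forall z \near y, dot (fun k => sdF c k z) v = h z.
Proof.
have [c [y N]] := saturated_open; exists c.
have [H|H] := pselect (\forall z \near y, h z = 0).
  exists (fun k => (k == t0)%:R), y; split; first by rewrite /dot sum3 /= !mulr0 !addr0 mulr1.
  apply: filterS2 N H => z nz hz; rewrite hz in nz.
  by rewrite /dot big1 ?hz // => k _; rewrite (nrm_eq0 nz) mul0r.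
have [z [Nz hz]] := exists_box N H.
have h0 : 0 < h z by rewrite lt_neqAle h_ge0 andbT eq_sym; apply/eqP.
have [g [g0 gE]] := positive_extension h0.
pose q l := sdF c l * invf g0.
have qg l : q l * g = sdF c l by rewrite /q -mulrA invfM mulr1.
have Nh : \forall w \near z, 0 < h w := near_gt (sfun_continuous (f := h) (x := z)) h0.
have Dq l : \forall w \near z, forall k, D k (q l) w = 0.
  apply: filterS3 (near_near Nz) (near_near gE) Nh => w nw gw hw k.
  have := saturated_parallel nw hw k l.
  have -> : sdF c l = q l * g by rewrite qg.
  rewrite DM (sfunDE _ (q l * D k g)) (sfunME (D k (q l))) (sfunME (q l)) (sfunME (q l)).
  rewrite (D_near k gw) (nbhs_singleton gw) => E.
  have : h w ^+ 2 * D k (q l) w = 0.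
    move: E; move: (h w) (D k (q l) w) (q l w) (D k h w) => r s t p E.
    have -> : r ^+ 2 * s = r * (s * r + t * p) - p * (t * r) by ring.
    by rewrite E subrr.
  by move/eqP; rewrite mulf_eq0 expf_eq0 gt_eqF // => /eqP.
have qz l := const_near (Dq l).
have fz w : g w = h w -> (forall l, q l w = q l z) -> forall l, sdF c l w = h w * q l z.
  by move=> gw ql l; rewrite -(qg l) (sfunME (q l)) gw ql mulrC.
have v1 : dot (fun l => q l z) (fun l => q l z) = 1.
  have fE := fz z (nbhs_singleton gE) (fun l => erefl).
  have := sdF2_val c z; rewrite -nrm_sqr (nbhs_singleton Nz).
  have -> : dot (fun l => sdF c l z) (fun l => sdF c l z) =
      dot (fun l => h z * q l z) (fun l => h z * q l z) by apply: eq_bigr => l _; rewrite fE.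
  rewrite dotZr dotC dotZr => E; apply: (mulfI (x := h z ^+ 2)).
    by rewrite expf_eq0 gt_eqF.
  by rewrite [LHS]mulrC mulr1 {2}E mulrC expr2 mulrA.
exists (fun l => q l z), z; split=> //.
apply: filterS2 gE (filterI (qz t0) (filterI (qz t1) (qz t2))) => w gw [q0 [q1 q2]].
have fw := fz w gw _; have {}fw l : sdF c l w = h w * q l z by apply: fw; exact: ord3_case.
transitivity (dot (fun l => q l z) (fun l => h w * q l z)).
  by rewrite dotC; apply: eq_bigr => l _; rewrite fw.
by rewrite dotZr v1 mulr1.
Qed.

(** v is constant with f . v = h near a point.  Then h - f . v >= 0 and
    lap (h - f . v) <= h - f . v, so that f . v = h everywhere; with |f| <= h this gives f = h v,
    and equality in psi . v <= |nabla u|^2 is the first order equation for u. *)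
Lemma vortex_direction : exists c (v : 'I_3 -> R), [/\ dot v v = 1,
  forall x k, sdF c k x = h x * v k &
  forall x j, P j x = \sum_k Jm (sg R c) v j k * Q k x /\
              Q j x = - \sum_k Jm (sg R c) v j k * P k x].
Proof.
have [c [v [z [v1 N]]]] := saturated_direction; exists c, v.
pose f : sfun := \sum_k cstf (v k) * sdF c k.
pose g : sfun := \sum_k cstf (v k) * sdW c k.
have fE y : f y = dot (fun k => sdF c k y) v.
  by rewrite sfun_sumE; apply: eq_bigr => k _; rewrite (sfunME (cstf _)) cstfE mulrC.
have gE y : g y = dot (sd (sg R c) (wedge (fun j => P j y) (fun j => Q j y))) v.
  by rewrite sfun_sumE; apply: eq_bigr => k _; rewrite (sfunME (cstf _)) cstfE sdW_val mulrC.
have ge y : g y <= eps y.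
  by rewrite eps_val -[leRHS]mul1r gE; apply: wedge_le; rewrite ?sg_sqr // v1 expr1n.
have lf : lap f = u2 * f - g.
  rewrite /f /g mulr_sumr -sumrB {1}/lap; under eq_bigr do rewrite !Dsum.
  rewrite exchange_big /=; apply: eq_bigr => k _; rewrite -/(lap (cstf (v k) * sdF c k)) lap_cstM.
  by rewrite lap_sdF; ring.
have lw x : lap (h - f) x = u2 x * (h - f) x - (eps x - g x).
  rewrite lapD lapN lf (sfunDE (lap h)) sfunNE lap_h_val (sfunDE (u2 * f)) (sfunME u2) (sfunDE h) !sfunNE.
  by move: (u2 x) (h x) (f x) (eps x) (g x) => *; ring.
have w0 x : 0 <= (h - f) x.
  by rewrite (sfunDE h) sfunNE fE subr_ge0; exact: curvature_pairing_le.
have u1 x : u2 x <= 1 by have := h_ge0 x; rewrite higgsf_val; move: (u2 x) => *; lra.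
have W x : (h - f) x = 0.
  apply: (@unique_continuation R (h - f) z) => // [y|].
    rewrite lw lerBlDr (@le_trans _ _ ((h - f) y)) ?lerDl ?subr_ge0 //.
    by rewrite -[leRHS]mul1r ler_wpM2r.
  by apply: filterS N => y; rewrite (sfunDE h) sfunNE fE => ->; rewrite subrr.
have hf x : dot (fun k => sdF c k x) v = h x.
  by apply/eqP; rewrite eq_sym -subr_eq0 -fE -sfunNE -sfunDE W.
have E0 x : eps x = g x.
  have : lap (h - f) x = 0.
    have -> : h - f = 0 by apply/sfun_ext => y; rewrite W.
    by rewrite /lap big1 // => k _; rewrite !D0.
  by rewrite lw W mulr0 sub0r => /eqP; rewrite oppr_eq0 subr_eq0 => /eqP.
split=> // [x k|x j].
  pose y l := sdF c l x - h x * v l.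
  have Y : dot y y <= 0.
    have -> : dot y y = dot (fun l => sdF c l x) (fun l => sdF c l x)
       - 2 * h x * dot (fun l => sdF c l x) v + h x ^+ 2 * dot v v.
      by rewrite /y /dot !sum3; move: (sdF c t0 x) (sdF c t1 x) (sdF c t2 x) (h x) => *; ring.
    have [_ le] := curvature_le c x; rewrite hf v1 -sdF2_val.
    by move: le; move: (sdF2 c x) (h x) => *; lra.
  apply/eqP; rewrite -subr_eq0 -/(y k) -sqrf_eq0 eq_le sqr_ge0 andbT (le_trans _ Y) // expr2.
  by apply: (le_sum_term (f := fun k => y k * y k)) => l; rewrite -expr2 sqr_ge0.
have := sqsum_rot 1 v (fun j => P j x) (fun j => Q j x) (sg_sqr R c).
rewrite -gE -E0 -eps_val v1.
have -> : (1 ^+ 2 + 1) * eps x - (1 * eps x) *+ 2 = 0 by ring.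
move/sqsum_eq0/(_ j) => [].
by rewrite /rotP /rotQ !mul1r => /eqP; rewrite subr_eq0 => /eqP -> /eqP; rewrite addr_eq0 => /eqP.
Qed.

End StabilityInequality.

(** * The vortex equations *)

Section ComplexStructure.
Local Open Scope complex_scope.
Variable R : realType.
Local Notation V := 'rV[R]_4.
Variables (c : bool) (v : 'I_3 -> R).
Hypothesis v1 : dot v v = 1.

Definition Jmat : 'M[R]_4 := \matrix_(i, j) Jm (sg R c) v i j.

Lemma mulJ (X : V) k : (X *m Jmat) 0 k = \sum_j X 0 j * Jm (sg R c) v j k.
Proof. by rewrite mxE; apply: eq_bigr => j _; rewrite mxE. Qed.

Lemma sum_mulJ (X : V) (p q : 'I_4 -> R) : (forall j, q j = \sum_k Jm (sg R c) v j k * p k) ->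
  \sum_k (X *m Jmat) 0 k * p k = \sum_j X 0 j * q j.
Proof.
move=> qE; under eq_bigr do rewrite mulJ mulr_suml; rewrite exchange_big /=.
by apply: eq_bigr => j _; rewrite qE mulr_sumr; apply: eq_bigr => k _; rewrite mulrA.
Qed.

Lemma Jmat_sqr (X : V) : X *m Jmat *m Jmat = - X.
Proof.
apply/rowP => l; rewrite mulJ; under eq_bigr do rewrite mulJ.
by rewrite (Jm_sqr v (fun j => X 0 j)) ?sg_sqr // v1 mul1r mxE.
Qed.

Lemma Jmat_complex_structure : orthogonal_complex_structure Jmat.
Proof.
split=> [X Y|X]; last exact: Jmat_sqr.
rewrite -[RHS]mul1r -{1}v1 /euclid /dot !sum4 !mulJ !sum4 !sum3 !JmE.
have s1 := sg_sqr R c; move: (sg R c) s1 => s s1.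
move: (X 0 o0) (X 0 o1) (X 0 o2) (X 0 o3) (Y 0 o0) (Y 0 o1) (Y 0 o2) (Y 0 o3).
move: (v t0) (v t1) (v t2) => *; ring: s1.
Qed.

Lemma kahler_Jmat j k : kahler_form Jmat j k = Jm (sg R c) v j k.
Proof.
rewrite mxE euclid_coordvec mulJ (bigD1 j) //= mxE !eqxx mul1r big1 ?addr0 // => i ij.
by rewrite mxE (negbTE ij) andbF mul0r.
Qed.

Variables (F : 'M[R]_4) (h : R).
Hypothesis FN : forall j k, F j k = - F k j.
Hypothesis sdFE : forall k, sd (sg R c) (fun i j => F i j) k = h * v k.

Let F_diag i : F i i = 0. Proof. by have := FN i i; lra. Qed.

Let F01 : F o0 o1 = h * v t0 - sg R c * F o2 o3.
Proof. by rewrite -sdFE sdE addrK. Qed.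
Let F02 : F o0 o2 = h * v t1 + sg R c * F o1 o3.
Proof. by rewrite -sdFE sdE subrK. Qed.
Let F03 : F o0 o3 = h * v t2 - sg R c * F o1 o2.
Proof. by rewrite -sdFE sdE addrK. Qed.

(* The three components of F along the forms of the same orientation are h v, and |v| = 1. *)
Lemma Lambda_Jmat : Lambda Jmat F = h.
Proof.
rewrite /Lambda inner2E !kahler_Jmat !JmE F01 F02 F03.
rewrite -[RHS]mulr1 -v1 /dot sum3; ring.
Qed.

(* F splits into h / 2 times J and a form of the opposite orientation, and both commute with J. *)
Lemma eval2_Jmat (X Y : V) : eval2 F (X *m Jmat) Y = - eval2 F X (Y *m Jmat).
Proof.
rewrite /eval2 !sum4 !mulJ !sum4 !JmE !F_diag.
rewrite (FN o1 o0) (FN o2 o0) (FN o3 o0) (FN o2 o1) (FN o3 o1) (FN o3 o2) F01 F02 F03.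
have s1 := sg_sqr R c; move: (sg R c) s1 => s s1.
move: (F o1 o2) (F o1 o3) (F o2 o3).
move: (X 0 o0) (X 0 o1) (X 0 o2) (X 0 o3) (Y 0 o0) (Y 0 o1) (Y 0 o2) (Y 0 o3).
move: (v t0) (v t1) (v t2) => *; ring: s1.
Qed.

Lemma eval2N (X Y : V) : eval2 F X (- Y) = - eval2 F X Y.
Proof.
rewrite /eval2 -sumrN; apply: eq_bigr => j _; rewrite -sumrN; apply: eq_bigr => k _.
by rewrite mxE mulrN.
Qed.

Lemma part02_Jmat (X Y : V) : part02 Jmat F X Y = 0.
Proof.
rewrite /part02 /part01 !eval2_Jmat Jmat_sqr eval2N opprK.
move: (eval2 F X Y) (eval2 F X (Y *m Jmat)) => p q.
by apply/eqP; rewrite eq_complex /=; apply/andP; split; apply/eqP; ring.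
Qed.

End ComplexStructure.

Lemma cs_second_var (R : realType) (a b : sfun R) A p q (G : 'I_4 -> sfun R) :
  cs p -> cs q -> (forall j, cs (G j)) -> cs (second_var a b A p q G).
Proof.
move=> cp cq cG; rewrite /second_var.
apply: csD; last by apply/csN/csMl/csD; exact: csMr.
apply: csD; last by apply/cs_sqr/csD; exact: csMl.
apply: csD; last first.
  apply/csMl/cs_sum => j; apply: cs_sum => k; apply/cs_sqr/csD; first exact: cs_der.
  exact/csN/cs_der.
apply: csD; last by apply/csN/csMn/cs_sum => j; apply: csD; [exact: csMl|exact/csN/csMl].
apply: cs_sum => j; apply: csD; apply/cs_sqr; apply: csD.
- by apply: csD; [exact: cs_der|exact: csMl].
- exact: csMr.
- by apply: csD; [exact: cs_der|exact/csN/csMl].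
- exact/csN/csMr.
Qed.

Lemma cs_family (R : realType) (G : 'I_4 -> sfun R) : (forall j, cs (G j)) ->
  exists M, forall j, supp_in M (G j).
Proof.
move=> /choice[M GM]; exists (\sum_j `|M j|) => j x [k kM]; apply: (GM j); exists k.
apply: le_lt_trans kM; apply: le_trans (ler_norm _) _.
by rewrite (bigD1 j) //= lerDl sumr_ge0.
Qed.

Section Main.
Local Open Scope complex_scope.
Variable R : realType.
Local Notation V := 'rV[R]_4.

Lemma stable_second_var (u : V -> R[i]) (A : V -> V) (a b : sfun R) (A' : 'I_4 -> sfun R) :
  (forall x j, A x 0 j = A' j x) -> (forall x, u x = a x +i* b x) -> ymh_stable u A ->
  forall p q (G : 'I_4 -> sfun R), cs p -> cs q -> (forall j, cs (G j)) ->
  0 <= int4 (second_var a b A' p q G).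
Proof.
move=> AE uE st p q G cp cq cG.
rewrite -lee_fin -int4_integral4; last exact: cs_second_var.
have -> : sfun_val (second_var a b A' p q G) =
    second_variation_density u A (fun y => p y +i* q y) (fun y => \row_j G j y).
  by apply/funext => x; rewrite (second_variation_densityE AE uE).
apply: st.
- by split; exact: sfun_smooth.
- move=> j; have -> : (fun x : V => (\row_i G i x : V) 0 j) = G j by apply/funext => x; rewrite mxE.
  exact: sfun_smooth.
- have [M pM] := cp; have [N qN] := cq.
  apply: (@compactly_supported_bounded _ _ _ (Num.max M N)) => x [k].
  by rewrite gt_max => /andP[kM kN]; rewrite pM ?qN //; exists k.
- have [M GM] := cs_family cG.
  apply: (@compactly_supported_bounded _ _ _ M) => x xM.
  by apply/rowP => j; rewrite !mxE GM.
Qed.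

Lemma nabla_dir (u : V -> R[i]) (A : V -> V) (a b : sfun R) (A' : 'I_4 -> sfun R) x X :
  (forall x j, A x 0 j = A' j x) -> (forall x, u x = a x +i* b x) ->
  nabla A u x X = (\sum_k X 0 k * covP a b A' k x) +i* (\sum_k X 0 k * covQ a b A' k x).
Proof.
move=> AE uE; rewrite /nabla /dirderiv.
have -> : (fun y => complex.Re (u y)) = a by apply/funext => y; rewrite uE.
have -> : (fun y => complex.Im (u y)) = b by apply/funext => y; rewrite uE.
rewrite !derive_dir uE /euclid.
have P k : X 0 k * covP a b A' k x = X 0 k * D k a x + A x 0 k * X 0 k * b x.
  by rewrite (sfunDE (D k a)) sfunME AE; ring.
have Q k : X 0 k * covQ a b A' k x = X 0 k * D k b x - A x 0 k * X 0 k * a x.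
  by rewrite (sfunDE (D k b)) sfunNE sfunME AE; ring.
rewrite (eq_bigr _ (fun k _ => P k)) (eq_bigr _ (fun k _ => Q k)) big_split sumrB -!mulr_suml.
move: (\sum_k A x 0 k * X 0 k) (\sum_k _) (\sum_k _) (a x) (b x) => s p q r t.
by apply/eqP; rewrite eq_complex /=; apply/andP; split; apply/eqP; ring.
Qed.
End Main.

Local Open Scope complex_scope.

Theorem theorem1 (R : realType) (u : 'rV[R]_4 -> R[i]) (A : 'rV[R]_4 -> 'rV[R]_4)
    (u_smooth : smooth_fun u) (A_smooth : smooth_form A)
    (uA_solution : ymh_solution u A) (uA_stable : ymh_stable u A)
    (uA_growth : exists C : R, 0 < C /\ forall r : R, 1 <= r ->
      (integral4 (euclid_ball r) (energy_density u A) <= (C * r ^+ 2)%:E)%E) :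
  exists J : 'M[R]_4,
    orthogonal_complex_structure J /\ vortex_equations u A J.
Proof.
have [su1 su2] := u_smooth.
pose a := mk_sfun su1; pose b := mk_sfun su2; pose A' j := mk_sfun (A_smooth j).
have AE x j : A x 0 j = A' j x by [].
have uE x : u x = a x +i* b x by rewrite /a /b /=; case: (u x).
have [eq_re eq_im eq_curv] := ymh_equations AE uE uA_solution.
have stable := stable_second_var AE uE uA_stable.
have [C [C0 growth]] := uA_growth.
have {}growth (r : R) : 1 <= r -> (integral4 (euclid_ball r) (energy a b A') <= (C * r ^+ 2)%:E)%E.
  move=> /growth; congr (integral4 _ _ <= _)%E; apply/funext => x.
  by rewrite (energy_densityE AE uE) energy_val sdF2E.
have [c [v [v1 Fv PQ]]] := vortex_direction eq_re eq_im eq_curv stable (ltW C0) growth.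
exists (Jmat c v); split; first exact: Jmat_complex_structure.
move=> x.
have FN j k : dform A x j k = - dform A x k j.
  by rewrite !(dformE AE) /curv !(sfunDE, sfunNE) opprB.
have sdFE k : sd (sg R c) (fun i j => dform A x i j) k = higgs u x * v k.
  rewrite (higgsE uE) -Fv /sdF sd_val; congr (sd _ _ k).
  by apply/funext => i; apply/funext => j; rewrite (dformE AE).
split=> [X|X Y|].
- rewrite /part01 !(nabla_dir _ _ AE uE).
  rewrite (sum_mulJ X (p := fun k => covQ a b A' k x) (fun j => (PQ x j).1)).
  rewrite (sum_mulJ X (p := fun k => covP a b A' k x) (q := fun j => - covQ a b A' j x)); last first.
    by move=> j; rewrite (PQ x j).2 opprK.
  have -> : \sum_j X 0 j * - covQ a b A' j x = - \sum_j X 0 j * covQ a b A' j x.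
    by rewrite -sumrN; apply: eq_bigr => j _; rewrite mulrN.
  move: (\sum_j X 0 j * covP a b A' j x) (\sum_j X 0 j * covQ a b A' j x) => p q.
  by rewrite mul_i; apply/eqP; rewrite eq_complex /=; apply/andP; split; apply/eqP; ring.
- by apply: (@part02_Jmat R c v v1 _ (higgs u x)).

- by apply: (@Lambda_Jmat R c v v1 _ (higgs u x)).
Qed.
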